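(* Let $E\subset\mathbb R$ be compact with $\dim_{\mathcal H}(E)>3/4$. Then the set of cross ratios of four-tuples of points of $E$, $$\mathrm{Cross}(E)=\left\{[x_1,x_2;x_3,x_4]=\frac{(x_3-x_1)(x_4-x_2)}{(x_3-x_2)(x_4-x_1)} : x_1,x_2,x_3,x_4\in E\right\}\subset\mathbb R,$$ (taken over those four-tuples for which the expression is defined) contains an open interval.
   Context: $\dim_{\mathcal H}$ denotes Hausdorff dimension. *)

(* Defs.v *)
From HB Require Import structures.
From mathcomp Require Import all_boot all_order all_algebra.
From mathcomp Require Import all_classical all_reals all_analysis.
Set Implicit Arguments. Unset Strict Implicit. Unset Printing Implicit Defensive.
Import Order.TTheory GRing.Theory Num.Theory.
Import numFieldNormedType.Exports.
Local Open Scope classical_set_scope.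
Local Open Scope ring_scope.

(* diameter of a set of reals (extended real; -oo for the empty set) *)
Definition diam {R : realType} (A : set R) : \bar R :=
  ereal_sup [set (`|x - y|)%:E | x in A & y in A].

Definition hcontrib {R : realType} (s : R) (A : set R) : \bar R :=
  if `[< A = set0 >] then 0%E else ((fine (diam A)) `^ s)%:E.

Definition hausdorff_delta {R : realType} (s delta : R) (E : set R) : \bar R :=
  ereal_inf [set (\sum_(0 <= i <oo) hcontrib s (F i))%E
            | F in [set F : nat -> set R |
                     E `<=` \bigcup_i F i /\ forall i, (diam (F i) <= delta%:E)%E]].

Definition hausdorff_measure {R : realType} (s : R) (E : set R) : \bar R :=
  ereal_sup [set hausdorff_delta s delta E | delta in [set d : R | 0 < d]].

Definition hausdorff_dim {R : realType} (E : set R) : \bar R :=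
  ereal_inf [set s%:E | s in [set s : R | 0 <= s /\ hausdorff_measure s E = 0%E]].

Definition cross_ratio {R : realType} (x1 x2 x3 x4 : R) : R :=
  ((x3 - x1) * (x4 - x2)) / ((x3 - x2) * (x4 - x1)).

Definition Cross {R : realType} (E : set R) : set R :=
  [set r | exists x1 x2 x3 x4, [/\ E x1, E x2, E x3 & E x4] /\
           (x3 - x2) * (x4 - x1) != 0 /\ r = cross_ratio x1 x2 x3 x4].

(* Main.v *)
Require Import Defs.
From HB Require Import structures.
From mathcomp Require Import all_boot all_order all_algebra.
From mathcomp Require Import ring lra zify finmap.
From mathcomp Require Import all_classical all_reals all_analysis.
Import Order.TTheory GRing.Theory Num.Theory.
Import numFieldNormedType.Exports.
Set Implicit Arguments. Unset Strict Implicit. Unset Printing Implicit Defensive.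
Local Open Scope classical_set_scope.
Local Open Scope ring_scope.

(** Put P_t(x1,x2,x3,x4) = (x3-x1)(x4-x2) - t (x3-x2)(x4-x1), so that t is a cross ratio of points of E
    when P_t vanishes at four separated points of E. Since dim E > 3/4, four distinct points of E have
    neighbourhoods in E carrying s-Frostman measures mu1, ..., mu4 for some s > 3/4, discretised here on
    dyadic grids. Let f be a bump function and let nu_n(t) be the integral of 2^n f(2^n P_t) against
    mu1 x mu2 in (x1,x2) and against the densities of mu3, mu4 at scale 2^-n in (x3,x4).

    The difference nu_n(t) - nu_{n+1}(t) involves oscillating profiles, i.e. derivatives of bump
    functions. By Cauchy-Schwarz in (x3,x4) it is controlled by the correlations of thickened level curves
    {P_t(x1,x2,.,.) = 0} and {P_t(y1,y2,.,.) = 0}. If (x1,x2) and (y1,y2) are at distance r, these curves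
    cross at an angle of order r, and summation by parts along one of them bounds the correlation by
    2^{-3n} / r^2. Summing over mu1 x mu2 and using the bounds 2^{n(1-s)} for the densities gives
    |nu_n(t) - nu_{n+1}(t)| <= C 2^{n(3/2-2s)}, which is summable exactly when s > 3/4.

    At a fixed coarse scale nu_n is Lipschitz in t and bounded below at some point of a fixed finite grid
    of values of t. Hence for one of these points, for all t in a fixed neighbourhood of it and for
    infinitely many N, nu_N(t) > 0, i.e. P_t has 2^-N-approximate zeros on E; compactness concludes. *)

(** * Compactly supported profiles *)

(** The oscillation is essential. Two level strips of width [e = 2^-n] crossing at angle [r] overlap
    in area [e^2 / r]; summed over mu1 x mu2 this is of order [e^2], and absolute values would bound
    |nu_n - nu_{n+1}| only by a growing power of 2^n. The gained factor [e / r] makes the pairs at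
    distance [r ~ e] dominate as soon as s < 1, and the energy drops to 2^{-n(1+2s)}. With a product
    of densities of size 2^{2n(1-s)}, Cauchy-Schwarz and the normalisation 2^n then give the
    exponent 3/2-2s. Cauchy-Schwarz in (x3,x4) needs bounded densities, hence the averaging of mu3
    and mu4 at scale 2^-n. Passing from n to n+1 changes these densities too; the change has mean
    zero on each dyadic interval, so it tests a derivative of the field, which is again an
    oscillating profile. No limit measure is taken: the measures depend on a last scale N, the
    constants do not, and only points of E pass to the limit. Integrals and derivatives become
    finite sums and finite differences, and the estimates hold over any real field. *)

Section Bump.
Variable R : realFieldType.
Implicit Types (p : {poly R}) (u v h : R) (f g : R -> R).

(** A quantitative form of [f' = g] that makes sense over any ordered field; it is what finite
    differences on a grid consume. *)
Definition taylor1 (B : R) f g :=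
  forall u h, `|f (u + h) - f u - h * g u| <= B * h ^+ 2.
Definition bounded_by (B : R) f := forall u, `|f u| <= B.
Definition unit_supp f := forall u, 1 <= `|u| -> f u = 0.

Lemma taylor1_weaken B B' f g : B <= B' -> taylor1 B f g -> taylor1 B' f g.
Proof. by move=> BB' H u h; rewrite (le_trans (H u h))// ler_wpM2r// sqr_ge0. Qed.

Lemma bounded_weaken B B' f : B <= B' -> bounded_by B f -> bounded_by B' f.
Proof. by move=> BB' H u; rewrite (le_trans (H u)). Qed.

Definition clamp u := if u <= -1 then -1 else if 1 <= u then 1 else u.

Lemma clamp_range u : `|clamp u| <= 1.
Proof.
by rewrite /clamp; case: (leP u (-1)) => ?; [|case: (leP 1 u) => ?];
  rewrite ler_norml; apply/andP; split; lra.
Qed.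

Lemma clamp_ge u : 1 <= u -> clamp u = 1.
Proof. by rewrite /clamp => ?; case: (leP u (-1)) => ?; [|case: (leP 1 u) => ?]; lra. Qed.

Lemma clamp_le u : u <= -1 -> clamp u = -1.
Proof. by rewrite /clamp => ->. Qed.

Lemma clamp_id u : `|u| <= 1 -> clamp u = u.
Proof.
rewrite ler_norml /clamp => /andP[? ?].
by case: (leP u (-1)) => ?; [|case: (leP 1 u) => ?]; lra.
Qed.

Lemma clamp_lip u v : `|clamp u - clamp v| <= `|u - v|.
Proof.
rewrite /clamp; case: (leP u (-1)) => ?; [|case: (leP 1 u) => ?];
  (case: (leP v (-1)) => ?; [|case: (leP 1 v) => ?]);
  rewrite ler_norml; have := ler_norm (u - v);
  have := ler_norm (v - u); rewrite distrC => ? ?; apply/andP; split; lra.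
Qed.

Lemma poly_bounded p : exists2 C, 0 <= C & forall u, `|u| <= 1 -> `|p.[u]| <= C.
Proof.
elim/poly_ind: p => [|p c [C C0 HC]].
  by exists 0 => // u _; rewrite horner0 normr0.
exists (C + `|c|) => [|u u1]; first by rewrite addr_ge0.
rewrite hornerMXaddC (le_trans (ler_normD _ _))// lerD2r normrM.
by rewrite -[C]mulr1 ler_pM // HC.
Qed.

Lemma poly_taylor p : exists2 C, 0 <= C & forall u v, `|u| <= 1 -> `|v| <= 1 ->
  `|p.[v] - p.[u] - (v - u) * p^`().[u]| <= C * (v - u) ^+ 2.
Proof.
elim/poly_ind: p => [|p c [C C0 HC]].
  by exists 0 => // u v _ _; rewrite deriv0 !horner0 mulr0 mul0r !subr0 normr0.
have [D D0 HD] := poly_bounded p^`().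
exists (C + D) => [|u v u1 v1]; first exact: addr_ge0.
rewrite !hornerMXaddC derivD derivC addr0 derivM derivX mulr1 hornerD hornerMX.
set a := p.[u]; set b := p.[v]; set d := p^`().[u].
have -> : b * v + c - (a * u + c) - (v - u) * (d * u + a) =
  (b - a - (v - u) * d) * v + d * (v - u) ^+ 2 by ring.
rewrite (le_trans (ler_normD _ _))// [leRHS]mulrDl lerD //.
  by rewrite normrM -[leRHS]mulr1 ler_pM // HC.
by rewrite normrM [X in _ * X]ger0_norm ?sqr_ge0// ler_wpM2r ?sqr_ge0// HD.
Qed.

Lemma poly_lip p : exists2 C, 0 <= C & forall u v, `|u| <= 1 -> `|v| <= 1 ->
  `|p.[v] - p.[u]| <= C * `|v - u|.
Proof.
have [C C0 HC] := poly_taylor p; have [D D0 HD] := poly_bounded p^`().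
exists (C * 2 + D) => [|u v u1 v1]; first by rewrite addr_ge0// mulr_ge0.
have -> : p.[v] - p.[u] =
  (p.[v] - p.[u] - (v - u) * p^`().[u]) + (v - u) * p^`().[u] by ring.
rewrite (le_trans (ler_normD _ _))// [leRHS]mulrDl lerD //.
  rewrite (le_trans (HC _ _ u1 v1))// -mulrA ler_wpM2l//.
  rewrite -(real_normK (num_real (v - u))) expr2 ler_wpM2r//.
  by rewrite (le_trans (ler_normB _ _))//; lra.
by rewrite normrM mulrC ler_wpM2r// HD.
Qed.

(** Composing with [clamp] extends a polynomial from [-1, 1] by constants. If its derivative
    vanishes at both ends, the extension still has a Lipschitz derivative. *)
Definition glue p u := p.[clamp u].

Lemma glue_bounded p : exists2 C, 0 <= C & bounded_by C (glue p).
Proof.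
have [C C0 HC] := poly_bounded p.
by exists C => // u; apply/HC/clamp_range.
Qed.

Lemma glue_supp p : p.[1] = 0 -> p.[-1] = 0 -> unit_supp (glue p).
Proof.
move=> p1 pN1 u; rewrite ler_normr /glue => /orP[/clamp_ge->//|u1].
by rewrite clamp_le//; lra.
Qed.

Lemma glue_taylor p : p^`().[1] = 0 -> p^`().[-1] = 0 ->
  exists2 C, 0 <= C & taylor1 C (glue p) (glue p^`()).
Proof.
move=> p1 pN1.
have [C C0 HC] := poly_taylor p; have [D D0 HD] := poly_lip p^`().
exists (C + D) => [|u h]; first exact: addr_ge0.
rewrite /glue; set v := u + h; have -> : h = v - u by rewrite /v; ring.
have -> : p.[clamp v] - p.[clamp u] - (v - u) * p^`().[clamp u] =
  (p.[clamp v] - p.[clamp u] - (clamp v - clamp u) * p^`().[clamp u])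
  + ((clamp v - clamp u) - (v - u)) * p^`().[clamp u] by ring.
rewrite (le_trans (ler_normD _ _))// [leRHS]mulrDl lerD //.
  rewrite (le_trans (HC _ _ (clamp_range _) (clamp_range _)))// ler_wpM2l//.
  by rewrite -(real_normK (num_real (_ - _))) -[leRHS](real_normK (num_real _));
     rewrite lerXn2r ?nnegrE// clamp_lip.
have [u1|u1] := leP 1 `|u|.
  by rewrite -/(glue _ _) glue_supp// mulr0 normr0 mulr_ge0// sqr_ge0.
rewrite (clamp_id (ltW u1)).
have [v1|v1] := lerP `|v| 1.
  by rewrite clamp_id// subrr mul0r normr0 mulr_ge0// sqr_ge0.
rewrite -(real_normK (num_real (v - u))) expr2 mulrA normrM mulrC.
(* With [u] inside and [v] outside, clamping moves [v] by at most [|v - u|], and the derivative at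
   [u] is at most [D * |v - u|] because it vanishes at the endpoint that is crossed. *)
have a1 : `|clamp v - u - (v - u)| <= `|v - u|.
  move: u1 v1; rewrite ltr_norml lter_normr => /andP[u1 u2] /orP[v1|v1].
    by rewrite clamp_ge ?(ltW v1)// ler0_norm ?ger0_norm; lra.
  by rewrite clamp_le; [rewrite ger0_norm ?ler0_norm; lra | lra].
have a2 : `|p^`().[u]| <= D * `|v - u|.
  move: (u1) v1; rewrite ltr_norml lter_normr => /andP[w1 w2] /orP[v1|v1].
    have := HD 1 u; rewrite p1 subr0 normr1 => /(_ (lexx _) (ltW u1)) H.
    by apply: (le_trans H); rewrite ler_wpM2l// ler0_norm ?ger0_norm; lra.
  have := HD (-1) u; rewrite pN1 subr0 normrN1 => /(_ (lexx _) (ltW u1)) H.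
  by apply: (le_trans H); rewrite ler_wpM2l// ger0_norm ?ler0_norm; lra.
by rewrite ler_pM.
Qed.

Lemma cube_half u : `|u| <= 2^-1 -> 4^-1 <= (1 - u ^+ 2) ^+ 3.
Proof.
rewrite ler_norml => /andP[h1 h2]; set v := 1 - _.
have h3 : 3/4 <= v by rewrite /v; nra.
have -> : v ^+ 3 = v * (v * v) by ring.
have h4 : 9/16 <= v * v by nra.
nra.
Qed.

Lemma bump_exists : exists B : R, exists F f f1 f2 : R -> R,
  [/\ 1 <= B,
      [/\ taylor1 B F f, taylor1 B f f1 & taylor1 B f1 f2],
      [/\ bounded_by B F, bounded_by B f, bounded_by B f1 & bounded_by B f2],
      [/\ (forall u, 1 <= u -> F u = F 1), (forall u, u <= -1 -> F u = F (-1)),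
          unit_supp f, unit_supp f1 & unit_supp f2] &
      (forall u, 0 <= f u) /\ (forall u, `|u| <= 2^-1 -> 4^-1 <= f u)].
Proof.
(* [p] is the antiderivative of [(1 - u^2)^3]. The exponent 3 makes the bump and its first two
   derivatives vanish at 1 and -1, so that the three pairs [p, p1], [p1, p2] and [p2, p3] can all be
   glued. *)
pose p : {poly R} := 'X - 'X^3 + (3/5)%:P * 'X^5 - (1/7)%:P * 'X^7.
pose b : {poly R} := 1 - 'X^2; pose p1 := b ^+ 3; pose p2 := p1^`(); pose p3 := p2^`().
have Dp : p^`() = p1.
  have c5 : (3/5)%:P * 5 = 3 :> {poly R}.
    by rewrite -!polyC_natr -polyCM; congr (_%:P); field.
  have c7 : (1/7)%:P * 7 = 1 :> {poly R}.
    by rewrite -!polyC_natr -polyCM; congr (_%:P); field.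
  rewrite /p /p1 !(poly.derivE, derivM) /=.
  transitivity (1 - 3 * 'X^2 + ((3/5)%:P * 5) * 'X^4 - ((1/7)%:P * 7) * 'X^6 : {poly R}).
    by ring.
  by rewrite c5 c7 mul1r /b; ring.
have b1 : b.[1] = 0 by rewrite /b !hornerE; ring.
have bN1 : b.[-1] = 0 by rewrite /b !hornerE; ring.
have Hp1 u : p1.[u] = (1 - u ^+ 2) ^+ 3 by rewrite /p1 /b !hornerE; ring.
have Dp1 : p2 = b^`() * b ^+ 2 *+ 3 by rewrite /p2 /p1 deriv_exp.
have Dp2 : p3 = (b^`()^`() * b ^+ 2 + b^`() * (b^`() * b *+ 2)) *+ 3.
  by rewrite /p3 Dp1 derivMn derivM deriv_exp.
have [p1z p1z'] : p1.[1] = 0 /\ p1.[-1] = 0 by rewrite !Hp1; split; ring.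
have [p2z p2z'] : p2.[1] = 0 /\ p2.[-1] = 0.
  by split; rewrite Dp1 hornerMn hornerM horner_exp ?b1 ?bN1 expr0n mulr0 mul0rn.
have [p3z p3z'] : p3.[1] = 0 /\ p3.[-1] = 0.
  by rewrite Dp2; split; rewrite hornerMn hornerD !hornerM !hornerMn !hornerM
    ?b1 ?bN1 !(mulr0, mul0rn, addr0).
have [|| T0 T00 HT0] := @glue_taylor p; rewrite ?Dp//.
have [|| T1 T10 HT1] := @glue_taylor p1; rewrite -/p2//.
have [|| T2 T20 HT2] := @glue_taylor p2; rewrite -/p3//.
rewrite Dp in HT0; rewrite -/p2 in HT1; rewrite -/p3 in HT2.
have [B0 B00 HB0] := glue_bounded p.
have [B1 B10 HB1] := glue_bounded p1.
have [B2 B20 HB2] := glue_bounded p2.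
have [B3 B30 HB3] := glue_bounded p3.
exists (1 + (T0 + T1 + T2 + B0 + B1 + B2 + B3)), (glue p), (glue p1), (glue p2), (glue p3).
split; first lra.
- by split; [apply: taylor1_weaken HT0|apply: taylor1_weaken HT1|apply: taylor1_weaken HT2]; lra.
- by split; [apply: bounded_weaken HB0|apply: bounded_weaken HB1|apply: bounded_weaken HB2
    |apply: bounded_weaken HB3]; lra.
- split; try exact: glue_supp; move=> u hu.
    by rewrite /glue !clamp_ge.
  by rewrite /glue !clamp_le.
split=> u; rewrite /glue Hp1; first have := clamp_range u.
  by rewrite ler_norml => /andP[h1 h2]; apply: exprn_ge0; nra.
move=> hu; rewrite clamp_id; last by apply: le_trans hu _; lra.
exact: cube_half.
Qed.

End Bump.

(** * Correlations of two level sets *)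

Section Counting.
Variable R : realFieldType.

Lemma count_spread (c : pred nat) (L : nat) (A : R) : 0 <= A ->
  (forall i j, (i <= j < L)%N -> c i -> c j -> (j - i)%:R <= A) ->
  \sum_(i < L) (c i)%:R <= A + 1.
Proof.
move=> A0 H; pose s n : R := \sum_(i < n) (c i)%:R.
(* The invariant remembers the first and the last marked index; all marked ones lie between them. *)
suff K n : s n = 0 \/ exists i j, [/\ (i <= j < n)%N, c i, c j & s n <= (j - i)%:R + 1].
  case: (K L) => [|[i [j [ij ci cj /le_trans->//]]]]; last by rewrite lerD2r H.
  by rewrite /s => ->; lra.
elim: n => [|n [IH|[i [j [/andP[ij jn] ci cj IH]]]]]; first by left; rewrite /s big_ord0.
  have E : s n.+1 = (c n)%:R by rewrite /s big_ord_recr /= -/(s n) IH add0r.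
  rewrite E; case cn : (c n); last by left.
  by right; exists n, n; rewrite leqnn ltnSn subnn add0r.
have E : s n.+1 = s n + (c n)%:R by rewrite /s big_ord_recr.
right; rewrite E; case cn : (c n).
  exists i, n; split => //; first by rewrite (leq_trans ij (ltnW jn)) ltnSn.
  by rewrite lerD2r (le_trans IH)// natr1 ler_nat -subSn// leq_sub2r.
by exists i, j; split; rewrite ?ij ?addr0 // leqW.
Qed.

(** Project to the second coordinate: at most [A + 1] rows are occupied, and each holds at most
    [A' + 1] points. *)
Lemma count_spread2 (c : nat -> nat -> bool) (L : nat) (A A' : R) :
  0 <= A -> 0 <= A' ->
  (forall i i' j j', (j <= j' < L)%N -> (i < L)%N -> (i' < L)%N ->
     c i j -> c i' j' -> (j' - j)%:R <= A) ->
  (forall i i' j, (i <= i' < L)%N -> (j < L)%N -> c i j -> c i' j -> (i' - i)%:R <= A') ->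
  \sum_(j < L) \sum_(i < L) (c i j)%:R <= (A + 1) * (A' + 1).
Proof.
move=> A0 A'0 Hj Hi; pose d j := [exists i : 'I_L, c i j].
apply: (@le_trans _ _ (\sum_(j < L) (d j)%:R * (A' + 1))).
  apply: ler_sum => j _; case dj : (d j).
    by rewrite mul1r; apply: (@count_spread (c^~ j)) => // i i' ii; apply: Hi.
  rewrite mul0r big1 // => i _; case cij : (c i j) => //.
  by move/existsP: dj; case; exists i.
rewrite -mulr_suml ler_wpM2r ?addr_ge0//; apply: count_spread => // i j ij.
by move=> /existsP[k ck] /existsP[l cl]; apply: (Hj k l).
Qed.

(** Summation by parts; the vanishing of [a] at both ends leaves no boundary term. *)
Lemma abel_bound (a G : nat -> R) (L : nat) (D : R) :
  a 0 = 0 -> a L = 0 -> (forall i, (i < L)%N -> `|a i.+1 - a i| <= D) ->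
  `|\sum_(i < L) a i * (G i.+1 - G i)| <= D * \sum_(i < L) `|G i.+1|.
Proof.
move=> a0 aL HD.
have -> : \sum_(i < L) a i * (G i.+1 - G i) = \sum_(i < L) (a i - a i.+1) * G i.+1.
  apply/eqP; rewrite -subr_eq0 -sumrB; under eq_bigr => i _.
    have -> : a i * (G i.+1 - G i) - (a i - a i.+1) * G i.+1 =
      a i.+1 * G i.+1 - a i * G i by ring.
    over.
  by rewrite -(big_mkord xpredT (fun i => a i.+1 * G i.+1 - a i * G i)) telescope_sumr// a0 aL !mul0r subrr.
rewrite mulr_sumr (le_trans (ler_norm_sum _ _ _))// ler_sum// => i _.
by rewrite normrM distrC ler_wpM2r// HD.
Qed.

Lemma lip_prod4 (B d r w w' m m' t t' k k' : R) : 1 <= B -> 0 <= d -> 0 < r ->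
  `|w| <= 1 -> `|m'| <= B -> `|m| <= B -> `|t'| <= B -> `|t| <= B -> `|w'| <= 1 ->
  `|k'| <= B / r ->
  `|w - w'| <= d -> `|m - m'| <= B * d -> `|t - t'| <= B * d ->
  `|k - k'| <= B ^+ 4 * d / r ->
  `|w * m * t * k - w' * m' * t' * k'| <= 4 * B ^+ 6 * d / r.
Proof.
move=> B1 d0 r0 Hw Hm' Hm Ht' Ht Hw' Hk' dw dm dt dk.
have B0 : 0 <= B by lra.
have -> : w * m * t * k - w' * m' * t' * k' =
  w * m * t * (k - k') + w * m * (t - t') * k' + w * (m - m') * t' * k'
  + (w - w') * m' * t' * k' by ring.
have pB n : 0 <= B ^+ n by rewrite exprn_ge0.
have ir : 0 <= r^-1 by rewrite invr_ge0 ltW.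
have dr : 0 <= d / r by rewrite mulr_ge0.
have pw n : (n <= 6)%N -> B ^+ n * (d / r) <= B ^+ 6 * (d / r).
  by move=> n6; rewrite ler_wpM2r// ler_weXn2l.
have e1 : `|w * m * t * (k - k')| <= B ^+ 6 * (d / r).
  rewrite !normrM; apply: (@le_trans _ _ (1 * B * B * (B ^+ 4 * d / r))).
    by rewrite !ler_pM ?mulr_ge0.
  by rewrite le_eqVlt; apply/orP; left; apply/eqP; ring.
have e2 : `|w * m * (t - t') * k'| <= B ^+ 3 * (d / r).
  rewrite !normrM; apply: (@le_trans _ _ (1 * B * (B * d) * (B / r))).
    by rewrite !ler_pM ?mulr_ge0.
  by rewrite le_eqVlt; apply/orP; left; apply/eqP; ring.
have e3 : `|w * (m - m') * t' * k'| <= B ^+ 3 * (d / r).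
  rewrite !normrM; apply: (@le_trans _ _ (1 * (B * d) * B * (B / r))).
    by rewrite !ler_pM ?mulr_ge0.
  by rewrite le_eqVlt; apply/orP; left; apply/eqP; ring.
have e4 : `|(w - w') * m' * t' * k'| <= B ^+ 3 * (d / r).
  rewrite !normrM; apply: (@le_trans _ _ (d * B * B * (B / r))).
    by rewrite !ler_pM ?mulr_ge0.
  by rewrite le_eqVlt; apply/orP; left; apply/eqP; ring.
have p3 := pw 3%N isT.
have := ler_normD (w * m * t * (k - k') + w * m * (t - t') * k' + w * (m - m') * t' * k')
  ((w - w') * m' * t' * k').
have := ler_normD (w * m * t * (k - k') + w * m * (t - t') * k') (w * (m - m') * t' * k').
have := ler_normD (w * m * t * (k - k')) (w * m * (t - t') * k').
rewrite -!mulrA; move: e1 e2 e3 e4 p3; rewrite -!mulrA; lra.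
Qed.

End Counting.

Definition unit_itv (R : numDomainType) (x : R) := 0 <= x <= 1.

Section KernelBound.
Variables (R : realFieldType) (B : R) (f g g1 : R -> R).
Hypotheses (B1 : 1 <= B)
  (fg : taylor1 B f g) (gg1 : taylor1 B g g1)
  (fB : bounded_by B f) (gB : bounded_by B g) (g1B : bounded_by B g1)
  (fs : unit_supp f) (gs : unit_supp g).
Variables (L : nat) (d e : R).
Hypotheses (Ld : L%:R * d = 1) (d0 : 0 < d) (e0 : 0 < e) (e1 : e <= 1)
  (de : d <= e ^+ 5).
Variables c0 c1 c2 c3 k1 k2 k3 : R.
Definition bilin a b c d (x y : R) := a * x * y + b * x + c * y + d.
Let P := bilin c0 c1 c2 c3.
Let Q := bilin c0 k1 k2 k3.
Let P3 y := c0 * y + c1.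
Let P4 x := c0 * x + c2.
Let Q3 y := c0 * y + k1.
Let Q4 x := c0 * x + k2.
Let J x y := P3 y * Q4 x - P4 x * Q3 y.
Let I := @unit_itv R.
Hypotheses (c0B : `|c0| <= B)
  (P3B : forall y, I y -> B^-1 <= `|P3 y| <= B) (P4B : forall x, I x -> B^-1 <= `|P4 x| <= B)
  (Q3B : forall y, I y -> `|Q3 y| <= B) (Q4B : forall x, I x -> `|Q4 x| <= B).
Variable M : R -> R -> R.
Hypotheses (MB : forall x y, I x -> I y -> `|M x y| <= B)
  (MLx : forall x x' y, I x -> I x' -> I y -> `|M x y - M x' y| <= B * `|x - x'|)
  (MLy : forall x y y', I x -> I y -> I y' -> `|M x y - M x y'| <= B * `|y - y'|).

Let B0 : 0 < B. Proof. by apply: lt_le_trans B1. Qed.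
Let z (i : nat) : R := i%:R * d.

Lemma grid_unit i : (i <= L)%N -> I (z i).
Proof.
move=> iL; apply/andP; split; first by rewrite mulr_ge0 ?(ltW d0).
by rewrite -Ld ler_wpM2r ?(ltW d0)// ler_nat.
Qed.

Lemma mesh_le_scale : d <= e.
Proof. by apply: (le_trans de); rewrite -[leRHS]expr1 ler_wiXn2l// ltW. Qed.

Definition parab (x : R) := x * (1 - x).

Lemma parab_bound x : I x -> 0 <= parab x <= 1.
Proof. by rewrite /I /unit_itv /parab => /andP[? ?]; apply/andP; split; nra. Qed.

Lemma parab_lip x y : I x -> I y -> `|parab x - parab y| <= `|x - y|.
Proof.
rewrite /I /unit_itv /parab => /andP[x0 x1] /andP[y0 y1].
have -> : x * (1 - x) - y * (1 - y) = (x - y) * (1 - x - y) by ring.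
by rewrite normrM -[leRHS]mulr1 ler_wpM2l// ler_norml; apply/andP; split; lra.
Qed.

(* The weight [parab] kills the boundary terms of the summations by parts in [corr_far]. *)
Definition corr : R := \sum_(i < L) \sum_(j < L)
  parab (z i) * parab (z j) * M (z i) (z j) * (g (P (z i) (z j) / e) * g (Q (z i) (z j) / e)).

Lemma scaled_supp (v : R) (h : R -> R) : unit_supp h -> h (v / e) != 0 -> `|v| <= e.
Proof.
move=> hs; apply: contraNT; rewrite -ltNge => ev; rewrite hs// normrM normfV (gtr0_norm e0).
by rewrite ler_pdivlMr// mul1r ltW.
Qed.

Lemma natr_grid i j : (i <= j)%N -> (j - i)%:R = (z j - z i) / d.
Proof. by move=> ij; rewrite natrB// /z -mulrBl mulfK// gt_eqF. Qed.

(** No cancellation is used: in each column the strip [|P| <= e] has height of order [e] because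
    [P4] is bounded below, and the profile of [Q] is merely bounded. *)
Lemma corr_near : `|d ^+ 2 * corr| <= 5 * B ^+ 4 * e.
Proof.
rewrite normrM ger0_norm ?exprn_ge0 ?(ltW d0)//.
have cnt i : (i < L)%N ->
    \sum_(j < L) (`|P (z i) (z j)| <= e)%R%:R <= 2 * B * e / d + 1.
  move=> iL; apply: (@count_spread _ (fun j => `|P (z i) (z j)| <= e)).
    by rewrite !mulr_ge0 ?invr_ge0 ?ltW.
  move=> j j' /andP[jj j'L]; rewrite natr_grid// !ler_norml => /andP[? ?] /andP[? ?].
  rewrite ler_pM2r ?invr_gt0//.
  have E : P (z i) (z j') - P (z i) (z j) = P4 (z i) * (z j' - z j).
    by rewrite /P /P4 /bilin; ring.
  have zz : 0 <= z j' - z j by rewrite subr_ge0 /z ler_wpM2r ?(ltW d0)// ler_nat.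
  have : `|P4 (z i) * (z j' - z j)| <= 2 * e.
    by rewrite -E ler_norml; apply/andP; split; lra.
  rewrite normrM (ger0_norm zz); have /andP[H _] := P4B (grid_unit (ltnW iL)).
  move=> H2; rewrite -[leRHS]mulrA mulrCA -ler_pdivrMl// mulrC.
  by apply: le_trans H2; rewrite mulrC ler_wpM2r.
have bd i : (i < L)%N -> `|\sum_(j < L) parab (z i) * parab (z j) * M (z i) (z j) *
    (g (P (z i) (z j) / e) * g (Q (z i) (z j) / e))| <= B ^+ 3 * (2 * B * e / d + 1).
  move=> iL; rewrite (le_trans (ler_norm_sum _ _ _))//.
  apply: (@le_trans _ _ (\sum_(j < L) B ^+ 3 * (`|P (z i) (z j)| <= e)%R%:R)).
    apply: ler_sum => j _.
    have /andP[p1 p2] := parab_bound (grid_unit (ltnW iL)).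
    have /andP[p3 p4] := parab_bound (grid_unit (ltnW (ltn_ord j))).
    have [g0|/(scaled_supp gs) ->] := eqVneq (g (P (z i) (z j) / e)) 0.
      by rewrite g0 mul0r mulr0 normr0 mulr_ge0// exprn_ge0// ltW.
    move: (parab (z i)) (parab (z j)) p1 p2 p3 p4 => p p' p1 p2 p3 p4.
    rewrite mulr1 !normrM (ger0_norm p1) (ger0_norm p3).
    apply: (@le_trans _ _ (1 * 1 * B * (B * B))); last first.
      by rewrite le_eqVlt; apply/orP; left; apply/eqP; ring.
    have := MB (grid_unit (ltnW iL)) (grid_unit (ltnW (ltn_ord j))) => HM.
    by rewrite !ler_pM ?mulr_ge0.
  by rewrite -mulr_sumr ler_wpM2l ?exprn_ge0 ?(ltW B0)// cnt.
have H : `|corr| <= L%:R * (B ^+ 3 * (2 * B * e / d + 1)).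
  rewrite (le_trans (ler_norm_sum _ _ _))//.
  apply: (@le_trans _ _ (\sum_(i < L) (B ^+ 3 * (2 * B * e / d + 1)))).
    by apply: ler_sum => i _; apply: bd.
  by rewrite sumr_const card_ord -[leLHS]mulr_natl.
apply: le_trans (ler_wpM2l _ H) _; first by rewrite exprn_ge0// ltW.
have -> : d ^+ 2 * (L%:R * (B ^+ 3 * (2 * B * e / d + 1))) =
  L%:R * d * B ^+ 3 * (2 * B * e * (d / d) + d) by ring.
rewrite Ld mul1r divff ?gt_eqF// mulr1.
have -> : 5 * B ^+ 4 * e = B ^+ 3 * (5 * B * e) by ring.
rewrite ler_wpM2l ?exprn_ge0 ?(ltW B0)//; have := mesh_le_scale.
have : e <= B * e by rewrite ler_peMl// ltW.
by move=> eB de1; move: (e0); lra.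
Qed.

Lemma prod_taylor u v a b h : 0 <= h <= 1 -> `|a| <= B -> `|b| <= B ->
  `|f (u + h * a) * g (v + h * b) - f u * g v
    - h * (a * (g u * g v) + b * (f u * g1 v))| <= 6 * B ^+ 6 * h ^+ 2.
Proof.
move=> /andP[h0 h1] aB bB.
pose r1 := f (u + h * a) - f u - h * a * g u.
pose r2 := g (v + h * b) - g v - h * b * g1 v.
have B0' := ltW B0.
have hh : h ^+ 2 <= h by rewrite expr2 ler_piMl.
have sq x : `|x| <= B -> (h * x) ^+ 2 <= B ^+ 2 * h ^+ 2.
  move=> xB; rewrite exprMn mulrC ler_wpM2r ?exprn_ge0//.
  by rewrite -(real_normK (num_real x)) lerXn2r ?nnegrE.
have R1 : `|r1| <= B ^+ 3 * h ^+ 2.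
  by rewrite (le_trans (fg u (h * a)))// [B ^+ 3]exprS -[leRHS]mulrA ler_wpM2l// sq.
have R2 : `|r2| <= B ^+ 3 * h ^+ 2.
  by rewrite (le_trans (gg1 v (h * b)))// [B ^+ 3]exprS -[leRHS]mulrA ler_wpM2l// sq.
have B23 : B ^+ 2 <= B ^+ 3 by rewrite ler_weXn2l.
have B3h : B ^+ 3 * h ^+ 2 <= B ^+ 3 * h by rewrite ler_wpM2l ?exprn_ge0.
have B2h : B ^+ 2 * h <= B ^+ 3 * h by rewrite ler_wpM2r.
have aux (x y r : R) : `|x| <= B -> `|y| <= B -> `|r| <= B ^+ 3 * h ^+ 2 ->
    `|h * x * y + r| <= 2 * B ^+ 3 * h.
  move=> xB yB rB; rewrite (le_trans (ler_normD _ _))// !normrM (ger0_norm h0).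
  have : `|x| * `|y| <= B ^+ 2 by rewrite expr2 ler_pM.
  by move=> /(ler_wpM2l h0); move: rB; lra.
have A1 := aux a (g u) r1 aB (gB u) R1.
have A2 := aux b (g1 v) r2 bB (g1B v) R2.
have -> : f (u + h * a) = f u + (h * a * g u + r1) by rewrite /r1; ring.
have -> : g (v + h * b) = g v + (h * b * g1 v + r2) by rewrite /r2; ring.
have -> : (f u + (h * a * g u + r1)) * (g v + (h * b * g1 v + r2)) - f u * g v -
  h * (a * (g u * g v) + b * (f u * g1 v)) =
  r1 * g v + f u * r2 + (h * a * g u + r1) * (h * b * g1 v + r2) by ring.
have E1 : `|r1 * g v| <= B ^+ 4 * h ^+ 2.
  rewrite normrM; have -> : B ^+ 4 * h ^+ 2 = (B ^+ 3 * h ^+ 2) * B by ring.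
  by rewrite ler_pM.
have E2 : `|f u * r2| <= B ^+ 4 * h ^+ 2.
  rewrite normrM; have -> : B ^+ 4 * h ^+ 2 = B * (B ^+ 3 * h ^+ 2) by ring.
  by rewrite ler_pM.
have E3 : `|(h * a * g u + r1) * (h * b * g1 v + r2)| <= 4 * B ^+ 6 * h ^+ 2.
  rewrite normrM; have -> : 4 * B ^+ 6 * h ^+ 2 = (2 * B ^+ 3 * h) * (2 * B ^+ 3 * h) by ring.
  by rewrite ler_pM.
have B46 : B ^+ 4 * h ^+ 2 <= B ^+ 6 * h ^+ 2.
  by rewrite ler_wpM2r ?exprn_ge0// ler_weXn2l.
rewrite (le_trans (ler_normD _ _))// (le_trans (lerD (ler_normD _ _) (lexx _)))//.
by move: E1 E2 E3 B46; lra.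
Qed.

Variable r : R.
Hypotheses (er : e <= r) (r1 : r <= 1)
  (ck1 : `|k1 - c1| <= B * r) (ck2 : `|k2 - c2| <= B * r)
  (Jr : forall x y, I x -> I y -> r / B <= `|J x y|).

Let r0 : 0 < r. Proof. exact: lt_le_trans e0 er. Qed.

Let both i j := (`|P (z i) (z j)| <= e) && (`|Q (z i) (z j)| <= e).

(** As the strips cross at an angle of order [r], their intersection has extent of order [e / r] in
    [y], and [e] in [x] at fixed [y]. The shifts [k] and [l] are there because summation by parts
    evaluates [G] at a successor index. *)
Lemma count_both k l : (k <= 1)%N -> (l <= 1)%N ->
  \sum_(j < L) \sum_(i < L) (both (i + k) (j + l))%:R <= 15 * B ^+ 3 * (e ^+ 2 / (r * d ^+ 2)).
Proof.
move=> k1' l1'.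
have B0' := ltW B0; have d0' := ltW d0; have e0' := ltW e0.
have Iz i m : (i < L)%N -> (m <= 1)%N -> I (z (i + m)).
  move=> iL m1; apply: grid_unit; apply: leq_trans (leq_add (leqnn i) m1) _.
  by rewrite addn1.
have zle i i' m : (i <= i')%N -> 0 <= z (i' + m) - z (i + m).
  by move=> ii; rewrite subr_ge0 /z ler_wpM2r// ler_nat leq_add2r.
have zd i i' m : (i <= i')%N -> (i' - i)%:R = (z (i' + m) - z (i + m)) / d.
  by move=> ii; rewrite -natr_grid ?leq_add2r// subnDr.
have mid x y : I x -> I y -> I ((x + y) / 2).
  by rewrite /I /unit_itv => /andP[? ?] /andP[? ?]; apply/andP; split; lra.
have C1 : \sum_(j < L) \sum_(i < L) (both (i + k) (j + l))%:R <=
    (4 * B ^+ 2 * e / r / d + 1) * (2 * B * e / d + 1).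
  apply: (@count_spread2 _ (fun i j => both (i + k) (j + l))).
  - by rewrite !mulr_ge0 ?invr_ge0 ?exprn_ge0 ?(ltW r0).
  - by rewrite !mulr_ge0 ?invr_ge0.
  - move=> i i' j j' /andP[jj j'L] iL i'L /andP[p1 q1] /andP[p2 q2].
    have jL := leq_ltn_trans jj j'L.
    rewrite (zd _ _ l jj) ler_wpM2r ?invr_ge0//.
    move: p1 q1 p2 q2; set x := z (i + k); set x' := z (i' + k).
    set y := z (j + l); set y' := z (j' + l).
    have Ix : I x by exact: Iz. have Ix' : I x' by exact: Iz.
    have Iy : I y by exact: Iz. have Iy' : I y' by exact: Iz.
    move=> p1 q1 p2 q2.
    set xm := (x + x') / 2; set ym := (y + y') / 2.
    have Ixm : I xm by exact: mid. have Iym : I ym by exact: mid.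
    (* The increment of a bilinear function is exactly its gradient at the midpoint applied to the
       displacement. Eliminating [x' - x] between [P] and [Q] leaves [J] at the midpoint. *)
    have E : J xm ym * (y' - y) = P3 ym * (Q x' y' - Q x y) - Q3 ym * (P x' y' - P x y).
      by rewrite /J /P3 /Q3 /P4 /Q4 /P /Q /bilin /xm /ym; field.
    have K1 : `|J xm ym * (y' - y)| <= 4 * B * e.
      rewrite E (le_trans (ler_normB _ _))// !normrM.
      have /andP[_ h1] := P3B Iym; have h2 := Q3B Iym.
      have h3 : `|Q x' y' - Q x y| <= 2 * e by rewrite (le_trans (ler_normB _ _))//; lra.
      have h4 : `|P x' y' - P x y| <= 2 * e by rewrite (le_trans (ler_normB _ _))//; lra.
      have := ler_pM (normr_ge0 _) (normr_ge0 _) h1 h3.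
      by have := ler_pM (normr_ge0 _) (normr_ge0 _) h2 h4; lra.
    have yy : 0 <= y' - y by exact: zle.
    move: K1; rewrite normrM (ger0_norm yy) => K1.
    have K2 : r / B * (y' - y) <= 4 * B * e.
      by apply: le_trans K1; rewrite ler_wpM2r// Jr.
    rewrite ler_pdivlMr// -(ler_pM2r (x := B^-1)) ?invr_gt0//.
    have -> : 4 * B ^+ 2 * e / B = 4 * B * e by field; rewrite gt_eqF.
    by apply: le_trans K2; rewrite le_eqVlt; apply/orP; left; apply/eqP; ring.
  - move=> i i' j /andP[ii i'L] jL /andP[p1 _] /andP[p2 _].
    rewrite (zd _ _ k ii) ler_wpM2r ?invr_ge0//.
    have iL := leq_ltn_trans ii i'L.
    move: p1 p2; set x := z (i + k); set x' := z (i' + k); set y := z (j + l).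
    have Iy : I y by exact: Iz.
    move=> p1 p2; have E : P3 y * (x' - x) = P x' y - P x y.
      by rewrite /P /P3 /bilin; ring.
    have xx : 0 <= x' - x by exact: zle.
    have : `|P3 y * (x' - x)| <= 2 * e by rewrite E (le_trans (ler_normB _ _))//; lra.
    rewrite normrM (ger0_norm xx) => H; have /andP[h _] := P3B Iy.
    have : B^-1 * (x' - x) <= 2 * e by apply: le_trans H; rewrite ler_wpM2r.
    by rewrite mulrC ler_pdivrMr// => H'; apply: (le_trans H'); rewrite mulrAC.
apply: (le_trans C1).
have h1 : 1 <= B ^+ 2 * e / r / d.
  rewrite ler_pdivlMr// mul1r; apply: (le_trans mesh_le_scale).
  rewrite ler_pdivlMr//; apply: (@le_trans _ _ e); first by rewrite ler_piMr.
  by rewrite ler_peMl// exprn_ege1.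
have h2 : 1 <= B * e / d.
  rewrite ler_pdivlMr// mul1r; apply: (le_trans mesh_le_scale).
  by rewrite ler_peMl.
have -> : 15 * B ^+ 3 * (e ^+ 2 / (r * d ^+ 2)) = (5 * (B ^+ 2 * e / r / d)) * (3 * (B * e / d)).
  by field; rewrite !gt_eqF.
rewrite ler_pM ?addr_ge0 ?mulr_ge0 ?invr_ge0 ?exprn_ge0 ?(ltW r0)//.
  by move: h1; rewrite -!mulrA; lra.
by move: h2; rewrite -!mulrA; lra.
Qed.

Let G i j := f (P (z i) (z j) / e) * g (Q (z i) (z j) / e).
Let wt x y := parab x * parab y * M x y.

(* The field [(Q4, - Q3)] is tangent to the level curves of [Q]: along it the derivative of
   [f (P / e) * g (Q / e)] is [J / e * (g (P / e) * g (Q / e))], as [g] is the derivative of [f]. *)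
Lemma level_derivative i j : (i < L)%N -> (j < L)%N ->
  `|Q4 (z i) * (G i.+1 j - G i j) - Q3 (z j) * (G i j.+1 - G i j)
    - d / e * J (z i) (z j) * (g (P (z i) (z j) / e) * g (Q (z i) (z j) / e))|
  <= 12 * B ^+ 7 * (d / e) ^+ 2.
Proof.
move=> iL jL; have Ii := grid_unit (ltnW iL); have Ij := grid_unit (ltnW jL).
have h01 : 0 <= d / e <= 1.
  by rewrite divr_ge0 ?(ltW d0) ?(ltW e0)//= ler_pdivrMr// mul1r mesh_le_scale.
have /andP[_ b3] := P3B Ij; have /andP[_ b4] := P4B Ii.
have q3 := Q3B Ij; have q4 := Q4B Ii.
have zS k : z k.+1 = z k + d by rewrite /z -natr1; ring.
have SP3 : P (z i.+1) (z j) / e = P (z i) (z j) / e + d / e * P3 (z j).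
  by rewrite zS /P /P3 /bilin; ring.
have SQ3 : Q (z i.+1) (z j) / e = Q (z i) (z j) / e + d / e * Q3 (z j).
  by rewrite zS /Q /Q3 /bilin; ring.
have SP4 : P (z i) (z j.+1) / e = P (z i) (z j) / e + d / e * P4 (z i).
  by rewrite zS /P /P4 /bilin; ring.
have SQ4 : Q (z i) (z j.+1) / e = Q (z i) (z j) / e + d / e * Q4 (z i).
  by rewrite zS /Q /Q4 /bilin; ring.
have := prod_taylor (P (z i) (z j) / e) (Q (z i) (z j) / e) h01 b3 q3.
have := prod_taylor (P (z i) (z j) / e) (Q (z i) (z j) / e) h01 b4 q4.
rewrite -SP3 -SQ3 -SP4 -SQ4 -!/(G _ _).
set h := d / e; set gg := g _ * g _; set fg1 := f _ * g1 _.
set X4 := _ - _ - _; set X3 := _ - _ - _ => H4 H3.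
have -> : Q4 (z i) * (G i.+1 j - G i j) - Q3 (z j) * (G i j.+1 - G i j) -
   h * J (z i) (z j) * gg = Q4 (z i) * X3 - Q3 (z j) * X4.
  by rewrite /X3 /X4 /J; ring.
have -> : 12 * B ^+ 7 * h ^+ 2 = B * (6 * B ^+ 6 * h ^+ 2) + B * (6 * B ^+ 6 * h ^+ 2).
  by ring.
by rewrite (le_trans (ler_normB _ _))// !normrM lerD// ler_pM.
Qed.

Lemma G_both i j : `|G i j| <= B ^+ 2 * (both i j)%:R.
Proof.
rewrite /G; have [->|fn] := eqVneq (f (P (z i) (z j) / e)) 0.
  by rewrite mul0r normr0 mulr_ge0// exprn_ge0// ltW.
have [->|gn] := eqVneq (g (Q (z i) (z j) / e)) 0.
  by rewrite mulr0 normr0 mulr_ge0// exprn_ge0// ltW.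
rewrite /both (scaled_supp fs fn) (scaled_supp gs gn) mulr1 normrM expr2.
by rewrite ler_pM.
Qed.

Lemma J_neq0 x y : I x -> I y -> J x y != 0.
Proof.
move=> Ix Iy; rewrite -normr_gt0; apply: lt_le_trans (Jr Ix Iy).
by rewrite divr_gt0.
Qed.

Lemma Jinv_bound x y : I x -> I y -> `|(J x y)^-1| <= B / r.
Proof.
move=> Ix Iy; rewrite normfV -[B / r]invrK lef_pV2 ?posrE ?normr_gt0 ?J_neq0//.
  by rewrite invf_div Jr.
by rewrite invr_gt0 divr_gt0.
Qed.

Lemma Jinv_lip x y x' y' : I x -> I y -> I x' -> I y' ->
  `|J x y - J x' y'| <= B ^+ 2 * d * r -> `|(J x y)^-1 - (J x' y')^-1| <= B ^+ 4 * d / r.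
Proof.
move=> Ix Iy Ix' Iy' H.
have -> : (J x y)^-1 - (J x' y')^-1 = (J x y)^-1 * (J x' y')^-1 * (J x' y' - J x y).
  by field; rewrite !J_neq0.
have -> : B ^+ 4 * d / r = (B / r) * (B / r) * (B ^+ 2 * d * r).
  by field; rewrite gt_eqF.
rewrite !normrM ler_pM// ?mulr_ge0//; first by rewrite ler_pM// Jinv_bound.
by rewrite distrC.
Qed.

(** [P] and [Q] share the coefficient [c0], so the slope of [J] in [x] is a multiple of [k1 - c1]
    and is itself of order [r]. This is why [J^-1] has Lipschitz constant of order [1 / r] and not
    [1 / r^2]. *)
Lemma J_lip_x x x' y : `|x - x'| <= d -> `|J x y - J x' y| <= B ^+ 2 * d * r.
Proof.
move=> xd; have -> : J x y - J x' y = - (c0 * (x - x') * (k1 - c1)).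
  by rewrite /J /P3 /Q3 /P4 /Q4; ring.
have -> : B ^+ 2 * d * r = B * d * (B * r) by ring.
by rewrite normrN !normrM ler_pM// ?mulr_ge0// ler_pM.
Qed.

Lemma J_lip_y x y y' : `|y - y'| <= d -> `|J x y - J x y'| <= B ^+ 2 * d * r.
Proof.
move=> xd; have -> : J x y - J x y' = c0 * (y - y') * (k2 - c2).
  by rewrite /J /P3 /Q3 /P4 /Q4; ring.
have -> : B ^+ 2 * d * r = B * d * (B * r) by ring.
by rewrite !normrM ler_pM// ?mulr_ge0// ler_pM.
Qed.

Lemma parab_abs x : I x -> `|parab x| <= 1.
Proof. by move=> /parab_bound /andP[h1 h2]; rewrite ger0_norm. Qed.

Lemma parab2_abs x y : I x -> I y -> `|parab x * parab y| <= 1.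
Proof. by move=> Ix Iy; rewrite normrM -[leRHS]mulr1 ler_pM// parab_abs. Qed.

Lemma grid_step k : z k.+1 - z k = d.
Proof. by rewrite /z -natr1; ring. Qed.

(** The factor [wt * Q4 / J] changes by [O(d / r)] per grid step, and the sum of [|G|] left by
    summation by parts counts the points common to both strips. *)
Lemma main_x : `|\sum_(j < L) \sum_(i < L)
    (wt (z i) (z j) * Q4 (z i) * (J (z i) (z j))^-1) * (G i.+1 j - G i j)|
  <= (4 * B ^+ 6 * d / r) * (B ^+ 2 * (15 * B ^+ 3 * (e ^+ 2 / (r * d ^+ 2)))).
Proof.
have D0 : 0 <= 4 * B ^+ 6 * d / r.
  by rewrite !mulr_ge0 ?invr_ge0 ?exprn_ge0 ?(ltW B0) ?(ltW d0) ?(ltW r0).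
have B20 : 0 <= B ^+ 2 by rewrite exprn_ge0// ltW.
rewrite (le_trans (ler_norm_sum _ _ _))//.
apply: (@le_trans _ _ (\sum_(j < L) (4 * B ^+ 6 * d / r) * \sum_(i < L) `|G i.+1 j|)).
  apply: ler_sum => j _; have Ij := grid_unit (ltnW (ltn_ord j)).
  apply: (@abel_bound _ (fun i => wt (z i) (z j) * Q4 (z i) * (J (z i) (z j))^-1) (fun i => G i j)).
  - by rewrite /wt /z /parab !mul0r.
  - by rewrite /wt /z /parab Ld subrr mulr0 !mul0r.
  move=> i iL; have Ii := grid_unit (ltnW iL); have Ii' := grid_unit iL.
  have dz : `|z i.+1 - z i| <= d by rewrite grid_step ger0_norm// ltW.
  apply: (lip_prod4 B1 (ltW d0) r0); rewrite ?parab2_abs ?MB ?Q4B ?Jinv_bound//.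
  - rewrite -mulrBl normrM -[leRHS]mulr1 ler_pM ?parab_abs//.
    by rewrite (le_trans (parab_lip Ii' Ii)).
  - by rewrite (le_trans (MLx Ii' Ii Ij))// ler_wpM2l ?(ltW B0).
  - have -> : Q4 (z i.+1) - Q4 (z i) = c0 * (z i.+1 - z i) by rewrite /Q4; ring.
    by rewrite normrM ler_pM.
  - by apply: Jinv_lip => //; apply: J_lip_x.
rewrite -mulr_sumr ler_wpM2l//.
apply: (@le_trans _ _ (\sum_(j < L) B ^+ 2 * \sum_(i < L) (both (i + 1) (j + 0))%:R)).
  by apply: ler_sum => j _; rewrite mulr_sumr ler_sum// => i _; rewrite addn1 addn0 G_both.
by rewrite -mulr_sumr ler_wpM2l// count_both.
Qed.

Lemma main_y : `|\sum_(i < L) \sum_(j < L)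
    (wt (z i) (z j) * Q3 (z j) * (J (z i) (z j))^-1) * (G i j.+1 - G i j)|
  <= (4 * B ^+ 6 * d / r) * (B ^+ 2 * (15 * B ^+ 3 * (e ^+ 2 / (r * d ^+ 2)))).
Proof.
have D0 : 0 <= 4 * B ^+ 6 * d / r.
  by rewrite !mulr_ge0 ?invr_ge0 ?exprn_ge0 ?(ltW B0) ?(ltW d0) ?(ltW r0).
have B20 : 0 <= B ^+ 2 by rewrite exprn_ge0// ltW.
rewrite (le_trans (ler_norm_sum _ _ _))//.
apply: (@le_trans _ _ (\sum_(i < L) (4 * B ^+ 6 * d / r) * \sum_(j < L) `|G i j.+1|)).
  apply: ler_sum => i _; have Ii := grid_unit (ltnW (ltn_ord i)).
  apply: (@abel_bound _ (fun j => wt (z i) (z j) * Q3 (z j) * (J (z i) (z j))^-1) (fun j => G i j)).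
  - by rewrite /wt /z /parab !(mul0r, mulr0).
  - by rewrite /wt /z /parab Ld subrr !(mul0r, mulr0).
  move=> j jL; have Ij := grid_unit (ltnW jL); have Ij' := grid_unit jL.
  have dz : `|z j.+1 - z j| <= d by rewrite grid_step ger0_norm// ltW.
  apply: (lip_prod4 B1 (ltW d0) r0); rewrite ?parab2_abs ?MB ?Q3B ?Jinv_bound//.
  - rewrite -mulrBr normrM -[leRHS]mul1r ler_pM ?parab_abs//.
    by rewrite (le_trans (parab_lip Ij' Ij)).
  - by rewrite (le_trans (MLy Ii Ij' Ij))// ler_wpM2l ?(ltW B0).
  - have -> : Q3 (z j.+1) - Q3 (z j) = c0 * (z j.+1 - z j) by rewrite /Q3; ring.
    by rewrite normrM ler_pM.
  - by apply: Jinv_lip => //; apply: J_lip_y.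
rewrite -mulr_sumr ler_wpM2l//.
apply: (@le_trans _ _ (\sum_(i < L) B ^+ 2 * \sum_(j < L) (both (i + 0) (j + 1))%:R)).
  by apply: ler_sum => i _; rewrite mulr_sumr ler_sum// => j _; rewrite addn1 addn0 G_both.
by rewrite -mulr_sumr ler_wpM2l// exchange_big count_both.
Qed.

(** [level_derivative] expresses the product of profiles by differences of [G] at the price of
    dividing by [J * d / e]. Up to constants, summation by parts then gives [d^2 * (e / d) * (d / r)
    * (e^2 / (r * d^2)) = e^3 / r^2]. *)
Lemma corr_far : `|d ^+ 2 * corr| <= 132 * B ^+ 11 * (e ^+ 3 / r ^+ 2).
Proof.
pose h := d / e; have h0 : 0 < h by rewrite divr_gt0.
pose S3 := \sum_(j < L) \sum_(i < L)
    (wt (z i) (z j) * Q4 (z i) * (J (z i) (z j))^-1) * (G i.+1 j - G i j).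
pose S4 := \sum_(i < L) \sum_(j < L)
    (wt (z i) (z j) * Q3 (z j) * (J (z i) (z j))^-1) * (G i j.+1 - G i j).
have B0' := ltW B0.
have err : `|corr - h^-1 * (S3 - S4)| <= L%:R ^+ 2 * (12 * B ^+ 9 * (h / r)).
  have -> : corr - h^-1 * (S3 - S4) = \sum_(i < L) \sum_(j < L)
      - (wt (z i) (z j) * (J (z i) (z j))^-1 * h^-1) *
      (Q4 (z i) * (G i.+1 j - G i j) - Q3 (z j) * (G i j.+1 - G i j)
    - h * J (z i) (z j) * (g (P (z i) (z j) / e) * g (Q (z i) (z j) / e))).
    rewrite /S3 exchange_big /S4 -sumrB mulr_sumr -sumrB; apply: eq_bigr => i _.
    rewrite -sumrB mulr_sumr -sumrB; apply: eq_bigr => j _.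
    have Jn := J_neq0 (grid_unit (ltnW (ltn_ord i))) (grid_unit (ltnW (ltn_ord j))).
    rewrite -/(wt (z i) (z j)); field.
    by rewrite Jn gt_eqF.
  have -> : L%:R ^+ 2 * (12 * B ^+ 9 * (h / r)) =
      \sum_(i < L) \sum_(j < L) (12 * B ^+ 9 * (h / r)).
    move: (12 * _ * _) => X.
    by rewrite !sumr_const card_ord -mulrnA -[RHS]mulr_natl natrM expr2.
  rewrite (le_trans (ler_norm_sum _ _ _))// ler_sum// => i _.
  rewrite (le_trans (ler_norm_sum _ _ _))// ler_sum// => j _.
  have Ii := grid_unit (ltnW (ltn_ord i)); have Ij := grid_unit (ltnW (ltn_ord j)).
  rewrite normrM normrN.
  have -> : 12 * B ^+ 9 * (h / r) = B * (B / r) * h^-1 * (12 * B ^+ 7 * h ^+ 2).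
    by field; rewrite !gt_eqF.
  rewrite ler_pM// ?level_derivative// !normrM (gtr0_norm (x := h^-1)) ?invr_gt0//.
  rewrite ler_wpM2r ?invr_ge0 ?(ltW h0)// ler_pM ?mulr_ge0 ?Jinv_bound//.
  rewrite -!normrM -[leRHS]mul1r [leLHS]normrM.
  by rewrite ler_pM ?parab2_abs ?MB.
have m3 := main_x; have m4 := main_y; rewrite -/S3 -/S4 in m3 m4.
have H : `|corr| <= L%:R ^+ 2 * (12 * B ^+ 9 * (h / r)) +
    h^-1 * (2 * ((4 * B ^+ 6 * d / r) * (B ^+ 2 * (15 * B ^+ 3 * (e ^+ 2 / (r * d ^+ 2)))))).
  have -> : corr = (corr - h^-1 * (S3 - S4)) + h^-1 * (S3 - S4) by ring.
  rewrite (le_trans (ler_normD _ _))// lerD// normrM gtr0_norm ?invr_gt0//.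
  rewrite ler_wpM2l ?invr_ge0 ?(ltW h0)// (le_trans (ler_normB _ _))//.
  by rewrite mulrDl mul1r lerD.
rewrite normrM ger0_norm ?exprn_ge0 ?(ltW d0)//.
apply: le_trans (ler_wpM2l _ H) _; first by rewrite exprn_ge0// ltW.
have -> : d ^+ 2 * (L%:R ^+ 2 * (12 * B ^+ 9 * (h / r)) +
    h^-1 * (2 * ((4 * B ^+ 6 * d / r) * (B ^+ 2 * (15 * B ^+ 3 * (e ^+ 2 / (r * d ^+ 2))))))) =
  (L%:R * d) ^+ 2 * (12 * B ^+ 9 * (d / (e * r))) + 120 * B ^+ 11 * (e ^+ 3 / r ^+ 2).
  by rewrite /h; field; rewrite !gt_eqF.
rewrite Ld expr1n mul1r.
have k0 : 0 <= e ^+ 3 / r ^+ 2 by rewrite divr_ge0 ?exprn_ge0 ?(ltW e0) ?(ltW r0).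
(* The accumulated Taylor error stays below the main term because the mesh [d] is a high power of
   the scale [e]. *)
have k1' : d / (e * r) <= e ^+ 3 / r ^+ 2.
  rewrite ler_pdivrMr ?mulr_gt0//.
  have -> : e ^+ 3 / r ^+ 2 * (e * r) = e ^+ 4 / r by field; rewrite gt_eqF.
  rewrite ler_pdivlMr//; apply: (@le_trans _ _ (e ^+ 5 * 1)).
    by rewrite ler_pM// ltW.
  rewrite mulr1 exprSr -[leRHS]mulr1 ler_wpM2l// exprn_ge0// ltW//.
have b9 : B ^+ 9 <= B ^+ 11 by rewrite ler_weXn2l.
have k2' : B ^+ 9 * (d / (e * r)) <= B ^+ 11 * (e ^+ 3 / r ^+ 2).
  by rewrite ler_pM ?exprn_ge0 ?divr_ge0 ?mulr_ge0 ?(ltW d0) ?(ltW e0) ?(ltW r0).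
by rewrite -!mulrA; move: k2'; lra.
Qed.

End KernelBound.

(** * Frostman measures on dyadic trees *)

Section Tree.
Variable R : realFieldType.
Implicit Types (q : R) (mu : nat -> nat -> R).

Lemma sum_blocks (F : nat -> R) a b :
  \sum_(i < a * b) F i = \sum_(c < a) \sum_(i < b) F (c * b + i)%N.
Proof.
elim: a => [|a IH]; first by rewrite mul0n !big_ord0.
rewrite big_ord_recr /= -IH mulSn addnC.
rewrite -(big_mkord xpredT F) -(big_mkord xpredT F) (big_cat_nat _ (leq_addr b (a * b)%N))//=.
congr (_ + _); rewrite -{1}[(a * b)%N]add0n big_addn addKn big_mkord.
by apply: eq_bigr => i _; rewrite addnC.
Qed.

(* [mu n j] is the mass of the dyadic interval [[j 2^-n, (j+1) 2^-n[], and [q = 2^-s]. *)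
Record frostman q (N : nat) mu : Prop := Frostman {
  fr_ge0 : forall n j, 0 <= mu n j;
  fr_add : forall n j, (n < N)%N -> mu n j = mu n.+1 j.*2 + mu n.+1 j.*2.+1;
  fr_le : forall n j, (n <= N)%N -> mu n j <= q ^+ n }.

Section Frostman.
Variables (q : R) (N : nat) (mu : nat -> nat -> R).
Hypothesis fr : frostman q N mu.

Lemma fr_block n k j : (n + k <= N)%N ->
  \sum_(i < 2 ^ k) mu (n + k)%N (j * 2 ^ k + i)%N = mu n j.
Proof.
elim: k j => [|k IH] j nkN.
  by rewrite expn0 big_ord1 muln1 !addn0.
rewrite -IH; last by lia.
rewrite expnSr (sum_blocks (fun i => mu (n + k.+1)%N (j * (2 ^ k * 2) + i)%N)); apply: eq_bigr => i _.
rewrite !big_ord_recl big_ord0 /= addr0 [RHS](fr_add fr); last lia.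
by rewrite addnS mulnA; congr (mu _ _ + mu _ _); rewrite ?/bump /=; lia.
Qed.

Lemma fr_mass n : (n <= N)%N -> \sum_(i < 2 ^ n) mu n i = mu 0 0.
Proof.
by move=> nN; rewrite -(@fr_block 0 n 0).
Qed.

(** A neighbourhood of radius 2^-m is covered by three dyadic intervals of that length. *)
Lemma fr_ball m (j : nat) : 0 <= q -> (m <= N)%N ->
  \sum_(i < 2 ^ N) mu N i * ((i < j + 2 ^ (N - m)) && (j < i + 2 ^ (N - m)))%N%:R <= 3 * q ^+ m.
Proof.
move=> q0 mN; set b := (2 ^ (N - m))%N; have b0 : (0 < b)%N by rewrite expn_gt0.
have Eb : (2 ^ N = 2 ^ m * b)%N by rewrite -expnD subnKC.
rewrite Eb (sum_blocks (fun i => mu N i * ((i < j + b) && (j < i + b))%N%:R)).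
pose near (c : nat) := (j %/ b <= c.+1)%N && (c <= (j %/ b).+1)%N.
apply: (@le_trans _ _ (\sum_(c < 2 ^ m) (near c)%:R * q ^+ m)).
  apply: ler_sum => c _.
  have bl : \sum_(i < b) mu N (c * b + i)%N = mu m c.
    by rewrite /b -(@fr_block m (N - m) c) subnKC.
  case nc : (near c).
    rewrite mul1r (le_trans _ (fr_le fr c mN))// -bl ler_sum// => i _.
    by rewrite -[leRHS]mulr1 ler_wpM2l ?(fr_ge0 fr)// lern1 leq_b1.
  rewrite mul0r big1 // => i _; case: andP => [[h1 h2]|]; last by rewrite mulr0.
  move: nc; rewrite /near => /negbT; rewrite negb_and -!ltnNge.
  have := divn_eq j b; have := ltn_pmod j b0; have := ltn_ord i.
  move: (j %/ b)%N (j %% b)%N h1 h2 => x y h1 h2 ib yb jE /orP[h|h]; exfalso.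
    have : (c.+2 * b <= x * b)%N by rewrite leq_mul2r h orbT.
    lia.
  have : (x.+2 * b <= c * b)%N by rewrite leq_mul2r h orbT.
  lia.
rewrite -mulr_suml ler_wpM2r ?exprn_ge0//.
have := @count_spread R near (2 ^ m)%N 2; rewrite (_ : 2 + 1 = 3); last by lra.
apply => // i i' /andP[ii _]; rewrite /near => /andP[h1 h2] /andP[h3 h4].
by rewrite ler_nat; lia.
Qed.

End Frostman.

Section FrostmanExistence.
Variables (q : R) (N : nat) (meets : pred nat).
Hypothesis q0 : 0 < q.

(* Capacities of the dyadic tree seen as a flow network: the maximal flow out of the root equals the
   cost of a minimal cut, i.e. of an optimal cover by dyadic intervals. *)
Fixpoint capacity k j : R :=
  if k is k'.+1 then Num.min (q ^+ (N - k)) (capacity k' j.*2 + capacity k' j.*2.+1)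
  else q ^+ N * (meets j)%:R.

(** The flow into a node is split between its children in proportion to their capacities; if both
    capacities are 0, so is the quotient by convention. Levels are counted from the root here, and
    from the leaves in [capacity]. *)
Fixpoint flow n j : R :=
  if n is n'.+1 then
    flow n' j./2 * (capacity (N - n) j /
      (capacity (N - n) j./2.*2 + capacity (N - n) j./2.*2.+1))
  else capacity N j.

Lemma capacity_ge0 k j : 0 <= capacity k j.
Proof.
elim: k j => [|k IH] j /=; first by rewrite mulr_ge0// exprn_ge0// ltW.
by rewrite le_min exprn_ge0 ?(ltW q0)// addr_ge0.
Qed.

Lemma capacity_le k j : capacity k j <= q ^+ (N - k).
Proof.
case: k => [|k] /=; last by rewrite ge_min lexx.
by rewrite subn0 -[leRHS]mulr1 ler_wpM2l ?exprn_ge0 ?(ltW q0)// lern1 leq_b1.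
Qed.

Lemma capacity_meets k j : capacity k j != 0 ->
  exists i, meets i /\ (i %/ 2 ^ k = j)%N.
Proof.
elim: k j => [|k IH] j /=.
  by case mj : (meets j); [exists j; rewrite expn0 divn1|rewrite mulr0 eqxx].
have [c1|/IH[i [mi ij]] _] := eqVneq (capacity k j.*2) 0; last first.
  by exists i; split=> //; rewrite expnSr divnMA ij; lia.
have [c2|/IH[i [mi ij]] _] := eqVneq (capacity k j.*2.+1) 0; last first.
  by exists i; split=> //; rewrite expnSr divnMA ij; lia.
by rewrite c1 c2 addr0 min_r ?eqxx// exprn_ge0// ltW.
Qed.

(** The minimal cut is read off the recursion: either the node itself is the cheaper choice, or the
    covers of its two children are concatenated. *)
Lemma capacity_cover k j : (k <= N)%N -> exists s : seq (nat * nat),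
  [/\ forall p, p \in s -> (p.1 <= N)%N,
      forall i, meets i -> (i %/ 2 ^ k = j)%N -> exists2 p, p \in s & (i %/ 2 ^ (N - p.1) = p.2)%N &
      \sum_(p <- s) q ^+ p.1 <= capacity k j].
Proof.
elim: k j => [|k IH] j kN /=.
  case mj : (meets j); last first.
    exists [::]; split => //; last by rewrite big_nil mulr0.
    by move=> i mi; rewrite expn0 divn1 => ij; rewrite -ij mi in mj.
  exists [:: (N, j)]; split.
  - by move=> p; rewrite inE => /eqP->.
  - by move=> i mi ij; exists (N, j); rewrite ?inE //= subnn.
  - by rewrite big_seq1 mulr1.
have [le|le] := leP (q ^+ (N - k.+1)) (capacity k j.*2 + capacity k j.*2.+1).
  exists [:: (N - k.+1, j)%N]; split.
  - by move=> p; rewrite inE => /eqP->; exact: leq_subr.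
  - by move=> i mi ij; exists (N - k.+1, j)%N; rewrite ?inE //= subKn.
  - by rewrite big_seq1.
have [s1 [a1 b1 c1]] := IH j.*2 (ltnW kN).
have [s2 [a2 b2 c2]] := IH j.*2.+1 (ltnW kN).
exists (s1 ++ s2); split.
- by move=> p; rewrite mem_cat => /orP[/a1|/a2].
- move=> i mi; rewrite expnSr divnMA => ij.
  have [e|e] : (i %/ 2 ^ k = j.*2 \/ i %/ 2 ^ k = j.*2.+1)%N by lia.
    by have [p ps pe] := b1 _ mi e; exists p => //; rewrite mem_cat ps.
  by have [p ps pe] := b2 _ mi e; exists p => //; rewrite mem_cat ps orbT.
- by rewrite big_cat lerD.
Qed.

Lemma flow_bounds n j : (n <= N)%N -> 0 <= flow n j <= capacity (N - n) j.
Proof.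
elim: n j => [|n IH] j nN; first by rewrite /= capacity_ge0 subn0 lexx.
have /andP[f0 f1] := IH j./2 (ltnW nN); rewrite [flow _ _]/=.
set s := _ + _; set c := capacity _ _.
have s0 : 0 <= s by rewrite addr_ge0 ?capacity_ge0.
have c0 : 0 <= c by exact: capacity_ge0.
have fs : flow n j./2 <= s.
  apply: (le_trans f1); have -> : (N - n)%N = (N - n.+1).+1 by lia.
  by rewrite /= ge_min lexx orbT.
apply/andP; split; first by rewrite mulr_ge0// divr_ge0.
rewrite mulrCA ler_piMr//.
have [->|sn] := eqVneq s 0; first by rewrite invr0 mulr0.
by rewrite ler_pdivrMr ?mul1r// lt_def sn.
Qed.

Lemma flow_frostman : frostman q N (fun n j => if (n <= N)%N then flow n j else 0).
Proof.
split=> n j.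
- by case: leqP => // nN; have /andP[] := flow_bounds j nN.
- move=> nN; rewrite nN (ltnW nN) /= !doubleK uphalf_double.
  rewrite -mulrDr -mulrDl; set s := _ + _.
  have [s0|sn] := eqVneq s 0; last by rewrite divff// mulr1.
  rewrite s0 mul0r mulr0; have /andP[f0 f1] := flow_bounds j (ltnW nN).
  apply/eqP; rewrite eq_le f0 andbT (le_trans f1)//.
  have -> : (N - n)%N = (N - n.+1).+1 by lia.
  by rewrite /= -s0 ge_min lexx orbT.
- move=> nN; rewrite nN; have /andP[_ f1] := flow_bounds j nN.
  by rewrite (le_trans f1)// (le_trans (capacity_le _ _))// subKn.
Qed.

(** The last clause bounds the total mass below by the cost of an actual cover; this converts
    positive content into mass bounded below independently of [N]. *)
Lemma frostman_exists : exists mu,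
  [/\ frostman q N mu,
      forall n j, (n <= N)%N -> mu n j != 0 -> exists i, meets i /\ (i %/ 2 ^ (N - n) = j)%N &
      exists s : seq (nat * nat),
      [/\ forall p, p \in s -> (p.1 <= N)%N,
      forall i, meets i -> (i < 2 ^ N)%N -> exists2 p, p \in s & (i %/ 2 ^ (N - p.1) = p.2)%N &
      \sum_(p <- s) q ^+ p.1 <= mu 0 0]].
Proof.
exists (fun n j => if (n <= N)%N then flow n j else 0); split.
- exact: flow_frostman.
- move=> n j nN; rewrite nN => f0; apply: capacity_meets; apply: contra_neq f0 => c0.
  by have := flow_bounds j nN; rewrite c0 -eq_le eq_sym => /eqP.
- have [s [s1 s2 s3]] := @capacity_cover N 0 (leqnn _).
  by exists s; split => // i mi iN; apply: s2 => //; rewrite divn_small.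
Qed.

End FrostmanExistence.
End Tree.

(** * Nondegenerate phases *)

Section Phase.
Variable R : realFieldType.

(* [ph_J]: when the level curves belonging to two parameters at distance [r] nearly meet somewhere,
   their gradients span an area of order [r] on the whole unit square. *)
Record phase_ok (B c0 : R) (c1 c2 c3 : R -> R -> R) : Prop := PhaseOk {
  ph_B : 1 <= B;
  ph_c0 : `|c0| <= B;
  ph_c1 : forall u v y, unit_itv u -> unit_itv v -> unit_itv y ->
    B^-1 <= `|c0 * y + c1 u v| <= B;
  ph_c2 : forall u v x, unit_itv u -> unit_itv v -> unit_itv x ->
    B^-1 <= `|c0 * x + c2 u v| <= B;
  ph_lip : forall u v u' v' r, unit_itv u -> unit_itv v -> unit_itv u' -> unit_itv v' ->
    `|u' - u| <= r -> `|v' - v| <= r ->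
    `|c1 u' v' - c1 u v| <= B * r /\ `|c2 u' v' - c2 u v| <= B * r;
  ph_J : forall u v u' v' x y e r,
    unit_itv u -> unit_itv v -> unit_itv u' -> unit_itv v' -> unit_itv x -> unit_itv y ->
    0 < e -> B * e <= r -> Num.max `|u' - u| `|v' - v| = r ->
    `|bilin c0 (c1 u v) (c2 u v) (c3 u v) x y| <= e ->
    `|bilin c0 (c1 u' v') (c2 u' v') (c3 u' v') x y| <= e ->
    forall x' y', unit_itv x' -> unit_itv y' ->
    r / B <= `|(c0 * y' + c1 u v) * (c0 * x' + c2 u' v')
              - (c0 * x' + c2 u v) * (c0 * y' + c1 u' v')| }.

(** Amplitudes other than 1 arise because differentiating a profile of the phase in [x] or [y]
    brings down a partial derivative of the phase. *)
Record amplitude_ok (B : R) (m : R -> R -> R -> R -> R) : Prop := AmplitudeOk {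
  am_B : forall u v x y, unit_itv u -> unit_itv v -> unit_itv x -> unit_itv y ->
    `|m u v x y| <= B;
  am_x : forall u v x x' y, unit_itv u -> unit_itv v -> unit_itv x -> unit_itv x' ->
    unit_itv y -> `|m u v x y - m u v x' y| <= B * `|x - x'|;
  am_y : forall u v x y y', unit_itv u -> unit_itv v -> unit_itv x -> unit_itv y ->
    unit_itv y' -> `|m u v x y - m u v x y'| <= B * `|y - y'| }.

(** [g] oscillates in the sense that it is the derivative of the compactly supported [f]. *)
Record profile_ok (B : R) (f g g1 : R -> R) : Prop := ProfileOk {
  pr_fg : taylor1 B f g; pr_gg1 : taylor1 B g g1;
  pr_fB : bounded_by B f; pr_gB : bounded_by B g; pr_g1B : bounded_by B g1;
  pr_fs : unit_supp f; pr_gs : unit_supp g }.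

Lemma phase_weaken B B' c0 c1 c2 c3 : B <= B' ->
  phase_ok B c0 c1 c2 c3 -> phase_ok B' c0 c1 c2 c3.
Proof.
move=> BB' [B1 h0 h1 h2 h3 h4]; have Bp : 0 < B by apply: lt_le_trans B1.
have B'p : 0 < B' by apply: lt_le_trans BB'.
have iB : B'^-1 <= B^-1 by rewrite lef_pV2.
split; first exact: le_trans BB'.
- exact: le_trans BB'.
- by move=> u v y hu hv hy; have /andP[a b] := h1 u v y hu hv hy; rewrite (le_trans iB a) (le_trans b).
- by move=> u v y hu hv hy; have /andP[a b] := h2 u v y hu hv hy; rewrite (le_trans iB a) (le_trans b).
- move=> u v u' v' r hu hv hu' hv' r1 r2; have r0 : 0 <= r by apply: le_trans r1.
  have [a b] := h3 u v u' v' r hu hv hu' hv' r1 r2.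
  by split; [apply: (le_trans a)|apply: (le_trans b)]; rewrite ler_wpM2r.
- move=> u v u' v' x y e r hu hv hu' hv' hx hy e0 er mr p q x' y' hx' hy'.
  have r0 : 0 <= r by apply: le_trans er; rewrite mulr_ge0 ?ltW.
  apply: le_trans (h4 u v u' v' x y e r hu hv hu' hv' hx hy e0 _ mr p q x' y' hx' hy').
    by rewrite ler_wpM2l.
  by apply: le_trans er; rewrite ler_wpM2r// ltW.
Qed.

Lemma profile_weaken B B' f g g1 : B <= B' -> profile_ok B f g g1 -> profile_ok B' f g g1.
Proof.
move=> BB' [a b c d e h i].
by split => //; [exact: taylor1_weaken a|exact: taylor1_weaken b|exact: bounded_weaken c
  |exact: bounded_weaken d|exact: bounded_weaken e].
Qed.

Section Correlation.
Variables (B c0 : R) (c1 c2 c3 : R -> R -> R) (m : R -> R -> R -> R -> R) (f g g1 : R -> R).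
Hypotheses (ph : phase_ok B c0 c1 c2 c3) (am : amplitude_ok B m) (pr : profile_ok B f g g1).
Variables (L : nat) (d e : R).
Hypotheses (Ld : L%:R * d = 1) (d0 : 0 < d) (e0 : 0 < e) (e1 : e <= 1) (de : d <= e ^+ 5).

(** A product of two amplitudes has bound [B ^+ 2] and Lipschitz constant [2 * B ^+ 2]. *)
Let K := 2 * B ^+ 2.
Let P u v := bilin c0 (c1 u v) (c2 u v) (c3 u v).
Let M u v u' v' x y := m u v x y * m u' v' x y.

Definition pair_corr u v u' v' :=
  d ^+ 2 * corr g L d e c0 (c1 u v) (c2 u v) (c3 u v) (c1 u' v') (c2 u' v') (c3 u' v')
    (M u v u' v').

Lemma BK : B <= K.
Proof.
have B1 := ph_B ph; rewrite /K; apply: (@le_trans _ _ (B ^+ 2)).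
  by rewrite -[leLHS]expr1 ler_weXn2l.
by have : 0 <= B ^+ 2 by [apply: sqr_ge0]; lra.
Qed.

Lemma pair_corr_near u v u' v' :
  unit_itv u -> unit_itv v -> unit_itv u' -> unit_itv v' ->
  `|pair_corr u v u' v'| <= 5 * K ^+ 4 * e.
Proof.
move=> hu hv hu' hv'; have ph' := phase_weaken BK ph; have pr' := profile_weaken BK pr.
apply: (corr_near (ph_B ph') (pr_gB pr') (pr_gs pr') Ld d0 e0 e1 de) => [x hx|x y hx hy].
  exact: (ph_c2 ph').
rewrite /M normrM.
have B0 : 0 <= B by apply: le_trans (ph_B ph).
apply: (@le_trans _ _ (B ^+ 2)); first by rewrite expr2 ler_pM ?(am_B am).
by rewrite /K; have : 0 <= B ^+ 2 by [apply: sqr_ge0]; lra.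
Qed.

Lemma pair_corr_far u v u' v' r :
  unit_itv u -> unit_itv v -> unit_itv u' -> unit_itv v' -> 0 < r ->
  r <= `|u' - u| \/ r <= `|v' - v| ->
  `|pair_corr u v u' v'| <= 132 * K ^+ 11 * (e ^+ 3 / r ^+ 2).
Proof.
move=> hu hv hu' hv' r0 rd.
have ph' := phase_weaken BK ph; have pr' := profile_weaken BK pr.
have K1 := ph_B ph'; have K0 : 0 < K by apply: lt_le_trans K1.
have B0 : 0 <= B by apply: le_trans (ph_B ph).
set s := Num.max `|u' - u| `|v' - v|.
have rs : r <= s by rewrite /s le_max; apply/orP.
have s0 : 0 < s by apply: lt_le_trans rs.
have dist (x y : R) : unit_itv x -> unit_itv y -> `|x - y| <= 1.
  by rewrite /unit_itv ler_norml => /andP[? ?] /andP[? ?]; apply/andP; split; lra.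
have s1 : s <= 1 by rewrite /s ge_max !dist.
have mono : 132 * K ^+ 11 * (e ^+ 3 / s ^+ 2) <= 132 * K ^+ 11 * (e ^+ 3 / r ^+ 2).
  rewrite ler_wpM2l ?mulr_ge0 ?exprn_ge0 ?(ltW K0)// ler_wpM2l ?exprn_ge0 ?(ltW e0)//.
  by rewrite lef_pV2 ?posrE ?exprn_gt0// lerXn2r ?nnegrE// ltW.
apply: le_trans mono.
(* For parameters closer than [K * e] the claimed bound already exceeds the one without
   cancellation. *)
have [Kes|Kes] := leP (K * e) s; last first.
  apply: (le_trans (pair_corr_near hu hv hu' hv')).
  have -> : 132 * K ^+ 11 * (e ^+ 3 / s ^+ 2) = 132 * K ^+ 9 * e * (K * e / s) ^+ 2.
    by field; rewrite gt_eqF.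
  have q1 : 1 <= (K * e / s) ^+ 2 by rewrite exprn_ege1// ler_pdivlMr// mul1r ltW.
  have k9 : K ^+ 4 <= K ^+ 9 by rewrite ler_weXn2l.
  have : K ^+ 4 * e <= K ^+ 9 * e by rewrite ler_wpM2r// ltW.
  have : K ^+ 9 * e * 1 <= K ^+ 9 * e * (K * e / s) ^+ 2.
    by rewrite ler_wpM2l// mulr_ge0 ?exprn_ge0 ?(ltW K0) ?(ltW e0).
  have : 0 <= K ^+ 9 * e by rewrite mulr_ge0 ?exprn_ge0 ?(ltW K0) ?(ltW e0).
  by move=> h1 h2 h3; rewrite -!mulrA in h1 h2 h3 *; lra.
pose both (i j : nat) := (`|P u v (i%:R * d) (j%:R * d)| <= e) && (`|P u' v' (i%:R * d) (j%:R * d)| <= e).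
have gu i : (i < L)%N -> unit_itv (i%:R * d).
  move=> iL; apply/andP; split; first by rewrite mulr_ge0 ?(ltW d0).
  by rewrite -[leRHS]Ld ler_wpM2r ?(ltW d0)// ler_nat ltnW.
(* [ph_J] asks for one point common to both strips. If the grid has none, every term of [corr]
   vanishes. *)
have [/existsP[i /existsP[j /andP[p q]]]|none] :=
    boolP [exists i : 'I_L, exists j : 'I_L, both i j]; last first.
  rewrite /pair_corr /corr big1 => [|i _].
    by rewrite mulr0 normr0 !mulr_ge0 ?exprn_ge0 ?invr_ge0 ?exprn_ge0 ?(ltW K0) ?(ltW e0) ?(ltW s0).
  rewrite big1 // => j _.
  have [->|gn] := eqVneq (g (P u v (i%:R * d) (j%:R * d) / e)) 0; first by rewrite mul0r mulr0.
  have [->|gn'] := eqVneq (g (P u' v' (i%:R * d) (j%:R * d) / e)) 0; first by rewrite !mulr0.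
  have p1 := scaled_supp e0 (pr_gs pr) gn; have p2 := scaled_supp e0 (pr_gs pr) gn'.
  move/existsP: none; case; exists i; apply/existsP; exists j.
  by rewrite /both p1 p2.
have es : e <= s by apply: le_trans Kes; rewrite ler_peMl// ltW.
have [d1 d2] : `|u' - u| <= s /\ `|v' - v| <= s.
  by split; rewrite /s le_max lexx ?orbT.
have [l1 l2] := ph_lip ph' hu hv hu' hv' d1 d2.
have s1' := s1; rewrite /pair_corr.
refine (@corr_far _ _ _ _ _ K1 (pr_fg pr') (pr_gg1 pr') (pr_fB pr') (pr_gB pr') (pr_g1B pr')
  (pr_fs pr') (pr_gs pr') _ _ _ Ld d0 e0 e1 de _ _ _ _ _ _ _ (ph_c0 ph')
  _ _ _ _ _ _ _ _ _ es s1 l1 l2 _).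
- by move=> y hy; apply: (ph_c1 ph').
- by move=> y hy; apply: (ph_c2 ph').
- by move=> y hy; have /andP[] := ph_c1 ph' hu' hv' hy.
- by move=> y hy; have /andP[] := ph_c2 ph' hu' hv' hy.
- move=> x y hx hy; rewrite /M normrM.
  apply: (@le_trans _ _ (B ^+ 2)); first by rewrite expr2 ler_pM ?(am_B am).
  by rewrite /K; have : 0 <= B ^+ 2 by [apply: sqr_ge0]; lra.
- move=> x x' y hx hx' hy; rewrite /M.
  have -> : m u v x y * m u' v' x y - m u v x' y * m u' v' x' y =
    m u v x y * (m u' v' x y - m u' v' x' y) + (m u v x y - m u v x' y) * m u' v' x' y by ring.
  have -> : K * `|x - x'| = B * (B * `|x - x'|) + B * `|x - x'| * B by rewrite /K; ring.
  rewrite (le_trans (ler_normD _ _))// !normrM.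
  by rewrite lerD// ler_pM ?(am_B am) ?(am_x am).
- move=> x y y' hx hy hy'; rewrite /M.
  have -> : m u v x y * m u' v' x y - m u v x y' * m u' v' x y' =
    m u v x y * (m u' v' x y - m u' v' x y') + (m u v x y - m u v x y') * m u' v' x y' by ring.
  have -> : K * `|y - y'| = B * (B * `|y - y'|) + B * `|y - y'| * B by rewrite /K; ring.
  rewrite (le_trans (ler_normD _ _))// !normrM.
  by rewrite lerD// ler_pM ?(am_B am) ?(am_y am).
- move=> x y hx hy.
  exact: (ph_J ph' hu hv hu' hv' (gu _ (ltn_ord i)) (gu _ (ltn_ord j)) e0 Kes erefl p q hx hy).
Qed.

End Correlation.
End Phase.

(** * Energy of an oscillating field *)

Lemma level_shift N n l : (l <= n)%N -> (n <= N)%N ->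
  [/\ (N - n + l = N - (n - l))%N, (N - n + l <= N)%N & (N - (N - n + l) + l = n)%N].
Proof. by move=> ln nN; split; lia. Qed.

Section Energy.
Variables (R : realFieldType) (q : R).
Hypotheses (q_gt : 2^-1 < q).
Variables (B c0 : R) (c1 c2 c3 : R -> R -> R) (m : R -> R -> R -> R -> R) (f g g1 : R -> R).
Hypotheses (ph : phase_ok B c0 c1 c2 c3) (am : amplitude_ok B m) (pr : profile_ok B f g g1).
Variables (N n L : nat) (mu1 mu2 : nat -> nat -> R).
Hypotheses (fr1 : frostman q N mu1) (fr2 : frostman q N mu2) (nN : (n <= N)%N).
Variable d : R.
Let e : R := 2^-1 ^+ n.
Hypotheses (Ld : L%:R * d = 1) (d0 : 0 < d) (de : d <= e ^+ 5).

Let q0 : 0 < q. Proof. by move: q_gt; lra. Qed.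
Let e0 : 0 < e. Proof. by rewrite exprn_gt0// invr_gt0. Qed.
Let e1 : e <= 1. Proof. by rewrite exprn_ile1//; lra. Qed.

(** With [q = 2^-s] this is 2^{2s-2}, the ratio between the contributions of consecutive dyadic
    distances; it is below 1 exactly when s < 1. *)
Let ratio := (4 * q ^+ 2)^-1.
Let Q4 : 1 < 4 * q ^+ 2. Proof. by move: q_gt; nra. Qed.

Definition dyadic (N j : nat) : R := j%:R * 2^-1 ^+ N.
Let u := dyadic N.

Lemma dyadic_unit M j : (j < 2 ^ M)%N -> unit_itv (dyadic M j).
Proof.
move=> jN; rewrite /unit_itv /dyadic exprVn; apply/andP; split.
  by rewrite mulr_ge0 ?invr_ge0 ?exprn_ge0.
by rewrite ler_pdivrMr ?exprn_gt0// mul1r -natrX ler_nat ltnW.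
Qed.

Definition energy_const (B q : R) := 36 * (132 * (2 * B ^+ 2) ^+ 11) / (1 - (4 * q ^+ 2)^-1).

Let C := 132 * (2 * B ^+ 2) ^+ 11.
Let C0 : 0 <= C.
Proof. by rewrite mulr_ge0// exprn_ge0// mulr_ge0// exprn_ge0// (le_trans _ (ph_B ph)). Qed.

Let pc := pair_corr c0 c1 c2 c3 m g L d e.

Let nb k (i i' : nat) := ((i' < i + 2 ^ k) && (i < i' + 2 ^ k))%N.

Lemma not_nb k i i' : (k <= N)%N -> ~~ nb k i i' -> 2^-1 ^+ (N - k) <= `|u i' - u i|.
Proof.
move=> kN; rewrite negb_and -!leqNgt => H.
have -> : 2^-1 ^+ (N - k) = (2 ^ k)%:R * 2^-1 ^+ N :> R.
  by rewrite natrX !exprVn -[in RHS](subnK kN) exprD invfM mulrCA divff ?mulr1 ?expf_neq0 ?pnatr_eq0.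
rewrite /u /dyadic -mulrBl normrM (ger0_norm (x := _ ^+ N)) ?exprn_ge0 ?invr_ge0//.
rewrite ler_wpM2r ?exprn_ge0 ?invr_ge0//.
case/orP: H => H.
  rewrite -natrB ?(leq_trans (leq_addr _ _) H)// normr_nat ler_nat.
  by rewrite leq_subRL ?(leq_trans (leq_addr _ _) H).
rewrite distrC -natrB ?(leq_trans (leq_addr _ _) H)// normr_nat ler_nat.
by rewrite leq_subRL ?(leq_trans (leq_addr _ _) H).
Qed.

Lemma layer_ge0 k : 0 <= 4 * C * e * 4^-1 ^+ k.
Proof.
apply: mulr_ge0; last by rewrite exprn_ge0 ?invr_ge0.
by apply: mulr_ge0 (ltW e0); exact: mulr_ge0.
Qed.

(** Layer [l] collects the pairs at distance less than [2^l * e] in both coordinates, and the least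
    such [l] carries the bound. If it is positive, minimality puts the distance at [2^(l-1) * e] at
    least, whence the factor 4; the other layers only add nonnegative terms. *)
Lemma pair_corr_layers i j i' j' :
  (i < 2 ^ N)%N -> (j < 2 ^ N)%N -> (i' < 2 ^ N)%N -> (j' < 2 ^ N)%N ->
  `|pc (u i) (u j) (u i') (u j')| <=
  \sum_(l < n.+1) 4 * C * e * 4^-1 ^+ l * ((nb (N - n + l) i i')%:R * (nb (N - n + l) j j')%:R).
Proof.
move=> hi hj hi' hj'; have ui := dyadic_unit hi; have uj := dyadic_unit hj.
have ui' := dyadic_unit hi'; have uj' := dyadic_unit hj'.
pose c l := (l <= n)%N && (nb (N - n + l) i i' && nb (N - n + l) j j').
have ex : exists l, c l.
  exists n; rewrite /c leqnn subnK// /nb /=.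
  by rewrite !(leq_trans hi', leq_trans hi, leq_trans hj', leq_trans hj) ?leq_addl.
case: (ex_minnP ex) => l /andP[ln /andP[n1 n2]] lmin.
have t0 := layer_ge0.
rewrite (bigD1 (Ordinal (ln : (l < n.+1)%N)))//= n1 n2 !mulr1 ler_wpDr//.
  by apply: sumr_ge0 => k _; apply: mulr_ge0 => //; rewrite mulr_ge0.
case: l ln n1 n2 lmin => [|l] ln n1 n2 lmin.
  rewrite expr0 mulr1; apply: (le_trans (pair_corr_near ph am pr Ld d0 e0 e1 de ui uj ui' uj')).
  have K1 : 1 <= 2 * B ^+ 2.
    by have : 1 <= B ^+ 2 by [rewrite exprn_ege1// (ph_B ph)]; lra.
  have : (2 * B ^+ 2) ^+ 4 <= (2 * B ^+ 2) ^+ 11 by rewrite ler_weXn2l.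
  move=> /(ler_wpM2r (ltW e0)); rewrite -/e /C.
  have : 0 <= (2 * B ^+ 2) ^+ 11 * e by rewrite mulr_ge0 ?(ltW e0)// exprn_ge0// (le_trans _ K1).
  by move=> h1 h2; rewrite -!mulrA in h1 h2 *; lra.
have ncl : ~~ c l by apply/negP => /lmin; rewrite ltnn.
have [_ kN El] := level_shift (ltnW ln) nN.
pose r : R := 2^-1 ^+ (N - (N - n + l)).
have r0 : 0 < r by rewrite exprn_gt0// invr_gt0.
have rd : r <= `|u i' - u i| \/ r <= `|u j' - u j|.
  move: ncl; rewrite /c (ltnW ln) /= negb_and => /orP[h|h]; [left|right]; exact: not_nb.
apply: (le_trans (pair_corr_far ph am pr Ld d0 e0 e1 de ui uj ui' uj' r0 rd)).
rewrite -/C.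
have -> : e = r * 2^-1 ^+ l by rewrite /e /r -exprD El.
rewrite le_eqVlt; apply/orP; left; apply/eqP.
have -> : 4^-1 ^+ l.+1 = 4^-1 * (2^-1 ^+ l) ^+ 2 :> R.
  by rewrite exprS -exprM mulnC exprM; congr (_ * _ ^+ _); field.
by field; rewrite gt_eqF.
Qed.

Lemma energy_row i j : (i < 2 ^ N)%N -> (j < 2 ^ N)%N ->
  \sum_(i' < 2 ^ N) \sum_(j' < 2 ^ N) mu1 N i' * mu2 N j' * `|pc (u i) (u j) (u i') (u j')|
  <= energy_const B q * (e * q ^+ (2 * n)).
Proof.
move=> hi hj.
pose a l : R := 4 * C * e * 4^-1 ^+ l.
have a0 l : 0 <= a l by exact: layer_ge0.
apply: (@le_trans _ _ (\sum_(l < n.+1) a l *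
    ((\sum_(i' < 2 ^ N) mu1 N i' * (nb (N - n + l) i i')%:R) *
     (\sum_(j' < 2 ^ N) mu2 N j' * (nb (N - n + l) j j')%:R)))).
  under [leRHS]eq_bigr do rewrite big_distrlr mulr_sumr.
  rewrite [leRHS]exchange_big; apply: ler_sum => i' _ /=.
  under [leRHS]eq_bigr do rewrite mulr_sumr.
  rewrite [leRHS]exchange_big; apply: ler_sum => j' _ /=.
  apply: (@le_trans _ _ (mu1 N i' * mu2 N j' * \sum_(l < n.+1)
     a l * ((nb (N - n + l) i i')%:R * (nb (N - n + l) j j')%:R))).
    by rewrite ler_wpM2l ?mulr_ge0 ?(fr_ge0 fr1) ?(fr_ge0 fr2)// pair_corr_layers.
  rewrite mulr_sumr; apply: ler_sum => l _.
  by rewrite le_eqVlt; apply/orP; left; apply/eqP; ring.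
(* Each of the two sums over a neighbourhood is at most [3 * q ^+ (n - l)], and 36 is 4 * 3 * 3. *)
apply: (@le_trans _ _ (\sum_(l < n.+1) 36 * C * (e * q ^+ (2 * n)) * ratio ^+ l)).
  apply: ler_sum => l _.
  have mN : (n - l <= N)%N by apply: leq_trans (leq_subr _ _) nN.
  have [El _ _] := @level_shift N n l (ltn_ord l) nN.
  have S1 := fr_ball fr1 i (ltW q0) mN; have S2 := fr_ball fr2 j (ltW q0) mN.
  have -> : 36 * C * (e * q ^+ (2 * n)) * ratio ^+ l =
      a l * ((3 * q ^+ (n - l)) * (3 * q ^+ (n - l))).
    have -> : q ^+ (2 * n) = (q ^+ (n - l) * q ^+ l) ^+ 2.
      by rewrite -exprD (subnK (ltn_ord l : (l <= n)%N)) -exprM mulnC.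
    have qn : q ^+ l != 0 by rewrite expf_neq0// gt_eqF.
    have -> : ratio ^+ l = 4^-1 ^+ l * ((q ^+ l) ^+ 2)^-1.
      by rewrite /ratio invfM exprMn; congr (_ * _); rewrite exprVn -!exprM mulnC.
    by rewrite /a; field.
  rewrite ler_wpM2l// El; apply: ler_pM => //.
    by apply: sumr_ge0 => k _; rewrite mulr_ge0 ?(fr_ge0 fr1).
  by apply: sumr_ge0 => k _; rewrite mulr_ge0 ?(fr_ge0 fr2).
rewrite -mulr_sumr.
have rt1 : ratio < 1 by rewrite invf_lt1// (lt_trans _ Q4).
have rt0 : 0 <= ratio by rewrite invr_ge0 ltW// (lt_trans _ Q4).
have geo : \sum_(l < n.+1) ratio ^+ l <= (1 - ratio)^-1.
  rewrite -[leRHS]mulr1 ler_pdivlMl ?subr_gt0//.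
  have -> : (1 - ratio) * \sum_(l < n.+1) ratio ^+ l = 1 - ratio ^+ n.+1.
    by rewrite -[1 - ratio]opprB mulNr -subrX1 opprB.
  by rewrite gerBl exprn_ge0.
apply: le_trans (ler_wpM2l _ geo) _.
  apply: mulr_ge0; first exact: mulr_ge0.
  by rewrite mulr_ge0 ?(ltW e0) ?exprn_ge0 ?(ltW q0).
by rewrite /energy_const -/C -/ratio le_eqVlt; apply/orP; left; apply/eqP; ring.
Qed.

Definition local_sum (M : nat) (x y : R) : R :=
  \sum_(i < 2 ^ M) \sum_(j < 2 ^ M) mu1 M i * mu2 M j *
    (m (dyadic M i) (dyadic M j) x y *
     g (bilin c0 (c1 (dyadic M i) (dyadic M j)) (c2 (dyadic M i) (dyadic M j))
          (c3 (dyadic M i) (dyadic M j)) x y / e)).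

(** Expanding the square turns the weighted norm into a sum of [pair_corr] over pairs of parameters.
    [energy_row] bounds the sum over the second parameter, and the first is integrated against a
    mass of at most 1. *)
Lemma energy_bound :
  d ^+ 2 * \sum_(i < L) \sum_(j < L) parab (i%:R * d) * parab (j%:R * d) *
    local_sum N (i%:R * d) (j%:R * d) ^+ 2
  <= energy_const B q * (e * q ^+ (2 * n)).
Proof.
pose X : finType := ('I_(2 ^ N) * 'I_(2 ^ N))%type.
pose w (p : X) := mu1 N p.1 * mu2 N p.2.
pose k (p : X) x y := m (u p.1) (u p.2) x y *
     g (bilin c0 (c1 (u p.1) (u p.2)) (c2 (u p.1) (u p.2)) (c3 (u p.1) (u p.2)) x y / e).
have fE x y : local_sum N x y = \sum_(p : X) w p * k p x y by rewrite /local_sum pair_bigA.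
have w0 p : 0 <= w p by rewrite mulr_ge0 ?(fr_ge0 fr1) ?(fr_ge0 fr2).
have -> : d ^+ 2 * \sum_(i < L) \sum_(j < L) parab (i%:R * d) * parab (j%:R * d) *
    local_sum N (i%:R * d) (j%:R * d) ^+ 2 =
    \sum_(p : X) w p * \sum_(p' : X) w p' * pc (u p.1) (u p.2) (u p'.1) (u p'.2).
  pose Z : finType := ('I_L * 'I_L)%type.
  pose c (z : Z) := d ^+ 2 * (parab (z.1%:R * d) * parab (z.2%:R * d)).
  pose K (p : X) (z : Z) := k p (z.1%:R * d) (z.2%:R * d).
  have pcE (p p' : X) : pc (u p.1) (u p.2) (u p'.1) (u p'.2) = \sum_z c z * (K p z * K p' z).
    rewrite /pc /pair_corr /corr pair_bigA /= mulr_sumr; apply: eq_bigr => z _.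
    by rewrite /c /K /k; ring.
  transitivity (\sum_(z : Z) \sum_(p : X) \sum_(p' : X) w p * (w p' * (c z * (K p z * K p' z)))).
    rewrite pair_bigA /= mulr_sumr; apply: eq_bigr => z _.
    rewrite fE [(\sum_(p : X) _) ^+ 2]expr2 big_distrlr /= !mulr_sumr; apply: eq_bigr => p _.
    rewrite !mulr_sumr; apply: eq_bigr => p' _.
    by rewrite /c /K; ring.
  rewrite exchange_big; apply: eq_bigr => p _.
  rewrite exchange_big mulr_sumr; apply: eq_bigr => p' _.
  by rewrite pcE !mulr_sumr.
apply: (@le_trans _ _ (\sum_(p : X) w p * (energy_const B q * (e * q ^+ (2 * n))))).
  apply: ler_sum => p _; rewrite ler_wpM2l//.
  apply: le_trans (energy_row (ltn_ord p.1) (ltn_ord p.2)).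
  rewrite [leRHS]pair_bigA; apply: ler_sum => p' _.
  by rewrite ler_wpM2l// ler_norm.
rewrite -mulr_suml.
have -> : \sum_(p : X) w p = mu1 0 0 * mu2 0 0.
  rewrite -(fr_mass fr1 (leqnn N)) -(fr_mass fr2 (leqnn N)) big_distrlr /=.
  by rewrite pair_bigA.
rewrite ler_piMl//.
  apply: mulr_ge0; last by rewrite mulr_ge0 ?(ltW e0)// exprn_ge0// ltW.
  apply: mulr_ge0; first exact: mulr_ge0.
  by rewrite invr_ge0 subr_ge0 invf_le1 ?(ltW Q4)// (lt_trans _ Q4).
by rewrite mulr_ile1 ?(fr_ge0 fr1) ?(fr_ge0 fr2) ?(fr_le fr1 0 (leq0n _)) ?(fr_le fr2 0 (leq0n _)).
Qed.

End Energy.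

(** * Densities on the grid *)

Section Density.
Variables (R : realFieldType) (q : R) (N M : nat) (mu : nat -> nat -> R).
Hypotheses (fr : frostman q N mu) (NM : (N <= M)%N).

(** The mass of an interval of level [n], spread evenly over its cells of size 2^-M. *)
Definition dens (mu : nat -> nat -> R) (M n i : nat) : R :=
  mu n (i %/ 2 ^ (M - n))%N * 2^-1 ^+ (M - n).

Lemma dens_ge0 n i : 0 <= dens mu M n i.
Proof. by rewrite mulr_ge0 ?(fr_ge0 fr)// exprn_ge0// invr_ge0. Qed.

Lemma two_pow_inv k : (2 ^ k)%:R * 2^-1 ^+ k = 1 :> R.
Proof. by rewrite natrX exprVn divff// expf_neq0// pnatr_eq0. Qed.

Lemma dens_block n c : \sum_(i < 2 ^ (M - n)) dens mu M n (c * 2 ^ (M - n) + i)%N = mu n c.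
Proof.
under eq_bigr => i _ do rewrite /dens divnMDl ?expn_gt0// divn_small// addn0.
by rewrite sumr_const card_ord -[LHS]mulr_natr -mulrA [_ * _%:R]mulrC two_pow_inv mulr1.
Qed.

Lemma dens_total n : (n <= N)%N -> \sum_(i < 2 ^ M) dens mu M n i = mu 0 0.
Proof.
move=> nN; have -> : (2 ^ M = 2 ^ n * 2 ^ (M - n))%N.
  by rewrite -expnD subnKC// (leq_trans nN).
rewrite (sum_blocks (dens mu M n)).
under eq_bigr => c _ do rewrite dens_block.
by rewrite (fr_mass fr nN).
Qed.

Lemma dens_mass n : (n <= N)%N -> \sum_(i < 2 ^ M) dens mu M n i <= 1.
Proof. by move=> nN; rewrite dens_total// (fr_le fr 0 (leq0n _)). Qed.

Lemma dens_le n i : (n <= N)%N -> dens mu M n i <= (2 * q) ^+ n * 2^-1 ^+ M.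
Proof.
move=> nN; have nM := leq_trans nN NM.
have -> : (2 * q) ^+ n * 2^-1 ^+ M = q ^+ n * 2^-1 ^+ (M - n).
  transitivity (q ^+ n * 2^-1 ^+ (M - n) * ((2 ^ n)%:R * 2^-1 ^+ n)).
    by rewrite natrX -[in LHS](subnK nM) exprD exprMn; ring.
  by rewrite two_pow_inv mulr1.
by rewrite ler_wpM2r ?(fr_le fr)// exprn_ge0// invr_ge0.
Qed.

Lemma dens_block_succ n c : (n < N)%N ->
  \sum_(i < 2 ^ (M - n)) dens mu M n.+1 (c * 2 ^ (M - n) + i)%N = mu n c.
Proof.
move=> nN; have E : (M - n = (M - n.+1).+1)%N by move: NM nN; lia.
rewrite E expnS mul2n -addnn big_split_ord /=.
have := dens_block n.+1 (c.*2); have := dens_block n.+1 (c.*2.+1).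
rewrite (fr_add fr c nN) => <- <-; congr (_ + _); apply: eq_bigr => i _;
  congr dens; rewrite mulnDr -addnA -?muln2 -?mul2n; nia.
Qed.

(** The difference of the two densities has mean zero on each interval of level [n], so [F] may be
    recentred at the left end of the interval, where it is bounded by its variation. The factor
    [2 ^ (M - n)] converts density into mass. *)
Lemma dens_step n (F : nat -> R) : (n < N)%N ->
  `|\sum_(i < 2 ^ M) (dens mu M n i - dens mu M n.+1 i) * F i|
  <= 2 * (2 ^ (M - n))%:R * \sum_(i < 2 ^ M) dens mu M n i * `|F i.+1 - F i|.
Proof.
move=> nN; have nM : (n <= M)%N by move: NM nN; lia.
set b := (2 ^ (M - n))%N; have -> : (2 ^ M = 2 ^ n * b)%N by rewrite -expnD subnKC.
rewrite (sum_blocks (fun i => (dens mu M n i - dens mu M n.+1 i) * F i)).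
rewrite (sum_blocks (fun i => dens mu M n i * `|F i.+1 - F i|)).
rewrite mulr_sumr (le_trans (ler_norm_sum _ _ _))// ler_sum// => c _.
pose D i := dens mu M n (c * b + i)%N - dens mu M n.+1 (c * b + i)%N.
have D0 : \sum_(i < b) D i = 0.
  by rewrite /D sumrB dens_block dens_block_succ// subrr.
have -> : \sum_(i < b) (dens mu M n (c * b + i)%N - dens mu M n.+1 (c * b + i)%N) * F (c * b + i)%N
   = \sum_(i < b) D i * (F (c * b + i)%N - F (c * b + 0)%N).
  by under [RHS]eq_bigr do rewrite mulrBr; rewrite sumrB -mulr_suml D0 mul0r subr0.
pose V := \sum_(i < b) `|F (c * b + i).+1 - F (c * b + i)%N|.
have V0 : 0 <= V by apply: sumr_ge0.
have HV k : (k <= b)%N -> `|F (c * b + k)%N - F (c * b + 0)%N| <=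
    \sum_(i < k) `|F (c * b + i).+1 - F (c * b + i)%N|.
  elim: k => [|k IH] kb; first by rewrite subrr normr0 big_ord0.
  rewrite big_ord_recr /= addnS.
  have -> : F (c * b + k).+1 - F (c * b + 0)%N =
    (F (c * b + k)%N - F (c * b + 0)%N) + (F (c * b + k).+1 - F (c * b + k)%N) by ring.
  by rewrite (le_trans (ler_normD _ _))// lerD// IH// ltnW.
have HVb i : (i < b)%N -> `|F (c * b + i)%N - F (c * b + 0)%N| <= V.
  move=> ib; apply: (le_trans (HV i (ltnW ib))).
  rewrite /V -(subnKC (ltnW ib)) big_split_ord /= lerDl; exact: sumr_ge0.
have -> : 2 * b%:R * (\sum_(i < b) dens mu M n (c * b + i)%N * `|F (c * b + i).+1 - F (c * b + i)%N|)
    = (2 * mu n c) * V.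
  rewrite /V !mulr_sumr; apply: eq_bigr => i _; rewrite !mulrA; congr (_ * _).
  rewrite /dens -/b divnMDl ?expn_gt0// divn_small// addn0.
  have -> : 2 * b%:R * mu n c * 2^-1 ^+ (M - n) = 2 * mu n c * (b%:R * 2^-1 ^+ (M - n)) by ring.
  by rewrite two_pow_inv mulr1.
apply: (@le_trans _ _ (\sum_(i < b) (dens mu M n (c * b + i)%N + dens mu M n.+1 (c * b + i)%N) * V)).
  rewrite (le_trans (ler_norm_sum _ _ _))// ler_sum// => i _.
  rewrite normrM ler_pM ?HVb// (le_trans (ler_normB _ _))//.
  by rewrite !ger0_norm ?dens_ge0.
rewrite -mulr_suml big_split /= dens_block dens_block_succ//.
by have -> : mu n c + mu n c = 2 * mu n c by ring.
Qed.

End Density.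

(** * Comparison of consecutive scales *)

Lemma dsum_linear (R : comNzRingType) (a b : R) (F G : nat -> nat -> R) (L : nat) :
  \sum_(i < L) \sum_(j < L) (a * F i j + b * G i j) =
  a * \sum_(i < L) \sum_(j < L) F i j + b * \sum_(i < L) \sum_(j < L) G i j.
Proof.
rewrite !mulr_sumr -big_split; apply: eq_bigr => i _.
by rewrite !mulr_sumr -big_split.
Qed.

Section Counting.
Variables (R : realFieldType) (q om : R).
Hypotheses (q_gt : 2^-1 < q) (q_lt : q < 1) (om0 : 0 < om) (om2 : om ^+ 2 = 2).
Variables (B c0 : R) (c1 c2 c3 : R -> R -> R).
Hypotheses (ph : phase_ok B c0 c1 c2 c3).
Variables (N : nat) (mu1 mu2 mu3 mu4 : nat -> nat -> R).
Hypotheses (fr1 : frostman q N mu1) (fr2 : frostman q N mu2)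
  (fr3 : frostman q N mu3) (fr4 : frostman q N mu4).

(* Keeps the measure away from the zeros of [parab]. *)
Definition centred (N : nat) (mu : nat -> nat -> R) := forall n j, (2 <= n <= N)%N ->
  mu n j != 0 -> (2 ^ n <= 4 * j)%N /\ (4 * j.+1 <= 3 * 2 ^ n)%N.
Hypotheses (ce3 : centred N mu3) (ce4 : centred N mu4).

(* A grid so fine that its mesh satisfies the hypothesis [d <= e ^+ 5] of [corr_far] at all scales. *)
Let M := (5 * N)%N.
Let d : R := 2^-1 ^+ M.
Let z := dyadic R M.

Let NM : (N <= M)%N. Proof. by rewrite leq_pmull. Qed.
Let q0 : 0 < q. Proof. by move: q_gt; lra. Qed.
Let d0 : 0 < d. Proof. by rewrite exprn_gt0// invr_gt0. Qed.
Let Ld : (2 ^ M)%:R * d = 1. Proof. exact: two_pow_inv. Qed.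

Lemma dens_centred mu n i : centred N mu -> (2 <= n <= N)%N -> dens mu M n i != 0 ->
  3 / 16 <= parab (z i).
Proof.
move=> ce nN; rewrite /dens mulf_eq0 negb_or => /andP[mn _].
have [h1 h2] := ce n _ nN mn.
have nM : (n <= M)%N by case/andP: nN => _ h; apply: leq_trans h NM.
have E : (2 ^ M = 2 ^ n * 2 ^ (M - n))%N by rewrite -expnD subnKC.
have b0 : (0 < 2 ^ (M - n))%N by rewrite expn_gt0.
have g1 : (2 ^ M <= 4 * i)%N.
  rewrite E; apply: leq_trans (leq_mul h1 (leqnn _)) _.
  by rewrite -mulnA leq_mul2l leq_divM.
have g2 : (4 * i <= 3 * 2 ^ M)%N.
  rewrite E mulnA; apply: leq_trans (leq_mul h2 (leqnn _)).
  by rewrite -mulnA leq_mul2l /= ltnW// ltn_ceil.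
have k1 : 1 <= 4 * z i.
  by rewrite -[leLHS]Ld mulrA ler_wpM2r ?(ltW d0)// -natrM ler_nat.
have k2 : 4 * z i <= 3.
  by rewrite -[leRHS]mulr1 -[X in 3 * X]Ld !mulrA ler_wpM2r ?(ltW d0)// -!natrM ler_nat.
by rewrite /parab; move: (z i) k1 k2 => y k1 k2; nra.
Qed.

Let EC := energy_const B q.

Let mesh k : (k <= N)%N -> d <= (2^-1 ^+ k) ^+ 5.
Proof.
move=> kN; rewrite -exprM /d /M ler_wiXn2l ?invr_ge0//; first by lra.
by rewrite mulnC leq_mul2l.
Qed.

(** Cauchy-Schwarz against the energy, in the form [w * h <= (lam * w^2 + h^2 / lam) / 2]. The
    levels [n3] and [n4] may differ by one because the two densities are refined one after the
    other. *)
Lemma weighted_l1 m f g g1 n k n3 n4 :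
  amplitude_ok B m -> profile_ok B f g g1 ->
  (2 <= n3 <= N)%N -> (2 <= n4 <= N)%N -> (n3 <= n.+1)%N -> (n4 <= n.+1)%N ->
  (n <= k <= N)%N ->
  \sum_(i < 2 ^ M) \sum_(j < 2 ^ M) dens mu3 M n3 i * dens mu4 M n4 j *
    `|local_sum c0 c1 c2 c3 m g k mu1 mu2 N (z i) (z j)|
  <= (2 + 15 * EC) * (om * q ^+ 2) ^+ n.
Proof.
move=> am pr n3N n4N n3n n4n /andP[nk kN].
have [[_ n3N'] [_ n4N']] := (andP n3N, andP n4N).
pose H i j := local_sum c0 c1 c2 c3 m g k mu1 mu2 N (z i) (z j).
pose W i j := dens mu3 M n3 i * dens mu4 M n4 j.
have W0 i j : 0 <= W i j by rewrite mulr_ge0// ?(dens_ge0 _ fr3) ?(dens_ge0 _ fr4).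
have en := energy_bound q_gt ph am pr fr1 fr2 kN Ld d0 (mesh kN).
(* As [om] is the square root of 2, [mu] is 2^{-3n/2}. This value balances the two halves: both
   become multiples of [(om * q ^+ 2) ^+ n]. *)
pose mu : R := ((om ^+ 3)^-1) ^+ n; pose lam := mu / d ^+ 2.
have mu0 : 0 < mu by rewrite exprn_gt0// invr_gt0 exprn_gt0.
have lam0 : 0 < lam by rewrite divr_gt0// exprn_gt0.
pose S := 4 * (2 * q) ^+ (2 * n) * d ^+ 2.
have dle nu mm i : frostman q N mm -> (nu <= N)%N -> (nu <= n.+1)%N ->
    dens mm M nu i <= 2 * (2 * q) ^+ n * d.
  move=> fr nuN nun; apply: (le_trans (dens_le fr NM i nuN)).
  rewrite ler_wpM2r ?(ltW d0)//; apply: (@le_trans _ _ ((2 * q) ^+ n.+1)).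
    by rewrite ler_weXn2l//; move: q_gt; lra.
  by rewrite exprS ler_wpM2r ?exprn_ge0 ?mulr_ge0 ?(ltW q0)//; move: q_lt; lra.
have WS i j : W i j <= S.
  have -> : S = (2 * (2 * q) ^+ n * d) * (2 * (2 * q) ^+ n * d).
    by rewrite /S mulnC exprM; ring.
  by rewrite ler_pM ?(dens_ge0 _ fr3) ?(dens_ge0 _ fr4)// dle.
have pt i j : (i < 2 ^ M)%N -> (j < 2 ^ M)%N -> W i j * `|H i j| <= lam * S / 2 * W i j +
    15 / lam * (parab (z i) * parab (z j) * H i j ^+ 2).
  move=> iM jM; have /andP[p1 _] := parab_bound (dyadic_unit R iM).
  have /andP[p2 _] := parab_bound (dyadic_unit R jM).
  have H2 : 0 <= H i j ^+ 2 by exact: sqr_ge0.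
  have il : 0 <= lam^-1 by rewrite invr_ge0 ltW.
  have [w0|wn] := eqVneq (W i j) 0.
    rewrite w0 mul0r mulr0 add0r; apply: mulr_ge0; first exact: mulr_ge0.
    by apply: mulr_ge0 => //; exact: mulr_ge0.
  move: wn; rewrite mulf_eq0 negb_or => /andP[w3 w4].
  have pp : 9 / 256 <= parab (z i) * parab (z j).
    have := ler_pM _ _ (dens_centred ce3 n3N w3) (dens_centred ce4 n4N w4).
    by move=> /(_ ltac:(lra) ltac:(lra)); apply: le_trans; lra.
  have A1 : W i j * `|H i j| <= (lam * W i j ^+ 2 + H i j ^+ 2 / lam) / 2.
    have := sqr_ge0 (lam * W i j - `|H i j|).
    rewrite -[in H i j ^+ 2](real_normK (num_real (H i j))).
    move: (W i j) (`|H i j|) => w h.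
    have -> : (lam * w - h) ^+ 2 = lam * (lam * w ^+ 2 + h ^+ 2 / lam - 2 * (w * h)).
      by field; rewrite gt_eqF.
    by rewrite pmulr_rge0//; lra.
  have A2 : lam * W i j ^+ 2 <= lam * S * W i j.
    by rewrite -mulrA ler_wpM2l ?(ltW lam0)// expr2 ler_wpM2r.
  (* The constant 30, and with it 15, comes from 30 * 9 / 256 > 1. *)
  have A3 : H i j ^+ 2 / lam <= 30 / lam * (parab (z i) * parab (z j) * H i j ^+ 2).
    move: (parab (z i) * parab (z j)) (H i j ^+ 2) (lam^-1) pp H2 il => p h l pp h0 l0.
    have : 0 <= h * l * (30 * p - 1) by apply: mulr_ge0; [exact: mulr_ge0|lra].
    lra.
  move: A1 A2 A3; move: (W i j * _) (lam * _ ^+ 2) (H i j ^+ 2) (parab (z i) * parab (z j)) => a b c p.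
  by move: (lam^-1) => l; lra.
have -> : (2 + 15 * EC) * (om * q ^+ 2) ^+ n = 2 * (om * q ^+ 2) ^+ n + 15 * EC * (om * q ^+ 2) ^+ n by ring.
apply: (@le_trans _ _ (\sum_(i < 2 ^ M) \sum_(j < 2 ^ M) (lam * S / 2 * W i j +
    15 / lam * (parab (z i) * parab (z j) * H i j ^+ 2)))).
  by apply: ler_sum => i _; apply: ler_sum => j _; apply: pt.
rewrite (dsum_linear (lam * S / 2) (15 / lam) W
  (fun i j => parab (z i) * parab (z j) * H i j ^+ 2)); apply: lerD.
  have -> : \sum_(i < 2 ^ M) \sum_(j < 2 ^ M) W i j =
      (\sum_(i < 2 ^ M) dens mu3 M n3 i) * (\sum_(j < 2 ^ M) dens mu4 M n4 j).
    by rewrite big_distrlr.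
  have -> : lam * S / 2 = 2 * (om * q ^+ 2) ^+ n.
    have E : (om * q ^+ 2) ^+ n = (2 * q) ^+ (2 * n) * mu.
      rewrite exprM -exprMn; congr (_ ^+ _); have -> : 2 * q = om ^+ 2 * q by rewrite om2.
      by field; rewrite gt_eqF.
    by rewrite E /lam /S; field; rewrite gt_eqF.
  rewrite -[leRHS]mulr1 ler_wpM2l.
    by [].
    by rewrite mulr_ge0// exprn_ge0// mulr_ge0 ?exprn_ge0 ?(ltW q0) ?(ltW om0).
  rewrite mulr_ile1 ?(dens_mass fr3 NM) ?(dens_mass fr4 NM)//.
    by apply: sumr_ge0 => i _; apply: dens_ge0 fr3 _ _.
  by apply: sumr_ge0 => i _; apply: dens_ge0 fr4 _ _.
have ek : 2^-1 ^+ k * q ^+ (2 * k) <= 2^-1 ^+ n * q ^+ (2 * n).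
  rewrite !exprM -!exprMn ler_wiXn2l//.
    by rewrite mulr_ge0 ?invr_ge0 ?exprn_ge0 ?(ltW q0).
  by move: q_lt q0; nra.
have EC0 : 0 <= EC.
  apply: mulr_ge0.
    by rewrite mulr_ge0// mulr_ge0// exprn_ge0// mulr_ge0// sqr_ge0.
  have q4 : 1 < 4 * q ^+ 2 by move: q_gt; nra.
  by rewrite invr_ge0 subr_ge0 invf_le1 ?(ltW q4)// (lt_trans _ q4).
have -> : 15 * EC * (om * q ^+ 2) ^+ n = 15 / lam / d ^+ 2 * (EC * (2^-1 ^+ n * q ^+ (2 * n))).
  have E : (om * q ^+ 2) ^+ n = 2^-1 ^+ n * q ^+ (2 * n) / mu.
    rewrite exprM -exprMn /mu exprVn invrK -exprMn; congr (_ ^+ _).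
    by rewrite [om ^+ 3]exprS om2; field.
  by rewrite E /lam; field; rewrite !gt_eqF.
have c15 : 0 <= 15 / lam / d ^+ 2.
  by rewrite divr_ge0 ?sqr_ge0// divr_ge0// ltW.
apply: le_trans (ler_wpM2l c15 (ler_wpM2l EC0 ek)).
apply: le_trans (ler_wpM2l c15 en).
rewrite le_eqVlt; apply/orP; left; apply/eqP.
have dn : d ^+ 2 != 0 by rewrite expf_neq0// gt_eqF.
by rewrite [RHS]mulrA divfK.
Qed.

Variables (f f1 f2 Phi phi phi1 : R -> R).
Hypotheses (pr_phi : profile_ok B Phi phi phi1) (pr_f : profile_ok B f f1 f2)
  (phiE : forall u, phi u = f u - 2 * f (2 * u)).

Let one (_ _ _ _ : R) : R := 1.
(** [m3] and [m4] are the partial derivatives of the phase in [x] and in [y]. *)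
Let m3 (u v x y : R) : R := c0 * y + c1 u v.
Let m4 (u v x y : R) : R := c0 * x + c2 u v.
Let fld m g k x y := local_sum c0 c1 c2 c3 m g k mu1 mu2 N x y.

Let B1 : 1 <= B. Proof. exact: ph_B ph. Qed.
Let B0 : 0 <= B. Proof. exact: le_trans B1. Qed.

Lemma one_ok : amplitude_ok B one.
Proof. by split=> *; rewrite /one ?normr1// subrr normr0 mulr_ge0. Qed.

Lemma m3_ok : amplitude_ok B m3.
Proof.
split=> u v x; rewrite /m3.
- by move=> y hu hv hx hy; have /andP[] := ph_c1 ph hu hv hy.
- by move=> x' y *; rewrite subrr normr0 mulr_ge0.
- move=> y y' *; have -> : c0 * y + c1 u v - (c0 * y' + c1 u v) = c0 * (y - y') by ring.
  by rewrite normrM ler_wpM2r// (ph_c0 ph).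
Qed.

Lemma m4_ok : amplitude_ok B m4.
Proof.
split=> u v x; rewrite /m4.
- by move=> y hu hv hx hy; have /andP[] := ph_c2 ph hu hv hx.
- move=> x' y *; have -> : c0 * x + c2 u v - (c0 * x' + c2 u v) = c0 * (x - x') by ring.
  by rewrite normrM ler_wpM2r// (ph_c0 ph).
- by move=> y y' *; rewrite subrr normr0 mulr_ge0.
Qed.

(** A grid step moves the argument of the profile by [h * m], so to first order the field of [f]
    changes by the field of its derivative [f1] with amplitude [m]. *)
Lemma field_step m k x y x' y' h : 0 <= h ->
  (forall u v, unit_itv u -> unit_itv v -> `|m u v x y| <= B /\
    bilin c0 (c1 u v) (c2 u v) (c3 u v) x' y' / (2^-1 ^+ k) =
    bilin c0 (c1 u v) (c2 u v) (c3 u v) x y / (2^-1 ^+ k) + h * m u v x y) ->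
  `|fld one f k x' y' - fld one f k x y - h * fld m f1 k x y| <= B ^+ 3 * h ^+ 2.
Proof.
move=> h0 Hm; rewrite /fld /local_sum.
pose w i j := mu1 N i * mu2 N j.
have w0 i j : 0 <= w i j by rewrite mulr_ge0 ?(fr_ge0 fr1) ?(fr_ge0 fr2).
rewrite mulr_sumr -!sumrB (le_trans (ler_norm_sum _ _ _))//.
have -> : B ^+ 3 * h ^+ 2 = 1 * (B ^+ 3 * h ^+ 2) by rewrite mul1r.
have wm : \sum_(i < 2 ^ N) \sum_(j < 2 ^ N) w i j <= 1.
  have -> : \sum_(i < 2 ^ N) \sum_(j < 2 ^ N) w i j = mu1 0 0 * mu2 0 0.
    by rewrite -(fr_mass fr1 (leqnn N)) -(fr_mass fr2 (leqnn N)) big_distrlr.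
  by rewrite mulr_ile1 ?(fr_ge0 fr1) ?(fr_ge0 fr2) ?(fr_le fr1 0 (leq0n _)) ?(fr_le fr2 0 (leq0n _)).
have c0' : 0 <= B ^+ 3 * h ^+ 2 by rewrite mulr_ge0 ?exprn_ge0.
apply: le_trans (ler_wpM2r c0' wm).
rewrite mulr_suml; apply: ler_sum => i _.
rewrite mulr_sumr -!sumrB (le_trans (ler_norm_sum _ _ _))// mulr_suml; apply: ler_sum => j _.
have [mB ->] := Hm _ _ (dyadic_unit R (ltn_ord i)) (dyadic_unit R (ltn_ord j)).
rewrite -/(w i j) /one.
set P := _ / _; set a := m _ _ _ _ in mB *.
have -> : w i j * (1 * f (P + h * a)) - w i j * (1 * f P) - h * (w i j * (a * f1 P)) =
  w i j * (f (P + h * a) - f P - h * a * f1 P) by ring.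
rewrite normrM ger0_norm// ler_wpM2l// (le_trans (pr_fg pr_f _ _))//.
rewrite [B ^+ 3]exprS -[leRHS]mulrA ler_wpM2l// exprMn mulrC ler_wpM2r ?exprn_ge0//.
by rewrite -(real_normK (num_real a)) lerXn2r ?nnegrE.
Qed.

Definition pairing n : R := \sum_(i < 2 ^ M) \sum_(j < 2 ^ M)
  dens mu3 M n i * dens mu4 M n j * (2 ^+ n * fld one f n (z i) (z j)).

Let C1 := 2 + 15 * EC.
(** With [q = 2^-s] this is 2^{3/2-2s}. *)
Let th := 2 * (om * q ^+ 2).

Let zS i : z i.+1 = z i + d.
Proof. by rewrite /z /dyadic -natr1 mulrDl mul1r. Qed.

Let M0 n : (n <= N)%N -> (2 ^ (M - n))%:R * d = 2^-1 ^+ n.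
Proof.
move=> nN; have nM := leq_trans nN NM.
have -> : d = 2^-1 ^+ (M - n) * 2^-1 ^+ n by rewrite -exprD subnK.
by rewrite mulrA two_pow_inv mul1r.
Qed.

Lemma osc_bound m n x y x' y' : (n.+1 <= N)%N ->
  (forall u v, unit_itv u -> unit_itv v -> `|m u v x y| <= B /\
    bilin c0 (c1 u v) (c2 u v) (c3 u v) x' y' =
    bilin c0 (c1 u v) (c2 u v) (c3 u v) x y + d * m u v x y) ->
  2 * (2 ^ (M - n))%:R * `|2 ^+ n.+1 * fld one f n.+1 x' y' - 2 ^+ n.+1 * fld one f n.+1 x y|
  <= 8 * 2 ^+ n * `|fld m f1 n.+1 x y| + 16 * B ^+ 3 * (4 ^+ n * d).
Proof.
move=> nN Hm; pose h := 2 ^+ n.+1 * d.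
have e2 : (2^-1 ^+ n.+1)^-1 = 2 ^+ n.+1 :> R by rewrite exprVn invrK.
have h0 : 0 <= h by apply: mulr_ge0 (ltW d0); exact: exprn_ge0.
have H : `|fld one f n.+1 x' y' - fld one f n.+1 x y - h * fld m f1 n.+1 x y| <= B ^+ 3 * h ^+ 2.
  apply: field_step => // u v hu hv; have [mB ->] := Hm u v hu hv.
  by split=> //; rewrite e2 /h; ring.
rewrite -mulrBr normrM ger0_norm ?exprn_ge0//.
set D := fld one f n.+1 x' y' - _ in H *.
have HD : `|D| <= h * `|fld m f1 n.+1 x y| + B ^+ 3 * h ^+ 2.
  have -> : D = (D - h * fld m f1 n.+1 x y) + h * fld m f1 n.+1 x y by ring.
  by rewrite [leRHS]addrC (le_trans (ler_normD _ _))// lerD// normrM ger0_norm.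
have M1 := M0 (ltnW nN).
have c0' : 0 <= 2 * (2 ^ (M - n))%:R * 2 ^+ n.+1 :> R by rewrite !mulr_ge0 ?exprn_ge0.
rewrite [leLHS]mulrA; apply: (le_trans (ler_wpM2l c0' HD)).
rewrite le_eqVlt; apply/orP; left; apply/eqP; rewrite /h.
have -> : 2 * (2 ^ (M - n))%:R * 2 ^+ n.+1 *
    (2 ^+ n.+1 * d * `|fld m f1 n.+1 x y| + B ^+ 3 * (2 ^+ n.+1 * d) ^+ 2)
  = ((2 ^ (M - n))%:R * d) * (2 * 2 ^+ n.+1 *
    (2 ^+ n.+1 * `|fld m f1 n.+1 x y| + B ^+ 3 * (2 ^+ n.+1) ^+ 2 * d)) by ring.
rewrite M1 exprVn; have -> : 4 ^+ n = 2 ^+ n * 2 ^+ n :> R.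
  by rewrite -exprMn; congr (_ ^+ _); ring.
rewrite [2 ^+ n.+1]exprS; have X0 : 2 ^+ n != 0 :> R by rewrite expf_neq0// pnatr_eq0.
by move: (2 ^+ n) X0 => X X0; field.
Qed.

Let EC0 : 0 <= EC.
Proof.
apply: mulr_ge0.
  by rewrite mulr_ge0// mulr_ge0// exprn_ge0// mulr_ge0// sqr_ge0.
have q4 : 1 < 4 * q ^+ 2 by move: q_gt; nra.
by rewrite invr_ge0 subr_ge0 invf_le1 ?(ltW q4)// (lt_trans _ q4).
Qed.

Let err_small n : (n < N)%N -> 4 ^+ n * d <= th ^+ n.
Proof.
move=> nN; have om1 : 1 <= om by move: om0 om2; nra.
have t2 : 2^-1 <= th by rewrite /th; move: q_gt om1; nra.
apply: (@le_trans _ _ (2^-1 ^+ n)); last by rewrite lerXn2r ?nnegrE//; lra.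
apply: (@le_trans _ _ (4 ^+ n * (2^-1 ^+ n) ^+ 5)).
  by rewrite ler_wpM2l ?exprn_ge0// mesh// ltnW.
rewrite -exprM mulnC exprM -exprMn lerXn2r ?nnegrE ?mulr_ge0 ?exprn_ge0 ?invr_ge0//.
by lra.
Qed.

Let thE n : 2 ^+ n * (C1 * (om * q ^+ 2) ^+ n) = C1 * th ^+ n.
Proof. by rewrite /th [in RHS]exprMn mulrCA. Qed.

Lemma osc_sum m g n n3 (W3 := dens mu3 M n3) (W4 := dens mu4 M n) :
  amplitude_ok B m -> (2 <= n)%N -> (n.+1 <= N)%N -> (n <= n3 <= n.+1)%N ->
  (forall i j, (i < 2 ^ M)%N -> (j < 2 ^ M)%N ->
     g i j <= 8 * 2 ^+ n * `|fld m f1 n.+1 (z i) (z j)| + 16 * B ^+ 3 * (4 ^+ n * d)) ->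
  \sum_(i < 2 ^ M) \sum_(j < 2 ^ M) W3 i * W4 j * g i j <= (8 * C1 + 16 * B ^+ 3) * th ^+ n.
Proof.
move=> am n2 nN /andP[nn3 n3n] Hg.
have W30 i : 0 <= W3 i by apply: dens_ge0 fr3 _ _.
have W40 i : 0 <= W4 i by apply: dens_ge0 fr4 _ _.
have n3N : (n3 <= N)%N by apply: leq_trans n3n nN.
have n32 : (2 <= n3 <= N)%N by rewrite (leq_trans n2 nn3).
have n42 : (2 <= n <= N)%N by rewrite n2 ltnW.
apply: (@le_trans _ _ (\sum_(i < 2 ^ M) \sum_(j < 2 ^ M)
   (8 * 2 ^+ n * (W3 i * W4 j * `|fld m f1 n.+1 (z i) (z j)|)
    + 16 * B ^+ 3 * (4 ^+ n * d) * (W3 i * W4 j)))).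
  apply: ler_sum => i _; apply: ler_sum => j _.
  apply: le_trans (ler_wpM2l (mulr_ge0 (W30 i) (W40 j)) (Hg _ _ (ltn_ord i) (ltn_ord j))) _.
  by rewrite le_eqVlt; apply/orP; left; apply/eqP; ring.
rewrite (dsum_linear _ _ (fun i j => W3 i * W4 j * `|fld m f1 n.+1 (z i) (z j)|) (fun i j => W3 i * W4 j)).
rewrite [leRHS]mulrDl; apply: lerD.
  have -> : 8 * C1 * th ^+ n = 8 * (2 ^+ n * (C1 * (om * q ^+ 2) ^+ n)) by rewrite thE mulrA.
  rewrite -[leLHS]mulrA ler_wpM2l// ler_wpM2l ?exprn_ge0//.
  by apply: (weighted_l1 am pr_f n32 n42 n3n (leqnSn n)); rewrite leqnSn nN.
have B3 : 0 <= 16 * B ^+ 3 by rewrite mulr_ge0// exprn_ge0.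
have E0 : 0 <= 4 ^+ n * d by apply: mulr_ge0 (ltW d0); exact: exprn_ge0.
rewrite -[leLHS]mulrA ler_wpM2l//; apply: le_trans (err_small nN).
rewrite ler_piMr//.
have -> : \sum_(i < 2 ^ M) \sum_(j < 2 ^ M) W3 i * W4 j =
      (\sum_(i < 2 ^ M) W3 i) * (\sum_(j < 2 ^ M) W4 j) by rewrite big_distrlr.
rewrite mulr_ile1 ?(dens_mass fr3 NM) ?(dens_mass fr4 NM) ?(ltnW nN)//.
  by apply: sumr_ge0 => i _.
by apply: sumr_ge0 => i _.
Qed.

Lemma fld_diff n x y :
  2 ^+ n * fld one f n x y - 2 ^+ n.+1 * fld one f n.+1 x y = 2 ^+ n * fld one phi n x y.
Proof.
rewrite /fld /local_sum !mulr_sumr -sumrB; apply: eq_bigr => i _.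
rewrite !mulr_sumr -sumrB; apply: eq_bigr => j _.
rewrite phiE; set P := bilin _ _ _ _ _ _.
have -> : P / 2^-1 ^+ n.+1 = 2 * (P / 2^-1 ^+ n) by rewrite !exprVn !invrK exprS; ring.
by rewrite [2 ^+ n.+1]exprS; ring.
Qed.

(** Three changes are made in turn: the profile ([T1]), the density of [mu3] ([T2]), the density of
    [mu4] ([T3]). The first produces [phi]. By [dens_step] each of the others produces a grid
    derivative of the field at scale [n.+1], that is the profile [f1] with amplitude [m3] or
    [m4]. *)
Lemma pairing_step n : (2 <= n)%N -> (n < N)%N ->
  `|pairing n - pairing n.+1| <= (17 * C1 + 32 * B ^+ 3) * th ^+ n.
Proof.
move=> n2 nN; pose W3 := dens mu3 M n; pose W4 := dens mu4 M n.
pose V3 := dens mu3 M n.+1; pose V4 := dens mu4 M n.+1.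
pose A i j := 2 ^+ n.+1 * fld one f n.+1 (z i) (z j).
have W30 i : 0 <= W3 i by apply: dens_ge0 fr3 _ _.
have W40 i : 0 <= W4 i by apply: dens_ge0 fr4 _ _.
have V30 i : 0 <= V3 i by apply: dens_ge0 fr3 _ _.
pose T1 := \sum_(i < 2 ^ M) \sum_(j < 2 ^ M) W3 i * W4 j * (2 ^+ n * fld one phi n (z i) (z j)).
pose T2 := \sum_(j < 2 ^ M) W4 j * \sum_(i < 2 ^ M) (W3 i - V3 i) * A i j.
pose T3 := \sum_(i < 2 ^ M) V3 i * \sum_(j < 2 ^ M) (W4 j - V4 j) * A i j.
have -> : pairing n - pairing n.+1 = T1 + T2 + T3.
  have -> : T2 = \sum_(i < 2 ^ M) \sum_(j < 2 ^ M) W4 j * ((W3 i - V3 i) * A i j).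
    by rewrite /T2; under eq_bigr do rewrite mulr_sumr; rewrite exchange_big.
  rewrite /pairing /T1 /T3 -sumrB -!big_split; apply: eq_bigr => i _ /=.
  rewrite mulr_sumr -sumrB -!big_split; apply: eq_bigr => j _ /=.
  rewrite -fld_diff -/(W3 i) -/(W4 j) -/(V3 i) -/(V4 j) -/(A i j); ring.
have ni : (2 <= n <= N)%N by rewrite n2 ltnW.
have H1 : `|T1| <= C1 * th ^+ n.
  rewrite -thE (le_trans (ler_norm_sum _ _ _))//.
  apply: (@le_trans _ _ (2 ^+ n * \sum_(i < 2 ^ M) \sum_(j < 2 ^ M) W3 i * W4 j * `|fld one phi n (z i) (z j)|)).
    rewrite mulr_sumr; apply: ler_sum => i _; rewrite (le_trans (ler_norm_sum _ _ _))//.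
    rewrite mulr_sumr; apply: ler_sum => j _.
    rewrite normrM (ger0_norm (mulr_ge0 (W30 i) (W40 j))) normrM.
    by rewrite (ger0_norm (x := 2 ^+ n)) ?exprn_ge0// mulrCA.
  rewrite ler_wpM2l ?exprn_ge0//.
  by apply: (weighted_l1 one_ok pr_phi ni ni (leqnSn n) (leqnSn n)); rewrite leqnn ltnW.
have lip3 i j : (i < 2 ^ M)%N -> (j < 2 ^ M)%N -> 2 * (2 ^ (M - n))%:R * `|A i.+1 j - A i j|
    <= 8 * 2 ^+ n * `|fld m3 f1 n.+1 (z i) (z j)| + 16 * B ^+ 3 * (4 ^+ n * d).
  move=> iM jM; apply: osc_bound => // u v hu hv; split.
    by apply: (am_B m3_ok) => //; exact: dyadic_unit.
  by rewrite zS /bilin /m3; ring.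
have lip4 i j : (i < 2 ^ M)%N -> (j < 2 ^ M)%N -> 2 * (2 ^ (M - n))%:R * `|A i j.+1 - A i j|
    <= 8 * 2 ^+ n * `|fld m4 f1 n.+1 (z i) (z j)| + 16 * B ^+ 3 * (4 ^+ n * d).
  move=> iM jM; apply: osc_bound => // u v hu hv; split.
    by apply: (am_B m4_ok) => //; exact: dyadic_unit.
  by rewrite zS /bilin /m4; ring.
have H2 : `|T2| <= (8 * C1 + 16 * B ^+ 3) * th ^+ n.
  have nn : (n <= n <= n.+1)%N by rewrite leqnn leqnSn.
  apply: le_trans (osc_sum m3_ok n2 nN nn lip3).
  rewrite exchange_big (le_trans (ler_norm_sum _ _ _))//; apply: ler_sum => j _ /=.
  rewrite normrM (ger0_norm (W40 j)).
  apply: le_trans (ler_wpM2l (W40 j) (dens_step fr3 NM (fun i => A i j) nN)) _.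
  rewrite !mulr_sumr; apply: ler_sum => i _.
  by rewrite le_eqVlt; apply/orP; left; apply/eqP; rewrite -/(W3 i) -/(W4 j); ring.
have H3 : `|T3| <= (8 * C1 + 16 * B ^+ 3) * th ^+ n.
  have nn : (n <= n.+1 <= n.+1)%N by rewrite leqnn leqnSn.
  apply: le_trans (osc_sum m4_ok n2 nN nn lip4).
  rewrite (le_trans (ler_norm_sum _ _ _))//; apply: ler_sum => i _ /=.
  rewrite normrM (ger0_norm (V30 i)).
  apply: le_trans (ler_wpM2l (V30 i) (dens_step fr4 NM (fun j => A i j) nN)) _.
  rewrite !mulr_sumr; apply: ler_sum => j _.
  by rewrite le_eqVlt; apply/orP; left; apply/eqP; rewrite -/(V3 i) -/(W4 j); ring.
have -> : (17 * C1 + 32 * B ^+ 3) * th ^+ n = C1 * th ^+ n + (8 * C1 + 16 * B ^+ 3) * th ^+ n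
  + (8 * C1 + 16 * B ^+ 3) * th ^+ n by ring.
rewrite (le_trans (ler_normD _ _))// lerD//.
by rewrite (le_trans (ler_normD _ _))// lerD.
Qed.

End Counting.

(** * Lower bound and continuity in the parameter *)

Section PairingSum.
Variables (R : realFieldType) (q : R) (N : nat) (mu1 mu2 mu3 mu4 : nat -> nat -> R).
Hypotheses (q0 : 0 <= q) (q1 : q <= 1).
Hypotheses (fr1 : frostman q N mu1) (fr2 : frostman q N mu2)
  (fr3 : frostman q N mu3) (fr4 : frostman q N mu4).
Let M := (5 * N)%N.
Let NM : (N <= M)%N. Proof. by rewrite leq_pmull. Qed.

Let Y : finType := ('I_(2 ^ M) * 'I_(2 ^ M) * ('I_(2 ^ N) * 'I_(2 ^ N)))%type.

Let weight n (p : Y) : R :=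
  dens mu3 M n p.1.1 * dens mu4 M n p.1.2 * (mu1 N p.2.1 * mu2 N p.2.2).

Let phase (c0 : R) (c1 c2 c3 : R -> R -> R) (p : Y) : R :=
  let u := dyadic R N p.2.1 in let v := dyadic R N p.2.2 in
  bilin c0 (c1 u v) (c2 u v) (c3 u v) (dyadic R M p.1.1) (dyadic R M p.1.2).

Lemma pairingE c0 c1 c2 c3 f n : pairing c0 c1 c2 c3 N mu1 mu2 mu3 mu4 f n =
  \sum_(p : Y) weight n p * (2 ^+ n * f (phase c0 c1 c2 c3 p * 2 ^+ n)).
Proof.
rewrite /pairing pair_bigA /= -(pair_bigA _ (fun z x => weight n (z, x) *
  (2 ^+ n * f (phase c0 c1 c2 c3 (z, x) * 2 ^+ n)))) /=.
apply: eq_bigr => z _; rewrite /local_sum pair_bigA /= !mulr_sumr; apply: eq_bigr => x _.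
by rewrite /weight /phase /= exprVn invrK; ring.
Qed.

Lemma weight_ge0 n p : 0 <= weight n p.
Proof.
apply: mulr_ge0; apply: mulr_ge0; [exact: dens_ge0 fr3 _ _|exact: dens_ge0 fr4 _ _|
  exact: fr_ge0 fr1 _ _|exact: fr_ge0 fr2 _ _].
Qed.

Lemma weight_mass n : (n <= N)%N ->
  \sum_(p : Y) weight n p = mu3 0 0 * mu4 0 0 * (mu1 0 0 * mu2 0 0).
Proof.
move=> nN; rewrite -(pair_bigA _ (fun z x => weight n (z, x))) /=.
transitivity ((\sum_(z : 'I_(2 ^ M) * 'I_(2 ^ M)) dens mu3 M n z.1 * dens mu4 M n z.2) *
    (\sum_(x : 'I_(2 ^ N) * 'I_(2 ^ N)) mu1 N x.1 * mu2 N x.2)).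
  by rewrite big_distrlr.
rewrite -(pair_bigA _ (fun i j : 'I_(2 ^ M) => dens mu3 M n i * dens mu4 M n j)) /=.
rewrite -(pair_bigA _ (fun i j : 'I_(2 ^ N) => mu1 N i * mu2 N j)) /=.
rewrite -!big_distrlr /= (dens_total fr3 NM nN) (dens_total fr4 NM nN).
by rewrite (fr_mass fr1 (leqnn N)) (fr_mass fr2 (leqnn N)).
Qed.

Lemma weight_le1 n : (n <= N)%N -> \sum_(p : Y) weight n p <= 1.
Proof.
move=> nN; rewrite weight_mass//.
have le1 mu : frostman q N mu -> mu 0 0 <= 1 by move=> fr; rewrite (fr_le fr 0 (leq0n _)).
by rewrite !mulr_ile1 ?mulr_ge0 ?(fr_ge0 fr1) ?(fr_ge0 fr2) ?(fr_ge0 fr3) ?(fr_ge0 fr4) ?le1.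
Qed.

Lemma pairing_hit c0 c1 c2 c3 f : unit_supp f ->
  pairing c0 c1 c2 c3 N mu1 mu2 mu3 mu4 f N != 0 ->
  exists i j k l, [/\ mu1 N i != 0, mu2 N j != 0, mu3 N (k %/ 2 ^ (M - N))%N != 0,
    mu4 N (l %/ 2 ^ (M - N))%N != 0 &
    [/\ (i < 2 ^ N)%N, (j < 2 ^ N)%N, (k < 2 ^ M)%N, (l < 2 ^ M)%N &
    `|bilin c0 (c1 (dyadic R N i) (dyadic R N j)) (c2 (dyadic R N i) (dyadic R N j))
       (c3 (dyadic R N i) (dyadic R N j)) (dyadic R M k) (dyadic R M l)| <= 2^-1 ^+ N]].
Proof.
move=> fs; rewrite pairingE => nz.
have [p pn] : exists p : Y, weight N p * (2 ^+ N * f (phase c0 c1 c2 c3 p * 2 ^+ N)) != 0.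
  apply/existsP; apply: contraNT nz => /existsPn H; apply/eqP/big1 => p _.
  by apply/eqP; have := H p; rewrite negbK.
move: pn; rewrite !mulf_eq0 !negb_or => /andP[/andP[/andP[/andP[a _] /andP[b _]] /andP[c e]] /andP[_ g]].
exists p.2.1, p.2.2, p.1.1, p.1.2; split => //; split; rewrite ?ltn_ord//.
rewrite -/(phase c0 c1 c2 c3 p) leNgt; apply: contra g => big.
rewrite fs// normrM (ger0_norm (x := 2 ^+ N)) ?exprn_ge0//.
have two : 2^-1 ^+ N * 2 ^+ N = 1 :> R by rewrite -exprMn mulVf ?expr1n// pnatr_eq0.
by rewrite -[leLHS]two ler_wpM2r ?exprn_ge0// ltW.
Qed.

Lemma phase_unit (Q : R -> R -> R -> R -> Prop) :
  (forall u v x y, unit_itv u -> unit_itv v -> unit_itv x -> unit_itv y -> Q u v x y) ->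
  forall p : Y, Q (dyadic R N p.2.1) (dyadic R N p.2.2) (dyadic R M p.1.1) (dyadic R M p.1.2).
Proof. by move=> H p; apply: H; apply: dyadic_unit. Qed.

Lemma pairing_lip (B D : R) c0 c1 c2 c3 c0' c1' c2' c3' f f1 n : (n <= N)%N -> 1 <= B ->
  taylor1 B f f1 -> bounded_by B f1 -> 0 <= D -> 2 ^+ n * D <= 1 ->
  (forall u v x y, unit_itv u -> unit_itv v -> unit_itv x -> unit_itv y ->
    `|bilin c0' (c1' u v) (c2' u v) (c3' u v) x y - bilin c0 (c1 u v) (c2 u v) (c3 u v) x y| <= D) ->
  `|pairing c0' c1' c2' c3' N mu1 mu2 mu3 mu4 f n - pairing c0 c1 c2 c3 N mu1 mu2 mu3 mu4 f n|
  <= 2 * B * 4 ^+ n * D.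
Proof.
move=> nN B1 ff1 f1B D0 D1 HD; have B0 : 0 <= B by apply: le_trans B1.
have tn : 0 <= 2 ^+ n :> R by rewrite exprn_ge0.
have c4 : 0 <= 2 * B * 4 ^+ n * D.
  by apply: mulr_ge0 => //; apply: mulr_ge0; [exact: mulr_ge0|exact: exprn_ge0].
rewrite !pairingE -sumrB (le_trans (ler_norm_sum _ _ _))//.
rewrite -[leRHS]mul1r; apply: le_trans (ler_wpM2r c4 (weight_le1 nN)).
rewrite mulr_suml; apply: ler_sum => p _.
rewrite -mulrBr normrM ger0_norm ?weight_ge0// ler_wpM2l ?weight_ge0//.
have /= := phase_unit HD p; rewrite -/(phase c0 c1 c2 c3 p) -/(phase c0' c1' c2' c3' p).
move: (phase _ _ _ _ p) (phase _ _ _ _ p) => b a ab.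
rewrite -mulrBr normrM (ger0_norm tn).
set h := (a - b) * 2 ^+ n; have -> : a * 2 ^+ n = b * 2 ^+ n + h by rewrite /h; ring.
have hD : `|h| <= 2 ^+ n * D by rewrite normrM (ger0_norm tn) mulrC ler_wpM2l.
have h1 : `|h| <= 1 by apply: le_trans hD D1.
set u := b * _; have -> : f (u + h) - f u = (f (u + h) - f u - h * f1 u) + h * f1 u by ring.
have E1 := ff1 u h; have E2 : `|h * f1 u| <= B * `|h| by rewrite normrM mulrC ler_wpM2r.
have E3 : B * h ^+ 2 <= B * `|h|.
  by rewrite ler_wpM2l// -(real_normK (num_real h)) expr2 ler_piMl.
have E4 : B * `|h| <= B * (2 ^+ n * D) by rewrite ler_wpM2l.
have -> : 2 * B * 4 ^+ n * D = 2 ^+ n * (2 * (B * (2 ^+ n * D))).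
  have -> : 4 ^+ n = 2 ^+ n * 2 ^+ n :> R by rewrite -exprMn; congr (_ ^+ _); ring.
  by ring.
rewrite ler_wpM2l// (le_trans (ler_normD _ _))//; lra.
Qed.

Lemma locate_unit (K : nat) (w : R) : (0 < K)%N -> 0 <= w <= K%:R ->
  exists2 k, (k < K)%N & k%:R <= w <= k%:R + 1.
Proof.
elim: K => // K IH _ /andP[w0 wK].
have [KE|K0] := posnP K.
  by exists 0%N; [rewrite KE | rewrite w0 add0r (le_trans wK)// KE].
have [le|lt] := leP w K%:R.
  have [|k kK kw] := IH K0; first by rewrite w0.
  by exists k => //; exact: leqW.
by exists K => //; rewrite (ltW lt) natr1.
Qed.

(** A first moment in the parameter: sum the pairings over [K * 2 ^ n] equally spaced values of [t].
    Every quadruple contributes to this sum, because its root [s] is within [tau / (K * 2 ^ n)] of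
    one of the values, and there the rescaled phase is at most 1/2. Some value does at least as well
    as the mean. *)
Lemma pairing_lower (B T tau m : R) (K : nat) (c0 : R -> R) (c1 c2 c3 : R -> R -> R -> R) f n :
  (n <= N)%N -> 0 < tau -> (0 < K)%N -> 2 * B * tau <= K%:R -> 0 < m -> 1 <= B ->
  m <= mu1 0 0 -> m <= mu2 0 0 -> m <= mu3 0 0 -> m <= mu4 0 0 ->
  (forall u, 0 <= f u) -> (forall u, `|u| <= 2^-1 -> 4^-1 <= f u) ->
  (forall u v x y, unit_itv u -> unit_itv v -> unit_itv x -> unit_itv y ->
    exists2 s, `|s - T| <= tau / 2 & forall t,
     `|bilin (c0 t) (c1 t u v) (c2 t u v) (c3 t u v) x y| <= B * `|t - s|) ->
  exists2 k, (k < K * 2 ^ n)%N & let t := T - tau / 2 + tau * (k%:R / (K * 2 ^ n)%:R) in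
   m ^+ 4 / (4 * K%:R) <= pairing (c0 t) (c1 t) (c2 t) (c3 t) N mu1 mu2 mu3 mu4 f n.
Proof.
move=> nN tau0 K0 BK m0 B1 m1 m2 m3 m4 f0 f4 Hs; have B0 : 0 < B by apply: lt_le_trans B1.
set KK := (K * 2 ^ n)%N; have KK0 : (0 < KK)%N by rewrite muln_gt0 K0 expn_gt0.
have KKr : 0 < KK%:R :> R by rewrite ltr0n.
pose t (k : nat) := T - tau / 2 + tau * (k%:R / KK%:R).
pose pr k := pairing (c0 (t k)) (c1 (t k)) (c2 (t k)) (c3 (t k)) N mu1 mu2 mu3 mu4 f n.
have tn : 0 < 2 ^+ n :> R by rewrite exprn_gt0.
have total : 2 ^+ n * 4^-1 * m ^+ 4 <= \sum_(k < KK) pr k.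
  rewrite /pr; under eq_bigr do rewrite pairingE.
  rewrite exchange_big /=.
  apply: (@le_trans _ _ (\sum_(p : Y) weight n p * (2 ^+ n * 4^-1))).
    rewrite -mulr_suml mulrC ler_wpM2r ?mulr_ge0 ?invr_ge0 ?(ltW tn)// weight_mass//.
    have -> : m ^+ 4 = m * m * (m * m) by ring.
    by rewrite !ler_pM ?mulr_ge0 ?(ltW m0).
  apply: ler_sum => p _; rewrite -mulr_sumr ler_wpM2l ?weight_ge0//.
  have [s sT Hp] := phase_unit Hs p.
  have := @locate_unit KK ((s - T + tau / 2) / tau * KK%:R) KK0; case.
    move: sT; rewrite ler_norml => /andP[s1 s2]; apply/andP; split.
      by rewrite mulr_ge0 ?divr_ge0 ?(ltW tau0) ?(ltW KKr)//; lra.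
    by rewrite ler_piMl ?(ltW KKr)// ler_pdivrMr//; lra.
  move=> k kK /andP[k1 k2].
  have tks : `|t k - s| <= tau / KK%:R.
    set w := (s - T + tau / 2) / tau * KK%:R in k1 k2.
    have -> : t k - s = tau / KK%:R * (k%:R - w) by rewrite /t /w; field; rewrite !gt_eqF.
    rewrite normrM ger0_norm ?divr_ge0 ?(ltW tau0) ?(ltW KKr)//.
    rewrite ler_piMr ?divr_ge0 ?(ltW tau0) ?(ltW KKr)//.
    by rewrite ler_norml; apply/andP; split; lra.
  rewrite (bigD1 (Ordinal kK))//= ler_wpDr//.
    by apply: sumr_ge0 => k' _; rewrite mulr_ge0// ltW.
  rewrite ler_wpM2l ?(ltW tn)// f4//.
  have /= := Hp (t k); rewrite -/(phase _ _ _ _ p) => H.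
  rewrite normrM (gtr0_norm tn).
  apply: le_trans (ler_wpM2r (ltW tn) (le_trans H (ler_wpM2l (ltW B0) tks))) _.
  rewrite /KK natrM natrX.
  have Kr : 0 < K%:R :> R by rewrite ltr0n.
  have -> : B * (tau / (K%:R * 2 ^+ n)) * 2 ^+ n = B * tau / K%:R by field; rewrite !gt_eqF.
  by rewrite ler_pdivrMr//; lra.
have [k _ Hk] : exists2 k : 'I_KK, true & m ^+ 4 / (4 * K%:R) <= pr k.
  apply/exists_inP; rewrite -[X in is_true X]negbK; apply/negP => /exists_inPn none.
  have : \sum_(k < KK) pr k < \sum_(k < KK) m ^+ 4 / (4 * K%:R).
    apply: ltr_sum => [|k _]; last by rewrite ltNge; exact: none.
    by apply/hasP; exists (Ordinal KK0); rewrite ?mem_index_enum.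
  rewrite sumr_const card_ord -[X in _ < X]mulr_natl => lt.
  have := le_lt_trans total lt; rewrite /KK natrM natrX.
  have Kr : K%:R != 0 :> R by rewrite pnatr_eq0 -lt0n.
  have -> : K%:R * 2 ^+ n * (m ^+ 4 / (4 * K%:R)) = 2 ^+ n * 4^-1 * m ^+ 4 by field.
  by rewrite ltxx.
by exists k.
Qed.

End PairingSum.

(** * The geometry of the cross ratio *)

Section CrossForm.
Variable R : realFieldType.
Implicit Types (t x y z : R).

Definition cross_form t x1 x2 x3 x4 := (x3 - x1) * (x4 - x2) - t * ((x3 - x2) * (x4 - x1)).
Definition dx1 t x1 x2 x3 x4 := t * (x3 - x2) - (x4 - x2).
Definition dx2 t x1 x2 x3 x4 := t * (x4 - x1) - (x3 - x1).
Definition dx3 t x1 x2 x3 x4 := (x4 - x2) - t * (x4 - x1).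
Definition dx4 t x1 x2 x3 x4 := (x3 - x1) - t * (x3 - x2).
(** The determinant of two linear forms in the displacement [(y1 - x1, y2 - x2)]: the differential
    of [cross_form] in its first two points, and [jac] as written in [jacE]. It is a rotational
    curvature of the incidence relation. *)
Definition curv t x1 x2 x3 x4 :=
  dx1 t x1 x2 x3 x4 * (t * dx3 t x1 x2 x3 x4 + dx4 t x1 x2 x3 x4)
  + dx2 t x1 x2 x3 x4 * (dx3 t x1 x2 x3 x4 + t * dx4 t x1 x2 x3 x4).
Definition jac t x1 x2 y1 y2 x3 x4 :=
  dx3 t x1 x2 x3 x4 * dx4 t y1 y2 x3 x4 - dx4 t x1 x2 x3 x4 * dx3 t y1 y2 x3 x4.

(** [jac] is affine in [(y1, y2)] and vanishes at [(x1, x2)], hence exactly linear in the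
    displacement. *)
Lemma jacE t x1 x2 y1 y2 x3 x4 : jac t x1 x2 y1 y2 x3 x4 =
  (t * dx3 t x1 x2 x3 x4 + dx4 t x1 x2 x3 x4) * (y2 - x2)
  - (dx3 t x1 x2 x3 x4 + t * dx4 t x1 x2 x3 x4) * (y1 - x1).
Proof. by rewrite /jac /dx3 /dx4; ring. Qed.

(* Two level sets [cross_form = 0] through nearly the same point that belong to distant parameters
   cross there transversally: [L] is the first-order variation of [cross_form], and [L] and [jac] are
   two independent linear forms in the displacement as long as [curv] does not vanish. *)
Lemma jac_lower A c h e r t x1 x2 y1 y2 x3 x4 z3 z4 :
  1 <= A -> 0 < c -> 0 <= h -> 64 * A ^+ 4 * h <= c ->
  `|t| <= A -> `|1 - t| <= A ->
  `|dx1 t x1 x2 x3 x4| <= A -> `|dx2 t x1 x2 x3 x4| <= A ->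
  `|dx3 t x1 x2 x3 x4| <= A -> `|dx4 t x1 x2 x3 x4| <= A ->
  c <= `|curv t x1 x2 x3 x4| ->
  `|y1 - x1| <= r -> `|y2 - x2| <= r -> r <= `|y1 - x1| \/ r <= `|y2 - x2| -> r <= 2 * h ->
  `|z3 - x3| <= 2 * h -> `|z4 - x4| <= 2 * h ->
  16 * A ^+ 2 * e <= c * r ->
  `|cross_form t x1 x2 x3 x4| <= e -> `|cross_form t y1 y2 x3 x4| <= e ->
  c * r <= 8 * A ^+ 2 * `|jac t x1 x2 y1 y2 z3 z4|.
Proof.
move=> A1 c0 h0 hc tA t1A a1 a2 a3 a4 cc ur vr rr rh z3h z4h er f1 f2.
have A0 : 0 <= A by apply: le_trans A1.
set u := y1 - x1 in ur rr *; set v := y2 - x2 in vr rr *.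
set P1 := dx1 _ _ _ _ _ in a1 *; set P2 := dx2 _ _ _ _ _ in a2 *.
set P3 := dx3 t x1 x2 x3 x4 in a3 *; set P4 := dx4 t x1 x2 x3 x4 in a4 *.
set J := jac t x1 x2 y1 y2 x3 x4; set J' := jac t x1 x2 y1 y2 z3 z4.
pose L := P1 * u + P2 * v; pose D := curv t x1 x2 x3 x4.
have r0 : 0 <= r by apply: le_trans ur.
have JE : J = (t * P3 + P4) * v - (P3 + t * P4) * u by rewrite /J jacE.
have A2 : A <= A ^+ 2 by rewrite -[leLHS]expr1 ler_weXn2l.
have t34 x y : `|x| <= A -> `|y| <= A -> `|t * x + y| <= 2 * A ^+ 2.
  move=> xA yA; rewrite (le_trans (ler_normD _ _))// normrM.
  have : `|t| * `|x| <= A ^+ 2 by rewrite expr2 ler_pM.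
  by lra.
have LE : cross_form t y1 y2 x3 x4 - cross_form t x1 x2 x3 x4 = L + (1 - t) * (u * v).
  by rewrite /L /cross_form /P1 /P2 /dx1 /dx2 /u /v; ring.
have uv : `|u * v| <= 2 * h * r.
  by rewrite normrM ler_pM// (le_trans ur).
have HL : `|L| <= 2 * e + A * (2 * h * r).
  have -> : L = cross_form t y1 y2 x3 x4 - cross_form t x1 x2 x3 x4 - (1 - t) * (u * v).
    by rewrite LE; ring.
  rewrite (le_trans (ler_normB _ _))// lerD//.
    by rewrite (le_trans (ler_normB _ _))//; lra.
  by rewrite normrM ler_pM.
have J0 := normr_ge0 J.
have key w : `|D * w| <= 2 * A ^+ 2 * (`|L| + `|J|) -> r <= `|w| ->
    c * r <= 2 * A ^+ 2 * (`|L| + `|J|).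
  rewrite normrM => Hw rw; apply: le_trans Hw; rewrite ler_pM ?(ltW c0)//.
have K1 : c * r <= 2 * A ^+ 2 * (`|L| + `|J|).
  (* Cramer's rule: [L] and [J] are linear in [u] and [v] with determinant [D]. *)
  case: rr; apply: key.
    have -> : D * u = (t * P3 + P4) * L - P2 * J by rewrite JE /L /D /curv -/P1 -/P2 -/P3 -/P4; ring.
    rewrite (le_trans (ler_normB _ _))// !normrM [leRHS]mulrDr lerD// ler_wpM2r//; first exact: t34.
    by apply: le_trans a2 _; lra.
  have -> : D * v = P1 * J + (t * P4 + P3) * L by rewrite JE /L /D /curv -/P1 -/P2 -/P3 -/P4; ring.
  rewrite addrC (le_trans (ler_normD _ _))// !normrM [leRHS]mulrDr lerD// ler_wpM2r//; first exact: t34.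
  by apply: le_trans a1 _; lra.
(* So far the bound is at the near-intersection [(x3, x4)]. Moving to [(z3, z4)] changes [J] by
   [O(h * r)], which the smallness of [h] absorbs. *)
have dJ : `|J' - J| <= 8 * A ^+ 2 * (h * r).
  have -> : J' - J = (t * ((1 - t) * (z4 - x4)) + (1 - t) * (z3 - x3)) * v
      - ((1 - t) * (z4 - x4) + t * ((1 - t) * (z3 - x3))) * u.
    by rewrite /J' /J !jacE /dx3 /dx4 /u /v; ring.
  have d3 : `|(1 - t) * (z3 - x3)| <= A * (2 * h) by rewrite normrM ler_pM.
  have d4 : `|(1 - t) * (z4 - x4)| <= A * (2 * h) by rewrite normrM ler_pM.
  have Ah : A * (2 * h) <= A ^+ 2 * (2 * h) by rewrite ler_wpM2r// mulr_ge0.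
  have td x y : `|x| <= A * (2 * h) -> `|y| <= A * (2 * h) -> `|t * x + y| <= 4 * A ^+ 2 * h.
    move=> xA yA; rewrite (le_trans (ler_normD _ _))// normrM.
    have : `|t| * `|x| <= A * (A * (2 * h)) by rewrite ler_pM.
    by move: yA Ah; rewrite expr2; lra.
  rewrite (le_trans (ler_normB _ _))// !normrM.
  have B1 := ler_pM (normr_ge0 _) (normr_ge0 v) (td _ _ d4 d3) vr.
  have B2 := ler_pM (normr_ge0 _) (normr_ge0 u) (td _ _ d3 d4) ur.
  rewrite [X in _ + `|X| * _]addrC; move: B1 B2; lra.
have JJ : `|J| <= `|J'| + `|J' - J|.
  by have := ler_normB J' (J' - J); rewrite opprB addrCA subrr addr0.
have hr : A ^+ 4 * (h * r) * 64 <= c * r.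
  by have := ler_wpM2r r0 hc; lra.
have A24 : A ^+ 2 * A ^+ 2 = A ^+ 4 by rewrite -exprD.
have A3 : A ^+ 3 * (h * r) <= A ^+ 4 * (h * r) by rewrite ler_wpM2r ?mulr_ge0// ler_weXn2l.
have S1 : A ^+ 2 * `|L| <= A ^+ 2 * (2 * e + A * (2 * h * r)) by rewrite ler_wpM2l ?exprn_ge0.
have S2 : A ^+ 2 * `|J| <= A ^+ 2 * (`|J'| + 8 * A ^+ 2 * (h * r)).
  by rewrite ler_wpM2l ?exprn_ge0// (le_trans JJ)// lerD2l.
have E1 : A ^+ 2 * (2 * e + A * (2 * h * r)) = 2 * (A ^+ 2 * e) + 2 * (A ^+ 3 * (h * r)) by ring.
have E2 : A ^+ 2 * (`|J'| + 8 * A ^+ 2 * (h * r)) = A ^+ 2 * `|J'| + 8 * (A ^+ 4 * (h * r)) by rewrite -A24; ring.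
rewrite E1 in S1; rewrite E2 in S2.
have J'0 : 0 <= A ^+ 2 * `|J'| by rewrite mulr_ge0 ?exprn_ge0.
clear - K1 er S1 S2 hr A3 J'0; lra.
Qed.

End CrossForm.

Section CrossPhase.
Variable R : realFieldType.

Definition bx (p l u : R) := p - l / 2 + l * u.

Section Coefficients.
Variables (p1 p2 p3 p4 l t : R).
Definition ph0 := (1 - t) * l ^+ 2.
(** [cross_form] is affine in each point, so [dx3] does not depend on [x3], nor [dx4] on [x4]; the 0
    in [ph1] and [ph2] is a placeholder. *)
Definition ph1 u v := l * dx3 t (bx p1 l u) (bx p2 l v) 0 (p4 - l / 2).
Definition ph2 u v := l * dx4 t (bx p1 l u) (bx p2 l v) (p3 - l / 2) 0.
Definition ph3 u v := cross_form t (bx p1 l u) (bx p2 l v) (p3 - l / 2) (p4 - l / 2).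

Lemma bilin_cross u v x y : bilin ph0 (ph1 u v) (ph2 u v) (ph3 u v) x y =
  cross_form t (bx p1 l u) (bx p2 l v) (bx p3 l x) (bx p4 l y).
Proof. by rewrite /bilin /ph0 /ph1 /ph2 /ph3 /cross_form /dx3 /dx4 /bx; ring. Qed.

Lemma ph1_dx u v x y : ph0 * y + ph1 u v = l * dx3 t (bx p1 l u) (bx p2 l v) x (bx p4 l y).
Proof. by rewrite /ph0 /ph1 /dx3 /bx; ring. Qed.

Lemma ph2_dx u v x y : ph0 * x + ph2 u v = l * dx4 t (bx p1 l u) (bx p2 l v) (bx p3 l x) y.
Proof. by rewrite /ph0 /ph2 /dx4 /bx; ring. Qed.
End Coefficients.

Lemma unit_dist (a b : R) : unit_itv a -> unit_itv b -> `|a - b| <= 1.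
Proof.
by move=> /andP[? ?] /andP[? ?]; rewrite ler_norml; apply/andP; split; lra.
Qed.

Lemma bx_near p l u : 0 <= l -> unit_itv u -> `|bx p l u - p| <= l / 2.
Proof.
move=> l0 /andP[u0 u1]; have -> : bx p l u - p = l * (u - 2^-1) by rewrite /bx; field.
by rewrite normrM ger0_norm// ler_wpM2l// ler_norml; apply/andP; split; lra.
Qed.

Lemma phase_of_bounds p1 p2 p3 p4 T tau A c l :
  1 <= A -> 0 < c -> 0 < l -> l <= 1 -> 64 * A ^+ 4 * (l / 2) <= c ->
  (forall t x1 x2 x3 x4, `|t - T| <= tau -> `|x1 - p1| <= l / 2 -> `|x2 - p2| <= l / 2 ->
     `|x3 - p3| <= l / 2 -> `|x4 - p4| <= l / 2 ->
     [/\ `|t| <= A, `|1 - t| <= A, `|dx1 t x1 x2 x3 x4| <= A & `|dx2 t x1 x2 x3 x4| <= A] /\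
     [/\ `|dx3 t x1 x2 x3 x4| <= A, `|dx4 t x1 x2 x3 x4| <= A,
       c <= `|dx3 t x1 x2 x3 x4|, c <= `|dx4 t x1 x2 x3 x4| & c <= `|curv t x1 x2 x3 x4|]) ->
  exists2 B, 1 <= B & forall B', B <= B' -> forall t, `|t - T| <= tau ->
    phase_ok B' (ph0 l t) (ph1 p1 p2 p4 l t) (ph2 p1 p2 p3 l t) (ph3 p1 p2 p3 p4 l t).
Proof.
move=> A1 c0 l0 l1 lc Hb.
have A0 : 0 < A by apply: lt_le_trans A1.
have l0' := ltW l0.
(* [Ba] matches the closeness hypothesis of [jac_lower], [Bb] its conclusion after rescaling by [l],
   and [Bc] the lower bounds on [dx3] and [dx4]. The summand [2 * A] below serves the upper and
   Lipschitz bounds. *)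
pose Ba := 16 * A ^+ 2 / (c * l); pose Bb := 8 * A ^+ 2 / (c * l ^+ 3).
pose Bc := (c * l)^-1.
have Ba0 : 0 <= Ba by rewrite divr_ge0// ?mulr_ge0 ?exprn_ge0 ?(ltW c0) ?(ltW A0).
have Bb0 : 0 <= Bb by rewrite divr_ge0// ?mulr_ge0 ?exprn_ge0 ?(ltW c0) ?(ltW A0).
have Bc0 : 0 <= Bc by rewrite invr_ge0 mulr_ge0 ?(ltW c0).
exists (Ba + Bb + Bc + 2 * A); first by lra.
move=> B BB t tT.
have B0 : 0 < B by apply: lt_le_trans BB; lra.
have BaB : Ba <= B by lra.
have BbB : Bb <= B by lra.
have iB : B^-1 <= c * l.
  have cl0 : 0 < c * l by rewrite mulr_gt0.
  have BcB : Bc <= B by lra.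
  by rewrite -[leRHS]invrK lef_pV2 ?posrE ?invr_gt0.
have bd u v x y : unit_itv u -> unit_itv v -> unit_itv x -> unit_itv y -> _ :=
  fun hu hv hx hy => Hb t _ _ _ _ tT (bx_near p1 l0' hu) (bx_near p2 l0' hv)
    (bx_near p3 l0' hx) (bx_near p4 l0' hy).
have unit0 : unit_itv (0 : R) by rewrite /unit_itv lexx ler01.
have [[tA t1A _ _] _] := bd _ _ _ _ unit0 unit0 unit0 unit0.
have l2 : l ^+ 2 <= 1 by rewrite exprn_ile1.
split.
- by lra.
- rewrite /ph0 normrM (ger0_norm (x := l ^+ 2)) ?exprn_ge0//; apply: (@le_trans _ _ (A * 1)); last by lra.
  by rewrite ler_pM ?exprn_ge0.
- move=> u v y hu hv hy; rewrite (ph1_dx _ _ _ _ _ u v (bx p3 l 0) y) normrM ger0_norm//.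
  have [_ [d3 _ e3 _ _]] := bd _ _ _ _ hu hv unit0 hy.
  apply/andP; split; first by apply: (le_trans iB); rewrite mulrC ler_wpM2l.
  by apply: (@le_trans _ _ (1 * A)); [rewrite ler_pM|lra].
- move=> u v x hu hv hx; rewrite (ph2_dx _ _ _ _ _ u v x (bx p4 l 0)) normrM ger0_norm//.
  have [_ [_ d4 _ e4 _]] := bd _ _ _ _ hu hv hx unit0.
  apply/andP; split; first by apply: (le_trans iB); rewrite mulrC ler_wpM2l.
  by apply: (@le_trans _ _ (1 * A)); [rewrite ler_pM|lra].
- move=> u v u' v' r hu hv hu' hv' ur vr.
  have r0 : 0 <= r by apply: le_trans ur.
  have gen x y : `|x| <= r -> `|y| <= r -> `|l ^+ 2 * (t * x - y)| <= B * r.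
    move=> xr yr; apply: (@le_trans _ _ (2 * A * r)); last by rewrite ler_wpM2r//; lra.
    rewrite normrM ger0_norm ?exprn_ge0// -[leRHS]mul1r ler_pM ?exprn_ge0//.
    rewrite (le_trans (ler_normB _ _))// normrM.
    have : `|t| * `|x| <= A * r by rewrite ler_pM.
    by have : r <= A * r by [rewrite ler_peMl]; lra.
  split.
    have -> : ph1 p1 p2 p4 l t u' v' - ph1 p1 p2 p4 l t u v =
      l ^+ 2 * (t * (u' - u) - (v' - v)) by rewrite /ph1 /dx3 /bx; ring.
    exact: gen.
  have -> : ph2 p1 p2 p3 l t u' v' - ph2 p1 p2 p3 l t u v =
    l ^+ 2 * (t * (v' - v) - (u' - u)) by rewrite /ph2 /dx4 /bx; ring.
  exact: gen.
- move=> u v u' v' x y e r hu hv hu' hv' hx hy e0 Ber mr.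
  rewrite !bilin_cross => f1 f2 x' y' hx' hy'.
  rewrite (ph1_dx _ _ _ _ _ u v (bx p3 l x') y') (ph1_dx _ _ _ _ _ u' v' (bx p3 l x') y').
  rewrite (ph2_dx _ _ _ _ _ u v x' (bx p4 l y')) (ph2_dx _ _ _ _ _ u' v' x' (bx p4 l y')).
  have -> : l * dx3 t (bx p1 l u) (bx p2 l v) (bx p3 l x') (bx p4 l y') *
     (l * dx4 t (bx p1 l u') (bx p2 l v') (bx p3 l x') (bx p4 l y')) -
     l * dx4 t (bx p1 l u) (bx p2 l v) (bx p3 l x') (bx p4 l y') *
     (l * dx3 t (bx p1 l u') (bx p2 l v') (bx p3 l x') (bx p4 l y'))
    = l ^+ 2 * jac t (bx p1 l u) (bx p2 l v) (bx p1 l u') (bx p2 l v') (bx p3 l x') (bx p4 l y').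
    by rewrite /jac; ring.
  have [[_ _ d1 d2] [d3 d4 _ _ cu]] := bd _ _ _ _ hu hv hx hy.
  have bxD (p a b : R) : bx p l a - bx p l b = l * (a - b) by rewrite /bx; ring.
  have ll (p a b : R) : unit_itv a -> unit_itv b -> `|bx p l a - bx p l b| <= 2 * (l / 2).
    move=> ha hb; rewrite bxD normrM ger0_norm// mulrCA divff ?mulr1 ?pnatr_eq0//.
    by rewrite ler_piMr// unit_dist.
  have r0 : 0 <= r by rewrite -mr le_max normr_ge0.
  have nl (p a b : R) : `|bx p l a - bx p l b| = l * `|a - b| by rewrite bxD normrM ger0_norm.
  have r1 : r <= 1 by rewrite -mr ge_max !unit_dist.
  have rcl : r * (c * l) = c * (l * r) by ring.
  have er : 16 * A ^+ 2 * e <= c * (l * r).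
    have : Ba * e <= r by apply: le_trans Ber; rewrite ler_wpM2r ?(ltW e0).
    by rewrite /Ba mulrAC ler_pdivrMr ?mulr_gt0// rcl.
  have hl : 0 <= l / 2 by rewrite divr_ge0.
  have ur : `|bx p1 l u' - bx p1 l u| <= l * r by rewrite nl ler_wpM2l// -mr le_max lexx.
  have vr : `|bx p2 l v' - bx p2 l v| <= l * r by rewrite nl ler_wpM2l// -mr le_max lexx orbT.
  have rr : l * r <= `|bx p1 l u' - bx p1 l u| \/ l * r <= `|bx p2 l v' - bx p2 l v|.
    rewrite !nl -mr; case: (leP `|u' - u| `|v' - v|) => _; [right|left]; exact: lexx.
  have rh : l * r <= 2 * (l / 2) by rewrite mulrCA divff ?mulr1 ?pnatr_eq0// ler_piMr.
  have H := jac_lower A1 c0 hl lc tA t1A d1 d2 d3 d4 cu ur vr rr rh (ll p3 _ _ hx' hx) (ll p4 _ _ hy' hy) er f1 f2.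
  rewrite normrM ger0_norm ?exprn_ge0// ler_pdivrMr//.
  set J := `|jac _ _ _ _ _ _ _| in H *.
  have J0 : 0 <= J by exact: normr_ge0.
  apply: (@le_trans _ _ (l ^+ 2 * J * Bb)); last first.
    by rewrite ler_wpM2l ?mulr_ge0 ?exprn_ge0.
  have -> : l ^+ 2 * J * Bb = 8 * A ^+ 2 * J / (c * l) by rewrite /Bb; field; rewrite !gt_eqF.
  by rewrite ler_pdivlMr ?mulr_gt0// rcl.
Qed.

End CrossPhase.

Section CrossGeometry.
Variable R : realFieldType.

Lemma near_quintuple (T p1 p2 p3 p4 : R) (Q : R * R * R * R * R -> Prop) :
  (\forall a \near (T, p1, p2, p3, p4), Q a) ->
  exists2 h, 0 < h & forall t x1 x2 x3 x4, `|t - T| <= h -> `|x1 - p1| <= h ->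
    `|x2 - p2| <= h -> `|x3 - p3| <= h -> `|x4 - p4| <= h -> Q (t, x1, x2, x3, x4).
Proof.
move=> /nbhs_ballP[e /= e0 H]; have e2 : 0 < e / 2 by rewrite divr_gt0.
have lt x y : `|x - y| <= e / 2 -> `|y - x| < e.
  by move=> xy; rewrite distrC (le_lt_trans xy)// ltr_pdivrMr// ltr_pMr// ltr1n.
exists (e / 2) => // t x1 x2 x3 x4 a0 a1 a2 a3 a4; apply: H.
by do !split; rewrite -ball_normE; exact: lt.
Qed.

Let V := (R * R * R * R * R)%type.

Lemma cvg_coordinates (b : V) :
  [/\ (fun a : V => a.1.1.1.1) @ b --> b.1.1.1.1, (fun a : V => a.1.1.1.2) @ b --> b.1.1.1.2,
      (fun a : V => a.1.1.2) @ b --> b.1.1.2, (fun a : V => a.1.2) @ b --> b.1.2 &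
      (fun a : V => a.2) @ b --> b.2].
Proof.
have f1 : (fun a : V => a.1.1) @ b --> b.1.1 by apply: (cvg_comp _ _ cvg_fst); exact: cvg_fst.
have f2 : (fun a : V => a.1.1.1) @ b --> b.1.1.1 by apply: (cvg_comp _ _ f1); exact: cvg_fst.
split; last exact: cvg_snd.
- by apply: (cvg_comp _ _ f2); exact: cvg_fst.
- by apply: (cvg_comp _ _ f2); exact: cvg_snd.
- by apply: (cvg_comp _ _ f1); exact: cvg_snd.
- by apply: (cvg_comp _ _ cvg_fst); exact: cvg_snd.
Qed.

(** At the base points, with [T] their cross ratio, [dx3], [dx4] and [curv] factor into differences
    of the base points, and all six differences occur in [curv]. Distinctness is thus the required
    nondegeneracy, and continuity extends it to small intervals. *)
Lemma cross_ratio_geometry (p1 p2 p3 p4 : R) :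
  [/\ p1 != p2, p1 != p3 & p1 != p4] -> [/\ p2 != p3, p2 != p4 & p3 != p4] ->
  exists T tau l B, [/\ 0 < tau, 0 < l & 1 <= B] /\
  [/\ forall B', B <= B' -> forall t, `|t - T| <= tau ->
      phase_ok B' (ph0 l t) (ph1 p1 p2 p4 l t) (ph2 p1 p2 p3 l t) (ph3 p1 p2 p3 p4 l t),
    forall u v x y, unit_itv u -> unit_itv v -> unit_itv x -> unit_itv y ->
      exists2 s, `|s - T| <= tau / 2 & forall t,
      `|cross_form t (bx p1 l u) (bx p2 l v) (bx p3 l x) (bx p4 l y)| <= B * `|t - s|,
    forall t t' u v x y, unit_itv u -> unit_itv v -> unit_itv x -> unit_itv y ->
     `|cross_form t' (bx p1 l u) (bx p2 l v) (bx p3 l x) (bx p4 l y)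
      - cross_form t (bx p1 l u) (bx p2 l v) (bx p3 l x) (bx p4 l y)| <= B * `|t' - t| &
    forall x1 x2 x3 x4, `|x1 - p1| <= l / 2 -> `|x2 - p2| <= l / 2 ->
     `|x3 - p3| <= l / 2 -> `|x4 - p4| <= l / 2 -> (x3 - x2) * (x4 - x1) != 0].
Proof.
move=> [n12 n13 n14] [n23 n24 n34].
have nz (a b : R) : a != b -> b - a != 0 by move=> ab; rewrite subr_eq0 eq_sym.
pose T := ((p3 - p1) * (p4 - p2)) / ((p3 - p2) * (p4 - p1)).
pose b : V := (T, p1, p2, p3, p4).
pose t_ (a : V) := a.1.1.1.1.
pose o_ (a : V) := 1 - a.1.1.1.1.
pose D1 (a : V) := dx1 a.1.1.1.1 a.1.1.1.2 a.1.1.2 a.1.2 a.2.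
pose D2 (a : V) := dx2 a.1.1.1.1 a.1.1.1.2 a.1.1.2 a.1.2 a.2.
pose D3 (a : V) := dx3 a.1.1.1.1 a.1.1.1.2 a.1.1.2 a.1.2 a.2.
pose D4 (a : V) := dx4 a.1.1.1.1 a.1.1.1.2 a.1.1.2 a.1.2 a.2.
pose Cu (a : V) := curv a.1.1.1.1 a.1.1.1.2 a.1.1.2 a.1.2 a.2.
pose De (a : V) := (a.1.2 - a.1.1.2) * (a.2 - a.1.1.1.2).
pose Nu (a : V) := (a.1.2 - a.1.1.1.2) * (a.2 - a.1.1.2) - T * ((a.1.2 - a.1.1.2) * (a.2 - a.1.1.1.2)).
have FF : Filter (nbhs b) by exact: nbhs_filter.
have [k0 k1 k2 k3 k4] := cvg_coordinates b.
have ct : t_ @ b --> t_ b := k0.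
have co : o_ @ b --> o_ b by exact: (@cvgB R R _ _ _ (cst 1) t_ _ _ (@cvg_cst _ _ _ _ _) k0).
have c1 : D1 @ b --> D1 b by exact: (cvgB (cvgM k0 (cvgB k3 k2)) (cvgB k4 k2)).
have c2 : D2 @ b --> D2 b by exact: (cvgB (cvgM k0 (cvgB k4 k1)) (cvgB k3 k1)).
have c3 : D3 @ b --> D3 b by exact: (cvgB (cvgB k4 k2) (cvgM k0 (cvgB k4 k1))).
have c4 : D4 @ b --> D4 b by exact: (cvgB (cvgB k3 k1) (cvgM k0 (cvgB k3 k2))).
have cC : Cu @ b --> Cu b.
  by exact: (cvgD (cvgM c1 (cvgD (cvgM ct c3) c4)) (cvgM c2 (cvgD c3 (cvgM ct c4)))).
have cD : De @ b --> De b by exact: (cvgM (cvgB k3 k2) (cvgB k4 k1)).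
have cN : Nu @ b --> Nu b.
  by exact: (cvgB (cvgM (cvgB k3 k1) (cvgB k4 k2)) (@cvgM R _ _ _ (cst T) De _ _ (@cvg_cst _ _ _ _ _) cD)).
have e12 := nz _ _ n12; have e13 := nz _ _ n13; have e14 := nz _ _ n14.
have e23 := nz _ _ n23; have e24 := nz _ _ n24; have e34 := nz _ _ n34.
have z3 : D3 b != 0.
  have -> : D3 b = - ((p4 - p2) * (p2 - p1) / (p3 - p2)).
    by rewrite /D3 /dx3 /b /T /=; field; rewrite e23 e14.
  by rewrite oppr_eq0 !mulf_neq0// invr_eq0.
have z4 : D4 b != 0.
  have -> : D4 b = (p3 - p1) * (p2 - p1) / (p4 - p1).
    by rewrite /D4 /dx4 /b /T /=; field; rewrite e23 e14.
  by rewrite !mulf_neq0// invr_eq0.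
have zC : Cu b != 0.
  have -> : Cu b = - (2 * (p2 - p1) ^+ 2 * (p4 - p3) ^+ 2 * (p3 - p1) * (p4 - p2)
      / ((p3 - p2) ^+ 2 * (p4 - p1) ^+ 2)).
    by rewrite /Cu /curv /dx1 /dx2 /dx3 /dx4 /b /T /=; field; rewrite e23 e14.
  by rewrite oppr_eq0 !mulf_neq0 ?invr_eq0 ?mulf_neq0 ?expf_neq0// pnatr_eq0.
have zD : De b != 0 by rewrite /De /b /= mulf_neq0.
have zN : Nu b = 0 by rewrite /Nu /b /T /=; field; rewrite e23 e14.
have bd (f : V -> R) : f @ b --> f b -> \forall a \near b, `|f a| <= `|f b| + 1.
  by move=> cf; apply: (@cvgr_norm_le R R _ _ _ _ _ cf); rewrite ltrDl.
have aw (f : V -> R) : f @ b --> f b -> f b != 0 -> \forall a \near b, `|f b| / 2 <= `|f a|.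
  move=> cf f0; apply: (@cvgr_norm_ge R R _ _ _ _ _ cf).
  by rewrite ltr_pdivrMr// ltr_pMr ?normr_gt0// ltr1n.
have [h1 h10 H1] := near_quintuple (filterI (bd _ ct) (filterI (bd _ co)
  (filterI (bd _ c1) (filterI (bd _ c2) (filterI (bd _ c3)
  (filterI (bd _ c4) (filterI (aw _ c3 z3) (filterI (aw _ c4 z4)
  (filterI (aw _ cC zC) (filterI (bd _ cD) (aw _ cD zD))))))))))).
(* The root of a quadruple differs from [T] by [Nu / De]; this bound on [Nu] keeps the root within
   [h1 / 2] of [T]. *)
have e0 : 0 < h1 / 2 * (`|De b| / 2) by rewrite mulr_gt0 ?divr_gt0 ?normr_gt0.
have [h2 h20 H2] := near_quintuple (@cvgr_distC_le R R _ _ _ _ _ cN _ e0).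
pose A := 1 + (`|t_ b| + `|o_ b| + `|D1 b| + `|D2 b| + `|D3 b| + `|D4 b| + `|De b|).
pose c := Num.min (`|D3 b| / 2) (Num.min (`|D4 b| / 2) (`|Cu b| / 2)).
have [A1 [At [Ao [AD1 [AD2 [AD3 [AD4 AD]]]]]]] : 1 <= A /\ `|t_ b| + 1 <= A /\ `|o_ b| + 1 <= A /\
   `|D1 b| + 1 <= A /\ `|D2 b| + 1 <= A /\ `|D3 b| + 1 <= A /\ `|D4 b| + 1 <= A /\ `|De b| + 1 <= A.
  rewrite /A; move: (normr_ge0 (t_ b)) (normr_ge0 (o_ b)) (normr_ge0 (D1 b)) (normr_ge0 (D2 b))
   (normr_ge0 (D3 b)) (normr_ge0 (D4 b)) (normr_ge0 (De b)).
  move: `|t_ b| `|o_ b| `|D1 b| `|D2 b| `|D3 b| `|D4 b| `|De b|.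
  clear; move=> x1 x2 x3 x4 x5 x6 x7 *; do !split; lra.
have c0 : 0 < c by rewrite !lt_min !divr_gt0// normr_gt0.
have [cl3 [cl4 clC]] : c <= `|D3 b| / 2 /\ c <= `|D4 b| / 2 /\ c <= `|Cu b| / 2.
  by rewrite /c !ge_min !lexx ?orbT.
have A0 : 0 < A by apply: lt_le_trans A1.
have A4 : 0 < 64 * A ^+ 4 by rewrite mulr_gt0// exprn_gt0.
pose l := Num.min 1 (Num.min h1 (Num.min h2 (c / (64 * A ^+ 4)))).
have l0 : 0 < l by rewrite !lt_min ltr01 h10 h20 divr_gt0.
have [l1 [lh1 [lh2 lc]]] : l <= 1 /\ l <= h1 /\ l <= h2 /\ l <= c / (64 * A ^+ 4).
  by rewrite /l !ge_min !lexx ?orbT.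
have l0' := ltW l0.
have half : l / 2 <= l by rewrite ler_pdivrMr// ler_peMr//; rewrite ler1n.
have lh1' := le_trans half lh1; have lh2' := le_trans half lh2.
have lc' : 64 * A ^+ 4 * (l / 2) <= c by rewrite mulrC -ler_pdivlMr// (le_trans half).
have [|B B1 HB] := @phase_of_bounds _ p1 p2 p3 p4 T h1 A c l A1 c0 l0 l1 lc'.
  move=> t x1 x2 x3 x4 tT a1 a2 a3 a4.
  have [Ht [Ho [K1 [K2 [K3 [K4 [L3 [L4 [LC _]]]]]]]]] := H1 t x1 x2 x3 x4 tT
    (le_trans a1 lh1') (le_trans a2 lh1') (le_trans a3 lh1') (le_trans a4 lh1').
  split; split.
  - exact: le_trans At. - exact: le_trans Ao. - exact: le_trans AD1. - exact: le_trans AD2.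
  - exact: le_trans AD3. - exact: le_trans AD4. - exact: le_trans L3. - exact: le_trans L4.
  - exact: le_trans LC.
have TT : `|T - T| <= h1 by rewrite subrr normr0 ltW.
have TT2 : `|T - T| <= h2 by rewrite subrr normr0 ltW.
have den x1 x2 x3 x4 : `|x1 - p1| <= l / 2 -> `|x2 - p2| <= l / 2 ->
     `|x3 - p3| <= l / 2 -> `|x4 - p4| <= l / 2 ->
     `|De b| / 2 <= `|(x3 - x2) * (x4 - x1)| <= A.
  move=> a1 a2 a3 a4; have [_ [_ [_ [_ [_ [_ [_ [_ [_ [DA LD]]]]]]]]]] := H1 T x1 x2 x3 x4 TT
    (le_trans a1 lh1') (le_trans a2 lh1') (le_trans a3 lh1') (le_trans a4 lh1').
  by apply/andP; split; [exact: LD|exact: le_trans AD].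
have den0 x1 x2 x3 x4 : `|x1 - p1| <= l / 2 -> `|x2 - p2| <= l / 2 ->
     `|x3 - p3| <= l / 2 -> `|x4 - p4| <= l / 2 -> (x3 - x2) * (x4 - x1) != 0.
  move=> a1 a2 a3 a4; have /andP[d1 _] := den _ _ _ _ a1 a2 a3 a4.
  by rewrite -normr_gt0; apply: lt_le_trans d1; rewrite divr_gt0// normr_gt0.
exists T, h1, l, (A + B); split; first by split=> //; clear - A1 B1; lra.
split=> //.
- by move=> B' BB'; apply: HB; apply: le_trans BB'; clear - A0; lra.
- move=> u v x y hu hv hx hy.
  have a1 := bx_near p1 l0' hu; have a2 := bx_near p2 l0' hv.
  have a3 := bx_near p3 l0' hx; have a4 := bx_near p4 l0' hy.
  move: (bx p1 l u) (bx p2 l v) (bx p3 l x) (bx p4 l y) a1 a2 a3 a4 => x1 x2 x3 x4 a1 a2 a3 a4.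
  have /andP[d1 dA] := den _ _ _ _ a1 a2 a3 a4; have d0 := den0 _ _ _ _ a1 a2 a3 a4.
  have dpos : 0 < `|(x3 - x2) * (x4 - x1)| by rewrite normr_gt0.
  exists ((x3 - x1) * (x4 - x2) / ((x3 - x2) * (x4 - x1))).
    have := H2 T x1 x2 x3 x4 TT2 (le_trans a1 lh2') (le_trans a2 lh2') (le_trans a3 lh2') (le_trans a4 lh2').
    rewrite zN subr0 /Nu /= => HN.
    have -> : (x3 - x1) * (x4 - x2) / ((x3 - x2) * (x4 - x1)) - T =
      ((x3 - x1) * (x4 - x2) - T * ((x3 - x2) * (x4 - x1))) / ((x3 - x2) * (x4 - x1)).
      by rewrite [RHS]mulrBl (mulfK d0).
    rewrite normrM normfV ler_pdivrMr// (le_trans HN)// ler_wpM2l// divr_ge0// ltW//.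
  move=> t; rewrite /cross_form; set d := (x3 - x2) * _ in d0 dA dpos *.
  have -> : (x3 - x1) * (x4 - x2) - t * d = - (d * (t - (x3 - x1) * (x4 - x2) / d)).
    by field.
  rewrite normrN normrM ler_wpM2r// (le_trans dA)//; clear - B1; lra.
- move=> t t' u v x y hu hv hx hy.
  have a1 := bx_near p1 l0' hu; have a2 := bx_near p2 l0' hv.
  have a3 := bx_near p3 l0' hx; have a4 := bx_near p4 l0' hy.
  move: (bx p1 l u) (bx p2 l v) (bx p3 l x) (bx p4 l y) a1 a2 a3 a4 => x1 x2 x3 x4 a1 a2 a3 a4.
  have /andP[d1 dA] := den _ _ _ _ a1 a2 a3 a4.
  rewrite /cross_form; set d := (x3 - x2) * _ in dA *.
  have -> : (x3 - x1) * (x4 - x2) - t' * d - ((x3 - x1) * (x4 - x2) - t * d) = - (d * (t' - t)) by ring.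
  rewrite normrN normrM ler_wpM2r// (le_trans dA)//; clear - B1; lra.
Qed.

End CrossGeometry.

(** * Uniform approximate solutions *)

Section UniformHits.
Variable R : realType.

Lemma exp_small (x e : R) : 0 <= x < 1 -> 0 < e -> exists n0, forall n, (n0 <= n)%N -> x ^+ n <= e.
Proof.
move=> /andP[x0 x1] e0; have xn : `|x| < 1 by rewrite ger0_norm.
have [n0 _ H] := @cvgr0_norm_le R R _ _ _ _ (cvg_expr xn) _ e0.
by exists n0 => n /H /=; rewrite ger0_norm ?exprn_ge0.
Qed.

Lemma telescope_geometric (a : nat -> R) (x C : R) n0 N : 0 <= x < 1 -> 0 <= C -> (n0 <= N)%N ->
  (forall n, (n0 <= n < N)%N -> `|a n - a n.+1| <= C * x ^+ n) ->
  `|a n0 - a N| <= C * (x ^+ n0 / (1 - x)).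
Proof.
move=> /andP[x0 x1] C0 nN Ha; have x1' : 0 < 1 - x by rewrite subr_gt0.
suff H : `|a n0 - a N| <= C * ((x ^+ n0 - x ^+ N) / (1 - x)).
  apply: (le_trans H); rewrite ler_wpM2l// ler_wpM2r ?invr_ge0 ?(ltW x1')//.
  by rewrite gerBl exprn_ge0.
elim: N nN Ha => [|N IH] nN Ha.
  by move: nN; rewrite leqn0 => /eqP ->; rewrite !subrr normr0 mul0r mulr0.
have [E|lt] := eqVneq n0 N.+1; first by rewrite E !subrr normr0 mul0r mulr0.
have n0N : (n0 <= N)%N by rewrite -ltnS ltn_neqAle lt nN.
have -> : a n0 - a N.+1 = (a n0 - a N) + (a N - a N.+1) by ring.
have -> : C * ((x ^+ n0 - x ^+ N.+1) / (1 - x)) =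
    C * ((x ^+ n0 - x ^+ N) / (1 - x)) + C * x ^+ N.
  by rewrite exprS; field; rewrite gt_eqF.
rewrite (le_trans (ler_normD _ _))// lerD//; last by apply: Ha; rewrite n0N ltnSn.
by apply: IH => // n /andP[h1 h2]; apply: Ha; rewrite h1 ltnW.
Qed.

(** [phi] is the derivative of [F u - F (2 * u)], which has compact support because [F] is constant
    on either side of [-1, 1]. The factor 9 is 1 + 2 * 2^2, the square coming from the rescaled
    Taylor remainder. *)
Lemma dyadic_profiles : exists Bf, 1 <= Bf /\ exists f f1 f2 Phi phi phi1 : R -> R,
  [/\ profile_ok Bf Phi phi phi1, profile_ok Bf f f1 f2,
      forall u, phi u = f u - 2 * f (2 * u),
      forall u, 0 <= f u & forall u, `|u| <= 2^-1 -> 4^-1 <= f u].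
Proof.
have [Bf [F [f [f1 [f2 [B1 [T0 T1 T2] [bF bf bf1 bf2] [Fp Fn sf sf1 sf2] [f0 f4]]]]]]] := bump_exists R.
have B9 : Bf <= 9 * Bf by lra.
exists (9 * Bf); split; first by lra.
have s2 u : 1 <= `|u| -> 1 <= `|2 * u| :> R by rewrite normrM ger0_norm//; lra.
exists f, f1, f2, (fun u => F u - F (2 * u)), (fun u => f u - 2 * f (2 * u)),
  (fun u => f1 u - 4 * f1 (2 * u)).
have comb (g g' : R -> R) c u h : taylor1 Bf g g' -> 0 <= c <= 2 ->
    `|g (u + h) - c * g (2 * (u + h)) - (g u - c * g (2 * u)) - h * (g' u - 2 * c * g' (2 * u))|
    <= 9 * Bf * h ^+ 2.
  move=> tg /andP[c0 c2].
  have -> : g (u + h) - c * g (2 * (u + h)) - (g u - c * g (2 * u)) - h * (g' u - 2 * c * g' (2 * u))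
    = (g (u + h) - g u - h * g' u) - c * (g (2 * u + 2 * h) - g (2 * u) - 2 * h * g' (2 * u)).
    by rewrite mulrDr; ring.
  rewrite (le_trans (ler_normB _ _))//.
  have E1 := tg u h; have E2 := tg (2 * u) (2 * h).
  have -> : 9 * Bf * h ^+ 2 = Bf * h ^+ 2 + 2 * (Bf * (2 * h) ^+ 2) by ring.
  by rewrite lerD// normrM ler_pM// ger0_norm.
have bcomb (g : R -> R) c : bounded_by Bf g -> 0 <= c <= 4 ->
   bounded_by (9 * Bf) (fun u => g u - c * g (2 * u)).
  move=> bg /andP[c0 c4] u; rewrite (le_trans (ler_normB _ _))// normrM (ger0_norm c0).
  have : c * `|g (2 * u)| <= 4 * Bf by rewrite ler_pM.
  by have := bg u; lra.
split => //; split.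
- move=> u h; have := @comb F f 1 u h T0; rewrite !mul1r mulr1; apply.
  by rewrite ler01 ler1n.
- move=> u h; have := @comb f f1 2 u h T1; rewrite (_ : 2 * 2 = 4 :> R); last by ring.
  by apply; rewrite lexx ler0n.
- move=> u; have := @bcomb F 1 bF; rewrite ler01 ler1n => /(_ isT u).
  by rewrite mul1r.
- by apply: bcomb => //; rewrite ler0n ler_nat.
- by apply: bcomb => //; rewrite ler0n lexx.
- move=> u; rewrite ler_normr => /orP[u1|u1].
    by rewrite Fp// (Fp (2 * u)) ?subrr//; lra.
  by rewrite Fn ?(Fn (2 * u)) ?subrr//; lra.
- by move=> u u1; rewrite sf// sf ?s2// mulr0 subr0.
- exact: taylor1_weaken T1. - exact: taylor1_weaken T2. - exact: bounded_weaken bf.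
- exact: bounded_weaken bf1. - exact: bounded_weaken bf2. - exact: sf. - exact: sf1.
Qed.

Section Family.
Variables (p1 p2 p3 p4 T tau l B : R).
Hypotheses (tau0 : 0 < tau) (B1 : 1 <= B)
  (Hph : forall B', B <= B' -> forall t, `|t - T| <= tau ->
      phase_ok B' (ph0 l t) (ph1 p1 p2 p4 l t) (ph2 p1 p2 p3 l t) (ph3 p1 p2 p3 p4 l t))
  (Hroot : forall u v x y, unit_itv u -> unit_itv v -> unit_itv x -> unit_itv y ->
      exists2 s, `|s - T| <= tau / 2 & forall t,
      `|cross_form t (bx p1 l u) (bx p2 l v) (bx p3 l x) (bx p4 l y)| <= B * `|t - s|)
  (Hlip : forall t t' u v x y, unit_itv u -> unit_itv v -> unit_itv x -> unit_itv y ->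
     `|cross_form t' (bx p1 l u) (bx p2 l v) (bx p3 l x) (bx p4 l y)
      - cross_form t (bx p1 l u) (bx p2 l v) (bx p3 l x) (bx p4 l y)| <= B * `|t' - t|).

(** The grid points need not belong to the set; the nonzero masses are what ties them to it. The
    last two points sit on the fine grid, and dividing by [2 ^ (5 * N - N)] gives the index of their
    cell of level [N]. *)
Definition hit N (mu1 mu2 mu3 mu4 : nat -> nat -> R) t := exists i j k k',
  [/\ mu1 N i != 0, mu2 N j != 0, mu3 N (k %/ 2 ^ (5 * N - N))%N != 0,
    mu4 N (k' %/ 2 ^ (5 * N - N))%N != 0 &
    [/\ (i < 2 ^ N)%N, (j < 2 ^ N)%N, (k < 2 ^ (5 * N))%N, (k' < 2 ^ (5 * N))%N &
    `|cross_form t (bx p1 l (dyadic R N i)) (bx p2 l (dyadic R N j))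
       (bx p3 l (dyadic R (5 * N) k)) (bx p4 l (dyadic R (5 * N) k'))| <= 2^-1 ^+ N]].

(** The order of quantifiers is the point: [n0], [K], [tk] and [r] precede [N] and the measures. The
    pairing at scale [n0] is at least [dl] for some [tk k]; moving [t] by [r] and adding all later
    steps cost at most [dl / 4] each, so it cannot vanish at scale [N]. *)
Lemma uniform_hits (q m : R) : 2^-1 < q -> q < 1 -> q ^+ 4 < 8^-1 -> 0 < m ->
  exists n0 K (tk : nat -> R) r, 0 < r /\ forall N (mu1 mu2 mu3 mu4 : nat -> nat -> R), (n0 <= N)%N ->
    frostman q N mu1 -> frostman q N mu2 -> frostman q N mu3 -> frostman q N mu4 ->
    centred N mu3 -> centred N mu4 ->
    m <= mu1 0 0 -> m <= mu2 0 0 -> m <= mu3 0 0 -> m <= mu4 0 0 ->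
    exists2 k, (k < K)%N & forall t, `|t - tk k| <= r -> hit N mu1 mu2 mu3 mu4 t.
Proof.
move=> q_gt q_lt q4 m0.
have [Bf [Bf1 [f [f1 [f2 [Phi [phi [phi1 [prPhi prf phiE f0 f4]]]]]]]]] := dyadic_profiles.
have B1' := B1; pose Bm := B + Bf; have BBm : B <= Bm by rewrite /Bm; lra.
have BfBm : Bf <= Bm by rewrite /Bm; lra.
have Bm1 : 1 <= Bm by rewrite /Bm; lra.
have Bm0 : 0 < Bm by apply: lt_le_trans Bm1.
have {}prPhi := profile_weaken BfBm prPhi; have {}prf := profile_weaken BfBm prf.
pose om := Num.sqrt (2 : R).
have om0 : 0 < om by rewrite sqrtr_gt0.
have om2 : om ^+ 2 = 2 by rewrite sqr_sqrtr.
have q0 : 0 < q by apply: lt_trans q_gt; rewrite invr_gt0.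
pose th := 2 * (om * q ^+ 2).
have th0 : 0 <= th by rewrite mulr_ge0// mulr_ge0 ?exprn_ge0 ?ltW.
have th1 : th < 1.
  rewrite -(@ltr_pXn2r _ 2)// ?nnegrE//; rewrite expr1n.
  have -> : th ^+ 2 = 4 * om ^+ 2 * q ^+ 4 by rewrite /th; ring.
  by rewrite om2; lra.
have th01 : 0 <= th < 1 by rewrite th0.
pose C := 17 * (2 + 15 * energy_const Bm q) + 32 * Bm ^+ 3.
have C0 : 0 <= C.
  have E0 : 0 <= energy_const Bm q.
    apply: mulr_ge0.
      by rewrite mulr_ge0// mulr_ge0// exprn_ge0// mulr_ge0// sqr_ge0.
    have q4' : 1 < 4 * q ^+ 2 by nra.
    by rewrite invr_ge0 subr_ge0 invf_le1 ?(ltW q4')// (lt_trans _ q4').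
  have B3 : 0 <= Bm ^+ 3 by rewrite exprn_ge0// ltW.
  by rewrite /C; lra.
pose K0 := (Num.truncn (2 * Bm * tau)).+1.
have K0B : 2 * Bm * tau <= K0%:R by rewrite ltW// truncnS_gt.
have K0r : 0 < K0%:R :> R by rewrite ltr0n.
pose dl := m ^+ 4 / (4 * K0%:R).
have dl0 : 0 < dl by rewrite divr_gt0 ?exprn_gt0 ?mulr_gt0.
have C1 : 0 < C + 1 by apply: lt_le_trans ltr01 _; rewrite lerDr.
have e0 : 0 < dl / 4 * (1 - th) / (C + 1).
  by apply: divr_gt0 => //; apply: mulr_gt0; [exact: divr_gt0|rewrite subr_gt0].
have [n1 Hn1] := exp_small th01 e0.
(* Level 2 is where [centred] begins to localise the measures. *)
pose n0 := maxn 2 n1.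
have tail : C * (th ^+ n0 / (1 - th)) <= dl / 4.
  have := Hn1 n0 (leq_maxr _ _); have s1 : 0 < 1 - th by rewrite subr_gt0.
  rewrite ler_pdivlMr// => H.
  rewrite mulrA ler_pdivrMr//; apply: le_trans H.
  by rewrite mulrC ler_wpM2l ?exprn_ge0//; lra.
pose r := Num.min (tau / 2) (Num.min (dl / 4 / (2 * Bm * 4 ^+ n0 * Bm)) (1 / (2 ^+ n0 * Bm))).
have cpos : 0 < 2 * Bm * 4 ^+ n0 * Bm :> R by rewrite !mulr_gt0// exprn_gt0.
have p2' : 0 < 2 ^+ n0 * Bm :> R by rewrite mulr_gt0// exprn_gt0.
have r0 : 0 < r.
  rewrite /r !lt_min; apply/and3P; split; first exact: divr_gt0.
    by apply: divr_gt0 => //; exact: divr_gt0.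
  exact: divr_gt0.
have [r1 [r2 r3]] : r <= tau / 2 /\ r <= dl / 4 / (2 * Bm * 4 ^+ n0 * Bm) /\ r <= 1 / (2 ^+ n0 * Bm).
  by rewrite /r !ge_min !lexx ?orbT.
pose tk (k : nat) := T - tau / 2 + tau * (k%:R / (K0 * 2 ^ n0)%:R).
exists n0, (K0 * 2 ^ n0)%N, tk, r; split=> // N mu1 mu2 mu3 mu4 nN fr1 fr2 fr3 fr4 ce3 ce4 m1 m2 m3 m4.
pose pr t n := pairing (ph0 l t) (ph1 p1 p2 p4 l t) (ph2 p1 p2 p3 l t) (ph3 p1 p2 p3 p4 l t)
   N mu1 mu2 mu3 mu4 f n.
have [|k kK low] := pairing_lower (c0 := ph0 l) (c1 := ph1 p1 p2 p4 l) (c2 := ph2 p1 p2 p3 l)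
  (c3 := ph3 p1 p2 p3 p4 l) (f := f) (T := T) (K := K0)
  fr1 fr2 fr3 fr4 nN tau0 isT K0B m0 Bm1 m1 m2 m3 m4 f0 f4.
- move=> u v x y hu hv hx hy; have [s sT Hs] := Hroot hu hv hx hy.
  exists s => // t; rewrite bilin_cross (le_trans (Hs t))// ler_wpM2r//.
exists k => // t tt.
have KK0 : 0 < (K0 * 2 ^ n0)%:R :> R by rewrite ltr0n muln_gt0 expn_gt0.
have kT : `|tk k - T| <= tau / 2.
  have w0 : 0 <= k%:R / (K0 * 2 ^ n0)%:R :> R by rewrite divr_ge0.
  have w1 : k%:R / (K0 * 2 ^ n0)%:R <= 1 :> R by rewrite ler_pdivrMr// mul1r ler_nat ltnW.
  have -> : tk k - T = tau * (k%:R / (K0 * 2 ^ n0)%:R - 2^-1) by rewrite /tk; move: (_%:R / _) => w; field.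
  rewrite normrM gtr0_norm// ler_wpM2l ?(ltW tau0)//.
  by move: w0 w1; move: (_ / _) => w w0 w1; rewrite ler_norml; apply/andP; split; lra.
have tT : `|t - T| <= tau.
  have -> : t - T = (t - tk k) + (tk k - T) by ring.
  by rewrite (le_trans (ler_normD _ _))//; lra.
have phT := Hph BBm tT.
have D0 : 0 <= Bm * r by rewrite mulr_ge0 ?ltW.
have D1 : 2 ^+ n0 * (Bm * r) <= 1.
  by rewrite mulrA mulrC -ler_pdivlMr.
have lipt := pairing_lip (c0 := ph0 l (tk k)) (c1 := ph1 p1 p2 p4 l (tk k))
  (c2 := ph2 p1 p2 p3 l (tk k)) (c3 := ph3 p1 p2 p3 p4 l (tk k))
  (c0' := ph0 l t) (c1' := ph1 p1 p2 p4 l t) (c2' := ph2 p1 p2 p3 l t) (c3' := ph3 p1 p2 p3 p4 l t)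
  fr1 fr2 fr3 fr4 nN Bm1 (pr_fg prf) (pr_gB prf) D0 D1.
have {}lipt : `|pr t n0 - pr (tk k) n0| <= dl / 4.
  apply: (le_trans (lipt _)).
    move=> u v x y hu hv hx hy; rewrite !bilin_cross (le_trans (Hlip _ _ hu hv hx hy))//.
    by rewrite ler_pM ?(le_trans _ B1).
  rewrite mulrA mulrC -ler_pdivlMr//.
have tele : `|pr t n0 - pr t N| <= dl / 4.
  apply: le_trans tail; apply: (telescope_geometric th01 C0 nN) => n /andP[n0n nN'].
  apply: (pairing_step q_gt q_lt om0 om2 phT fr1 fr2 fr3 fr4 ce3 ce4 prPhi prf phiE) => //.
  by apply: leq_trans n0n; exact: leq_maxl.
have pos : pr t N != 0.
  have {}low : dl <= pr (tk k) n0 := low; rewrite gt_eqF//.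
  move: lipt tele; rewrite !ler_norml => /andP[a1 a2] /andP[b1 b2].
  by lra.
have [i [j [a [b [u1 u2 u3 u4 [u5 u6 u7 u8 u9]]]]]] := pairing_hit (pr_fs prf) pos.
by exists i, j, a, b; split=> //; split=> //; rewrite -bilin_cross.
Qed.
End Family.
End UniformHits.

(** * Null sets and thick points *)

Section NullSets.
Variable R : realType.
Implicit Types (s c r : R) (A E : set R).

Definition cball (p : R * R) : set R := [set x | `|x - p.1| <= p.2].

(** Finite covers are enough for compact sets and match the finite minimal cuts. The radii are not
    restricted, since a small sum forces them to be small. *)
Definition content_null s A := forall c, 0 < c -> exists F : seq (R * R),
  [/\ forall p, p \in F -> 0 <= p.2,
      forall x, A x -> exists2 p, p \in F & cball p x &
      \sum_(p <- F) p.2 `^ s <= c].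

Lemma content_null_sub s A E : E `<=` A -> content_null s A -> content_null s E.
Proof.
move=> EA nA c c0; have [F [F0 FA Fc]] := nA c c0.
by exists F; split => // x /EA /FA.
Qed.

Lemma content_null_set0 s : content_null s set0.
Proof. by move=> c c0; exists [::]; split => //; rewrite big_nil ltW. Qed.

Lemma content_nullU s A E : content_null s A -> content_null s E -> content_null s (A `|` E).
Proof.
move=> nA nE c c0; have c2 : 0 < c / 2 by rewrite divr_gt0.
have [F [F0 FA Fc]] := nA _ c2; have [G [G0 GA Gc]] := nE _ c2.
exists (F ++ G); split.
- by move=> p; rewrite mem_cat => /orP[/F0|/G0].
- by move=> x [/FA[p pF px]|/GA[p pF px]]; exists p => //; rewrite mem_cat pF ?orbT.
- by rewrite big_cat /=; lra.
Qed.

Lemma content_null_finite s (I : eqType) (F : seq I) (A : I -> set R) :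
  (forall i, i \in F -> content_null s (A i)) ->
  content_null s [set x | exists2 i, i \in F & A i x].
Proof.
elim: F => [|i F IH] H.
  by apply: content_null_sub (content_null_set0 s) => x [].
apply: content_null_sub (content_nullU (H i (mem_head _ _)) (IH _)).
  move=> x [j]; rewrite inE => /orP[/eqP -> ?|jF ?]; [by left|by right; exists j].
by move=> j jF; apply: H; rewrite inE jF orbT.
Qed.

Lemma diam_cball p : 0 <= p.2 -> exists2 d : R, diam (cball p) = d%:E & 0 <= d <= 2 * p.2.
Proof.
move=> p0.
have le : (diam (cball p) <= (2 * p.2)%:E)%E.
  apply: ge_ereal_sup => _ [x xp [y yp <-]]; rewrite lee_fin.
  have -> : x - y = (x - p.1) - (y - p.1) by ring.
  by rewrite (le_trans (ler_normB _ _))//; move: xp yp; rewrite /cball /=; lra.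
have ge : (0 <= diam (cball p))%E.
  apply: le_ereal_sup_tmp; exists 0%E => //.
  exists p.1; first by rewrite /cball /= subrr normr0.
  by exists p.1; rewrite ?subrr ?normr0// /cball /= subrr normr0.
case: (diam (cball p)) le ge => [d| |] //= dle dge.
by exists d => //; rewrite -!lee_fin dle dge.
Qed.

Lemma hausdorff_of_null s E : 0 < s -> content_null s E -> hausdorff_measure s E = 0%E.
Proof.
move=> s0 nE.
have hc0 A : (0 <= hcontrib s A)%E.
  by rewrite /hcontrib; case: ifP => // _; rewrite lee_fin powR_ge0.
have key d : 0 < d -> hausdorff_delta s d E = 0%E.
  move=> d0; apply/eqP; rewrite eq_le; apply/andP; split; last first.
    by apply: le_ereal_inf_tmp => _ [F _ <-]; apply: nneseries_ge0.
  apply/lee_addgt0Pr => e e0; rewrite add0e.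
  (* The second bound forces every radius below [d / 2], so the cover is admissible for
     [hausdorff_delta]; the first compensates for the diameter being up to twice the radius. *)
  pose c := Num.min (e / 2 `^ s) ((d / 2) `^ s).
  have c0 : 0 < c by rewrite lt_min divr_gt0 ?powR_gt0// ?divr_gt0.
  have [ce cd] : c <= e / 2 `^ s /\ c <= (d / 2) `^ s by rewrite /c !ge_min !lexx orbT.
  have [F [F0 FE Fc]] := nE c c0.
  pose G i := if (i < size F)%N then cball (nth (0, 0) F i) else set0.
  have small p : p \in F -> 2 * p.2 <= d.
    move=> pF; rewrite leNgt; apply/negP => big.
    have : (d / 2) `^ s < p.2 `^ s.
      by apply: gt0_ltr_powR; rewrite ?nnegrE ?F0 ?divr_ge0 ?(ltW d0)//; lra.
    rewrite ltNge; apply/negP; rewrite negbK; apply: le_trans cd; apply: le_trans Fc.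
    rewrite (big_rem p pF) /= lerDl; apply: sumr_ge0 => *; exact: powR_ge0.
  apply: (@ge_ereal_inf _ _ _); exists (\sum_(0 <= i <oo) hcontrib s (G i))%E.
    exists G => //; split.
      move=> x /FE[p pF px]; exists (index p F) => //.
      by rewrite /G index_mem pF nth_index.
    move=> i; rewrite /G; case: ifP => [iF|_].
      have [dd -> /andP[_ d2]] := diam_cball (F0 _ (mem_nth (0, 0) iF)).
      by rewrite lee_fin (le_trans d2)// small// mem_nth.
    by apply: ge_ereal_sup => _ [x [] _ _].
  have part n : (\sum_(0 <= i < n) hcontrib s (G i) <= (2 `^ s * \sum_(p <- F) p.2 `^ s)%:E)%E.
    apply: (@le_trans _ _ (\sum_(0 <= i < maxn n (size F)) hcontrib s (G i))%E).
      by apply: lee_sum_nneg_natr => //; exact: leq_maxl.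
    rewrite (big_cat_nat _ (leq_maxr n (size F)))//= [X in (_ + X)%E]big1_seq ?adde0; last first.
      move=> i /andP[_]; rewrite mem_index_iota => /andP[Fi _].
      rewrite /hcontrib /G ltnNge Fi /=.
      by case: asboolP.
    rewrite (big_nth (0, 0)) mulr_sumr -sumEFin big_nat_cond [leRHS]big_nat_cond.
    apply: lee_sum => i /andP[/andP[_ iF] _].
    rewrite /G iF /hcontrib; case: asboolP => _; first by rewrite lee_fin mulr_ge0// powR_ge0.
    have p0 := F0 _ (mem_nth (0, 0) iF).
    have [dd -> /andP[dd0 d2]] := diam_cball p0.
    rewrite lee_fin /= -powRM//; apply: ge0_ler_powR; rewrite ?nnegrE ?(ltW s0)//.
    by rewrite mulr_ge0.
  apply: (@le_trans _ _ (2 `^ s * \sum_(p <- F) p.2 `^ s)%:E).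
    by apply: lime_le; [apply: is_cvg_nneseries|apply: nearW].
  rewrite lee_fin mulrC -ler_pdivlMr ?powR_gt0//; exact: le_trans ce.
apply/eqP; rewrite eq_le; apply/andP; split.
  by apply: ge_ereal_sup => _ [d d0 <-]; rewrite key.
by apply: le_ereal_sup_tmp; exists 0%E => //; exists 1 => //=; rewrite key.
Qed.

Lemma not_null_of_dim s E : 0 < s -> (s%:E < hausdorff_dim E)%E -> ~ content_null s E.
Proof.
move=> s0; rewrite ltNge => /negP H nE; apply: H.
apply: ge_ereal_inf; exists s%:E => //; exists s => //; split; first exact: ltW.
exact: hausdorff_of_null.
Qed.

End NullSets.

Section GoodPoints.
Variable R : realType.

(** Otherwise finitely many thin balls, together with balls around [S] of arbitrarily small cost,
    would cover the compact set and make it null. Avoiding a given finite [S] lets distinct points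
    be chosen one by one. *)
Lemma thick_point (s : R) (E : set R) (S : seq R) : 0 < s -> compact E -> ~ content_null s E ->
  exists2 p, p \notin S & forall r, 0 < r -> ~ content_null s (E `&` cball (p, r)).
Proof.
move=> s0 cE nE; apply: contrapT => none; apply: nE => c c0.
(* For [p] in [S] the radius is a default value; the implication sits under the quantifier so that
   [rr] is defined everywhere. *)
have thin p : exists r, p \notin S -> 0 < r /\ content_null s (E `&` cball (p, r)).
  apply: contrapT => H; apply: none; exists p.
    by apply/negP => pS; apply: H; exists 0; rewrite pS.
  by move=> r r0 nul; apply: H; exists r.
pose rr p := projT1 (cid (thin p)).
have Hrr p : p \notin S -> 0 < rr p /\ content_null s (E `&` cball (p, rr p)).
  by move=> pS; rewrite /rr; case: cid => r /=; apply.
pose n1 : R := (size S).+1%:R; have n10 : 0 < n1 by rewrite ltr0n.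
pose r0 := (c / 2 / n1) `^ s^-1.
have r00 : 0 < r0 by rewrite powR_gt0// !divr_gt0.
have r0s : r0 `^ s = c / 2 / n1.
  by rewrite /r0 -powRrM mulVf ?gt_eqF// powRr1// !divr_ge0// ltW.
pose U p : set R := ball p (if p \in S then r0 else rr p).
have cov : E `<=` \bigcup_(i in E) U i.
  move=> x Ex; exists x => //; apply: ballxx; case: ifPn => // xS.
  by have [] := Hrr _ xS.
have opn i : E i -> open (U i).
  by move=> _; apply: ball_open; case: ifPn => // iS; have [] := Hrr _ iS.
move: cE; rewrite compact_cover => cE.
have [D _ DE] := cE _ _ _ opn cov.
pose l := [seq i <- enum_fset D | i \notin S].
have nul : content_null s [set x | exists2 i, i \in l & (E `&` cball (i, rr i)) x].
  apply: content_null_finite => i; rewrite mem_filter => /andP[iS _].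
  by have [] := Hrr _ iS.
have c2 : 0 < c / 2 by rewrite divr_gt0.
have [F [F0 FA Fc]] := nul _ c2.
exists ([seq (p, r0) | p <- S] ++ F); split.
- by move=> p; rewrite mem_cat => /orP[/mapP[i _ ->]|/F0//]; exact: ltW.
- move=> x Ex; have [i /= iD] := DE x Ex; rewrite /U -ball_normE /ball_ /= distrC.
  case: ifPn => iS xi.
    exists (i, r0); last exact: ltW.
    by rewrite mem_cat map_f.
  have [|p pF px] := FA x; last by exists p => //; rewrite mem_cat pF orbT.
  by exists i; [rewrite mem_filter iS|split => //; exact: ltW].
- rewrite big_cat /= big_map /= r0s big_const_seq count_predT iter_addr addr0.
  have : c / 2 / n1 *+ size S <= c / 2.
    rewrite -mulr_natr mulrAC ler_pdivrMr// ler_wpM2l ?(ltW c2)//.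
    by rewrite /n1 ler_nat.
  by move=> H; apply: (le_trans (lerD H Fc)); lra.
Qed.

Lemma four_thick_points (s : R) (E : set R) : 0 < s -> compact E -> ~ content_null s E ->
  exists p1 p2 p3 p4, [/\ [/\ p1 != p2, p1 != p3 & p1 != p4], [/\ p2 != p3, p2 != p4 & p3 != p4] &
  forall p, p \in [:: p1; p2; p3; p4] -> forall r, 0 < r -> ~ content_null s (E `&` cball (p, r))].
Proof.
move=> s0 cE nE.
have [p1 _ H1] := thick_point [::] s0 cE nE.
have [p2 + H2] := thick_point [:: p1] s0 cE nE; rewrite !inE => n2.
have [p3 + H3] := thick_point [:: p1; p2] s0 cE nE; rewrite !inE negb_or => /andP[n31 n32].
have [p4 + H4] := thick_point [:: p1; p2; p3] s0 cE nE.
rewrite !inE !negb_or => /and3P[n41 n42 n43].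
exists p1, p2, p3, p4; split.
- by split; rewrite eq_sym.
- by split; rewrite eq_sym.
- by move=> p; rewrite !inE => /or4P[] /eqP ->.
Qed.

End GoodPoints.

(** * Discrete Frostman measures on pieces of the set *)

Section Pieces.
Variable R : realType.

(** For [q = 2^-s] the three inequalities express s < 1, s > 0 and s > 3/4. *)
Lemma half_powR (s : R) : 3 / 4 < s -> s < 1 ->
  [/\ 2^-1 < 2^-1 `^ s, 2^-1 `^ s < 1 & (2^-1 `^ s) ^+ 4 < 8^-1 :> R].
Proof.
move=> s34 s1; have s0 : 0 < s by lra.
have lt1 (r : R) : 0 < r -> 2^-1 `^ r < 1 :> R.
  move=> r0; have E : 1 `^ r = 1 :> R := congr1 (fun g => g r) (@powR1 R).
  by rewrite -[ltRHS]E; apply: gt0_ltr_powR; rewrite ?nnegrE//; lra.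
have q0 : 0 < 2^-1 `^ s :> R by rewrite powR_gt0.
have n0 : (2^-1 : R) != 0 by rewrite invr_eq0.
split; last 1 first.
- rewrite -powR_mulrn ?powR_ge0// -powRrM.
  have -> : s * 4%:R = 3%:R + (s * 4 - 3) by ring.
  rewrite powRD ?n0 ?implybT// powR_mulrn//.
  have h1 : 2^-1 `^ (s * 4 - 3) < 1 :> R by apply: lt1; lra.
  have -> : 2^-1 ^+ 3 = 8^-1 :> R by field.
  by rewrite -[ltRHS]mulr1 ltr_pM2l.
- have h1 : 2^-1 `^ (1 - s) < 1 :> R by apply: lt1; lra.
  have E : 2^-1 = 2^-1 `^ s * 2^-1 `^ (1 - s) :> R.
    by rewrite -powRD ?n0 ?implybT// addrC subrK powRr1.
  by rewrite [ltLHS]E -[ltRHS]mulr1 ltr_pM2l.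
- exact: lt1.
Qed.

Lemma half_pow_powR (s : R) k : (2^-1 ^+ k) `^ s = (2^-1 `^ s) ^+ k :> R.
Proof.
have h0 : 0 <= 2^-1 :> R by rewrite invr_ge0.
elim: k => [|k IH]; first by rewrite !expr0 powR1.
by rewrite !exprS powRM ?exprn_ge0// IH.
Qed.

(** Radius [l / 8] puts the set in the middle quarter of the unit interval, so dyadic intervals of
    length at most 1/4 that meet it stay within [1/4, 3/4]. [m] precedes [N]: it is a lower bound
    for the cost of all covers, rescaled by [l]. *)
Lemma piece_frostman (s p l : R) (E : set R) : 0 < s -> 0 < l ->
  E `<=` cball (p, l / 8) -> ~ content_null s E ->
  exists2 m : R, 0 < m & forall N, exists mu,
    [/\ frostman (2^-1 `^ s) N mu, centred N mu, m <= mu 0 0 &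
     forall j, mu N j != 0 -> exists2 w, E (bx p l w) & j%:R <= w * 2 ^+ N <= j.+1%:R].
Proof.
move=> s0 l0 Ep nE; set q := 2^-1 `^ s.
have q0 : 0 < q by rewrite powR_gt0.
have [c0 c00 Hc] : exists2 c0, 0 < c0 & forall F : seq (R * R), (forall p, p \in F -> 0 <= p.2) ->
   (forall x, E x -> exists2 p, p \in F & cball p x) -> c0 < \sum_(p <- F) p.2 `^ s.
  apply: contrapT => H; apply: nE => c cp; apply: contrapT => H2; apply: H.
  exists c => // F F0 FE; rewrite ltNge; apply/negP => Fc.
  by apply: H2; exists F.
have ls : 0 < l `^ s by rewrite powR_gt0.
exists (c0 / l `^ s); first by rewrite divr_gt0.
move=> N.
pose meets i := `[< exists2 w, E (bx p l w) & i%:R <= w * 2 ^+ N < i.+1%:R >].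
have tN n : 0 < 2 ^+ n :> R by rewrite exprn_gt0.
have wr w : E (bx p l w) -> 3 / 8 <= w <= 5 / 8.
  move=> /Ep; rewrite /cball /= ; have -> : bx p l w - p = l * (w - 2^-1) by rewrite /bx; field.
  rewrite normrM (gtr0_norm l0) ler_pM2l// ler_norml => /andP[? ?].
  by apply/andP; split; lra.
have [mu [fr supp [F [FN Fcov Fsum]]]] := frostman_exists N meets q0.
exists mu; split=> //.
- move=> n j /andP[n2 nN] mn.
  have [i [/asboolP[w Ew /andP[w1 w2]] ij]] := supp n j nN mn.
  have /andP[w3 w4] := wr w Ew.
  have EN : (2 ^ N = 4 * (2 ^ (n - 2) * 2 ^ (N - n)))%N.
    by rewrite -expnD -(expnD 2 2) addnA (subnKC n2) (subnKC nN).
  have E2 : (2 ^ n = 4 * 2 ^ (n - 2))%N.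
    by rewrite -(expnD 2 2) (subnKC n2).
  have i1 : (2 ^ (n - 2) * 2 ^ (N - n) <= i)%N.
    have : (2 ^ N < 4 * i.+1)%N.
      rewrite -(ltr_nat R) natrM natrX; apply: (@le_lt_trans _ _ (4 * (w * 2 ^+ N))).
        by rewrite mulrA ler_peMl ?(ltW (tN N))//; lra.
      by rewrite ltr_pM2l.
    by rewrite EN ltn_pmul2l.
  have i2 : (i < 3 * (2 ^ (n - 2) * 2 ^ (N - n)))%N.
    have : (4 * i < 3 * 2 ^ N)%N.
      rewrite -(ltr_nat R) !natrM natrX; apply: (@le_lt_trans _ _ (4 * (w * 2 ^+ N))).
        by rewrite ler_pM2l.
      by rewrite mulrA ltr_pM2r//; lra.
    by rewrite EN mulnCA ltn_pmul2l.
  have b0 : (0 < 2 ^ (N - n))%N by rewrite expn_gt0.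
  have j1 : (2 ^ (n - 2) <= j)%N by rewrite -ij leq_divRL.
  have j2 : (j < 3 * 2 ^ (n - 2))%N by rewrite -ij ltn_divLR// -mulnA.
  rewrite E2; split; first by rewrite leq_pmul2l.
  by rewrite mulnCA leq_pmul2l.
- rewrite ler_pdivrMr//; apply: (@le_trans _ _ (\sum_(p <- F) q ^+ p.1 * l `^ s)); last first.
    by rewrite -mulr_suml ler_wpM2r// ltW.
  (* A dyadic interval lies in the ball around its left end whose radius is its length, so the
     minimal cut is an admissible cover by balls. *)
  pose G := [seq (bx p l (x.2%:R * 2^-1 ^+ x.1), l * 2^-1 ^+ x.1) | x <- F].
  have -> : \sum_(p <- F) q ^+ p.1 * l `^ s = \sum_(p <- G) p.2 `^ s.
    rewrite big_map; apply: eq_bigr => x _ /=.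
    by rewrite powRM ?exprn_ge0 ?invr_ge0 ?(ltW l0)// half_pow_powR mulrC.
  apply/ltW/Hc.
    by move=> _ /mapP[x _ ->] /=; rewrite mulr_ge0 ?exprn_ge0 ?invr_ge0 ?(ltW l0).
  move=> x Ex; pose w := (x - p + l / 2) / l.
  have xw : x = bx p l w by rewrite /bx /w; field; rewrite gt_eqF.
  rewrite xw in Ex *; have /andP[w1 w2] := wr w Ex.
  have w0 : 0 <= w * 2 ^+ N by rewrite mulr_ge0 ?(ltW (tN N))//; lra.
  have /andP[t1 t2] := truncn_itv w0; set i := Num.truncn _ in t1 t2.
  have mi : meets i by apply/asboolP; exists w => //; rewrite t1 t2.
  have iN : (i < 2 ^ N)%N.
    rewrite -(ltr_nat R) natrX; apply: (le_lt_trans t1).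
    by rewrite -[ltRHS]mul1r ltr_pM2r//; lra.
  have [y yF yi] := Fcov i mi iN; have yN := FN y yF.
  exists (bx p l (y.2%:R * 2^-1 ^+ y.1), l * 2^-1 ^+ y.1); first by rewrite /G map_f.
  rewrite /cball /=.
  have -> : bx p l w - bx p l (y.2%:R * 2^-1 ^+ y.1) = l * (w - y.2%:R * 2^-1 ^+ y.1).
    by rewrite /bx; ring.
  rewrite normrM (gtr0_norm l0) ler_pM2l//.
  have b0 : (0 < 2 ^ (N - y.1))%N by rewrite expn_gt0.
  have a1 : (y.2 * 2 ^ (N - y.1) <= i)%N by rewrite -yi leq_divM.
  have a2 : (i.+1 <= y.2.+1 * 2 ^ (N - y.1))%N by rewrite -yi ltn_ceil.
  have EN : 2 ^+ N = 2 ^+ (N - y.1) * 2 ^+ y.1 :> R by rewrite -exprD subnK.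
  have c1 : y.2%:R <= w * 2 ^+ y.1.
    rewrite -(ler_pM2r (tN (N - y.1)%N)) -mulrA [2 ^+ y.1 * _]mulrC -EN.
    by apply: le_trans t1; rewrite -natrX -natrM ler_nat.
  have c2 : w * 2 ^+ y.1 <= y.2.+1%:R.
    rewrite -(ler_pM2r (tN (N - y.1)%N)) -mulrA [2 ^+ y.1 * _]mulrC -EN.
    by apply: (le_trans (ltW t2)); rewrite -natrX -natrM ler_nat.
  have Xn := lt0r_neq0 (tN y.1).
  have -> : w - y.2%:R * 2^-1 ^+ y.1 = (w * 2 ^+ y.1 - y.2%:R) / 2 ^+ y.1.
    by rewrite exprVn; field.
  rewrite exprVn normrM normfV (gtr0_norm (tN y.1)) ler_pdivrMr// mulVf//.
  by move: c2; rewrite -natr1 ler_norml => c2; apply/andP; split; lra.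
- move=> j mj; have [i [/asboolP[w Ew /andP[w1 w2]] ij]] := supp N j (leqnn N) mj.
  by exists w => //; move: ij; rewrite subnn expn0 divn1 => <-; rewrite w1 ltW.
Qed.

End Pieces.

(** * Passage to the limit *)

Lemma pigeonhole_infinite (P : nat -> nat -> Prop) n0 K :
  (forall N, (n0 <= N)%N -> exists2 k, (k < K)%N & P N k) ->
  exists2 k, (k < K)%N & forall N0, exists2 N, (N0 <= N)%N & P N k.
Proof.
move=> H; apply: contrapT => none.
have [N0 HN0] : exists N0, forall N, (N0 <= N)%N -> forall k, (k < K)%N -> ~ P N k.
  have : forall k, (k < K)%N -> exists N0, forall N, (N0 <= N)%N -> ~ P N k.
    move=> k kK; apply: contrapT => H1; apply: none; exists k => // N0.
    apply: contrapT => H2; apply: H1; exists N0 => N NN PN; apply: H2.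
    by exists N.
  move: {H none} K => K; elim: K => [|K IH] Hk; first by exists 0%N.
  have [|N1 H1] := IH; first by move=> k kK; apply: Hk; exact: leqW.
  have [N2 H2] := Hk K (ltnSn K).
  exists (maxn N1 N2) => N; rewrite geq_max => /andP[NN1 NN2] k.
  by rewrite ltnS leq_eqVlt => /orP[/eqP -> |]; [exact: H2|exact: H1].
have [k kK PN] := H (maxn n0 N0) (leq_maxl _ _).
exact: (HN0 _ (leq_maxr _ _) k kK PN).
Qed.

Section Final.
Variable R : realType.

Lemma cross_form_lip (t D h x1 x2 x3 x4 y1 y2 y3 y4 : R) : 0 <= h ->
  `|x3 - x1| <= D -> `|x3 - x2| <= D -> `|y4 - y2| <= D -> `|y4 - y1| <= D ->
  `|x1 - y1| <= h -> `|x2 - y2| <= h -> `|x3 - y3| <= h -> `|x4 - y4| <= h ->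
  `|cross_form t x1 x2 x3 x4 - cross_form t y1 y2 y3 y4| <= (1 + `|t|) * (4 * D * h).
Proof.
move=> h0 a b c d e1 e2 e3 e4.
have D0 : 0 <= D by apply: le_trans a.
have prod (p q p' q' : R) : `|p| <= D -> `|q'| <= D -> `|p - p'| <= 2 * h -> `|q - q'| <= 2 * h ->
    `|p * q - p' * q'| <= 4 * D * h.
  move=> hp hq' dp dq; have -> : p * q - p' * q' = p * (q - q') + (p - p') * q' by ring.
  rewrite (le_trans (ler_normD _ _))// !normrM.
  have : `|p| * `|q - q'| <= D * (2 * h) by rewrite ler_pM.
  by have : `|p - p'| * `|q'| <= (2 * h) * D by [rewrite ler_pM]; lra.
have dif (p q p' q' : R) : `|p - p'| <= h -> `|q - q'| <= h -> `|(p - q) - (p' - q')| <= 2 * h.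
  move=> hp hq; have -> : (p - q) - (p' - q') = (p - p') - (q - q') by ring.
  by rewrite (le_trans (ler_normB _ _))//; lra.
have -> : cross_form t x1 x2 x3 x4 - cross_form t y1 y2 y3 y4 =
  ((x3 - x1) * (x4 - x2) - (y3 - y1) * (y4 - y2))
  - t * ((x3 - x2) * (x4 - x1) - (y3 - y2) * (y4 - y1)) by rewrite /cross_form; ring.
rewrite (le_trans (ler_normB _ _))// [leRHS]mulrDl mul1r lerD// ?normrM ?ler_wpM2l//.
  by apply: prod => //; apply: dif.
by apply: prod => //; apply: dif.
Qed.

Lemma dist_near_points (p1 p2 p3 p4 l p p' x y : R) :
  p \in [:: p1; p2; p3; p4] -> p' \in [:: p1; p2; p3; p4] ->
  `|x - p| <= l / 2 -> `|y - p'| <= l / 2 ->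
  `|x - y| <= 2 * (`|p1| + `|p2| + `|p3| + `|p4| + l).
Proof.
have big q : q \in [:: p1; p2; p3; p4] -> `|q| <= `|p1| + `|p2| + `|p3| + `|p4|.
  move: (normr_ge0 p1) (normr_ge0 p2) (normr_ge0 p3) (normr_ge0 p4) => ? ? ? ?.
  by rewrite !inE => /or4P[] /eqP ->; lra.
move=> /big b1 /big b2 xp yp; have -> : x - y = (x - p) - (y - p') + (p - p') by ring.
rewrite (le_trans (ler_normD _ _))//.
by move: (normr_ge0 (x - p)) (ler_normB (x - p) (y - p')) (ler_normB p p'); lra.
Qed.

Lemma bx_close (p l w y : R) N a : 0 < l ->
  a%:R <= w * 2 ^+ N <= a.+1%:R -> a%:R <= y * 2 ^+ N <= a.+1%:R ->
  `|bx p l w - bx p l y| <= l * 2^-1 ^+ N.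
Proof.
move=> l0; have tN : 0 < 2 ^+ N :> R by rewrite exprn_gt0.
rewrite -natr1 => /andP[wa wb] /andP[ya yb].
have -> : bx p l w - bx p l y = l * (w * 2 ^+ N - y * 2 ^+ N) * 2^-1 ^+ N.
  by rewrite /bx exprVn; field; rewrite gt_eqF.
rewrite normrM (ger0_norm (x := _ ^+ N)) ?exprn_ge0 ?invr_ge0// ler_wpM2r ?exprn_ge0 ?invr_ge0//.
by rewrite normrM (gtr0_norm l0) ler_piMr ?(ltW l0)// ler_norml; apply/andP; split; lra.
Qed.

(** The image of the product under [cross_form t] is compact, hence closed, and 0 is adherent to
    it. *)
Lemma compact_cross_zero (t : R) (A1 A2 A3 A4 : set R) :
  compact A1 -> compact A2 -> compact A3 -> compact A4 ->
  (forall e, 0 < e -> exists x1 x2 x3 x4, [/\ A1 x1, A2 x2, A3 x3 & A4 x4] /\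
     `|cross_form t x1 x2 x3 x4| <= e) ->
  exists x1 x2 x3 x4, [/\ A1 x1, A2 x2, A3 x3 & A4 x4] /\ cross_form t x1 x2 x3 x4 = 0.
Proof.
move=> K1 K2 K3 K4 small.
pose f (p : (R * R) * (R * R)) : R := cross_form t p.1.1 p.1.2 p.2.1 p.2.2.
pose K := (A1 `*` A2) `*` (A3 `*` A4).
have cf : continuous f.
  move=> p; rewrite /f /cross_form.
  have c11 : (fun x : (R * R) * (R * R) => x.1.1) @ p --> p.1.1.
    by apply: (cvg_comp fst fst); [exact: cvg_fst|exact: cvg_fst].
  have c12 : (fun x : (R * R) * (R * R) => x.1.2) @ p --> p.1.2.
    by apply: (cvg_comp fst snd); [exact: cvg_fst|exact: cvg_snd].
  have c21 : (fun x : (R * R) * (R * R) => x.2.1) @ p --> p.2.1.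
    by apply: (cvg_comp snd fst); [exact: cvg_snd|exact: cvg_fst].
  have c22 : (fun x : (R * R) * (R * R) => x.2.2) @ p --> p.2.2.
    by apply: (cvg_comp snd snd); [exact: cvg_snd|exact: cvg_snd].
  apply: cvgB; first by apply: cvgM; apply: cvgB.
  by apply: cvgM; [exact: cvg_cst|apply: cvgM; apply: cvgB].
have cK : compact (f @` K).
  apply: continuous_compact; first exact: continuous_subspaceT.
  by do !apply: compact_setX.
have clK := compact_closed (@Rhausdorff R) cK.
have : (f @` K) 0.
  apply: clK => /= V /nbhs_ballP[e /= e0 eV].
  have e2 : 0 < e / 2 by rewrite divr_gt0.
  have [x1 [x2 [x3 [x4 [[h1 h2 h3 h4] hx]]]]] := small _ e2.
  exists (f ((x1, x2), (x3, x4))); split; first by exists ((x1, x2), (x3, x4)).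
  apply: eV; rewrite -ball_normE /ball_ /= sub0r normrN /f /=.
  by apply: (le_lt_trans hx); lra.
move=> [[[x1 x2] [x3 x4]] /= [[h1 h2] [h3 h4]] fx].
by exists x1, x2, x3, x4.
Qed.

Lemma compact_cball (E : set R) p : compact E -> compact (E `&` cball p).
Proof.
move=> cE; apply: (subclosed_compact _ cE); last by move=> x [].
apply: closedI; first exact: compact_closed (@Rhausdorff R) cE.
have -> : cball p = [set` `[p.1 - p.2, p.1 + p.2]].
  apply/seteqP; split => x; rewrite /cball /= in_itv /= ler_norml => /andP[? ?];
    by apply/andP; split; lra.
exact: itv_closed.
Qed.

End Final.

Unset Implicit Arguments.

Theorem theorem1p4 (R : realType) (E : set R) :
  compact E ->
  ((3 / 4 : R)%:E < hausdorff_dim E)%E ->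
  exists a b : R, a < b /\ `]a, b[ `<=` Cross E.
Proof.
move=> cE dE.
have [s [s34 s1 sE]] : exists s : R, [/\ 3 / 4 < s, s < 1 & (s%:E < hausdorff_dim E)%E].
  case: (hausdorff_dim E) dE => [r| |] //; rewrite ?lte_fin.
    (* The cap 7/8 keeps s below 1, where the sum over dyadic distances is a convergent geometric
       series. *)
    move=> h; exists (Num.min ((3 / 4 + r) / 2) (7 / 8)).
    rewrite lte_fin lt_min !gt_min; split.
    - by apply/andP; split; lra.
    - by apply/orP; right; lra.
    - by apply/orP; left; lra.
  by move=> _; exists (7 / 8); split; rewrite ?ltry//; lra.
have s0 : 0 < s by lra.
have nE := not_null_of_dim s0 sE.
have [p1 [p2 [p3 [p4 [d1 d2 thick]]]]] := four_thick_points s0 cE nE.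
have [T [tau [l [B [[tau0 l0 B1] [Hph Hroot Hlip Hsep]]]]]] := cross_ratio_geometry d1 d2.
have l8 : 0 < l / 8 by rewrite divr_gt0.
have piece p : p \in [:: p1; p2; p3; p4] -> _ := fun hp =>
  piece_frostman s0 l0 (@subIsetr _ E (cball (p, l / 8))) (thick p hp _ l8).
have [m1 m10 F1] := piece p1 (mem_head _ _).
have [|m2 m20 F2] := piece p2; first by rewrite !inE eqxx orbT.
have [|m3 m30 F3] := piece p3; first by rewrite !inE eqxx !orbT.
have [|m4 m40 F4] := piece p4; first by rewrite !inE eqxx !orbT.
pose m := Num.min (Num.min m1 m2) (Num.min m3 m4).
have m0 : 0 < m by rewrite !lt_min m10 m20 m30 m40.
have [l1 [l2 [l3 l4]]] : m <= m1 /\ m <= m2 /\ m <= m3 /\ m <= m4.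
  by rewrite /m !ge_min !lexx ?orbT.
have [q1 q2 q4] := half_powR s34 s1.
have [n0 [K [tk [r [r0 hits]]]]] := uniform_hits tau0 B1 Hph Hroot Hlip q1 q2 q4 m0.
pose D : R := 2 * (`|p1| + `|p2| + `|p3| + `|p4| + l).
pose sol N t := exists x1 x2 x3 x4,
  [/\ (E `&` cball (p1, l / 2)) x1, (E `&` cball (p2, l / 2)) x2,
      (E `&` cball (p3, l / 2)) x3 & (E `&` cball (p4, l / 2)) x4] /\
  `|cross_form t x1 x2 x3 x4| <= ((1 + `|t|) * (4 * D * l) + 1) * 2^-1 ^+ N.
have D_bound p p' x y : p \in [:: p1; p2; p3; p4] -> p' \in [:: p1; p2; p3; p4] ->
    `|x - p| <= l / 2 -> `|y - p'| <= l / 2 -> `|x - y| <= D by exact: dist_near_points.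
have l82 : l / 8 <= l / 2 by rewrite ler_pM2l// lef_pV2 ?posrE// ler_nat.
pose supported (mu : nat -> nat -> R) p N := forall j, mu N j != 0 ->
  exists2 w, (E `&` cball (p, l / 8)) (bx p l w) & j%:R <= w * 2 ^+ N <= j.+1%:R.
have hit_sol N mu1 mu2 mu3 mu4 t :
   supported mu1 p1 N ->
   supported mu2 p2 N ->
   supported mu3 p3 N ->
   supported mu4 p4 N ->
   hit p1 p2 p3 p4 l N mu1 mu2 mu3 mu4 t -> sol N t.
  move=> S1 S2 S3 S4 [i [j [k [k' [/S1[w1 [E1 c1] i1] /S2[w2 [E2 c2] i2] /S3[w3 [E3 c3] i3]
    /S4[w4 [E4 c4] i4] [iN jN kN kN' small]]]]]].
  have sub p x : cball (p, l / 8) x -> `|x - p| <= l / 2.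
    by rewrite /cball /= => h; exact: le_trans l82.
  have coarse a : a%:R <= dyadic R N a * 2 ^+ N <= a.+1%:R.
    rewrite /dyadic -mulrA -exprMn mulVf ?pnatr_eq0// expr1n mulr1 lexx /=.
    by rewrite ler_nat.
  have fine a : (a %/ 2 ^ (5 * N - N))%:R <= dyadic R (5 * N) a * 2 ^+ N <= (a %/ 2 ^ (5 * N - N)).+1%:R.
    set b := (5 * N - N)%N; have b0 : (0 < 2 ^ b)%N by rewrite expn_gt0.
    have b0r : 0 < (2 ^ b)%:R :> R by rewrite ltr0n.
    have E5 : (5 * N = b + N)%N by rewrite /b subnK// leq_pmull.
    have -> : dyadic R (5 * N) a * 2 ^+ N = a%:R / (2 ^ b)%:R.
      rewrite /dyadic E5 exprD natrX !exprVn; field.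
      by rewrite !expf_neq0// pnatr_eq0.
    rewrite ler_pdivlMr// ler_pdivrMr// -!natrM !ler_nat leq_divM /=.
    by rewrite ltnW// ltn_ceil.
  (* Each grid point shares its cell of level [N] with one of these points of [E], at distance at
     most [l * 2^-1 ^+ N]; the Lipschitz bound turns this into the extra constant in [sol]. *)
  exists (bx p1 l w1), (bx p2 l w2), (bx p3 l w3), (bx p4 l w4); split.
    by split; split => //; apply: sub.
  have L0 : 0 <= l * 2^-1 ^+ N by rewrite mulr_ge0 ?(ltW l0)// exprn_ge0// invr_ge0.
  have in1 : p1 \in [:: p1; p2; p3; p4] by rewrite mem_head.
  have in2 : p2 \in [:: p1; p2; p3; p4] by rewrite !inE eqxx orbT.
  have in3 : p3 \in [:: p1; p2; p3; p4] by rewrite !inE eqxx !orbT.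
  have in4 : p4 \in [:: p1; p2; p3; p4] by rewrite !inE eqxx !orbT.
  have n1 := bx_near p1 (ltW l0) (dyadic_unit R iN).
  have n2 := bx_near p2 (ltW l0) (dyadic_unit R jN).
  have n4 := bx_near p4 (ltW l0) (dyadic_unit R kN').
  have := cross_form_lip t L0 (D_bound _ _ _ _ in3 in1 (sub _ _ c3) (sub _ _ c1))
    (D_bound _ _ _ _ in3 in2 (sub _ _ c3) (sub _ _ c2)) (D_bound _ _ _ _ in4 in2 n4 n2)
    (D_bound _ _ _ _ in4 in1 n4 n1) (bx_close p1 l0 i1 (coarse i)) (bx_close p2 l0 i2 (coarse j))
    (bx_close p3 l0 i3 (fine k)) (bx_close p4 l0 i4 (fine k')).
  move: small; set X := cross_form _ _ _ _ _; set Y := cross_form _ _ _ _ _ => hX hY.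
  have -> : Y = (Y - X) + X by ring.
  rewrite (le_trans (ler_normD _ _))// [leRHS]mulrDl mul1r lerD//.
  by rewrite (le_trans hY)// le_eqVlt; apply/orP; left; apply/eqP; ring.
have near_sol N : (n0 <= N)%N -> exists2 k, (k < K)%N & forall t, `|t - tk k| <= r -> sol N t.
  move=> nN.
  have [mu1 [fr1 ce1 mm1 S1]] := F1 N; have [mu2 [fr2 ce2 mm2 S2]] := F2 N.
  have [mu3 [fr3 ce3 mm3 S3]] := F3 N; have [mu4 [fr4 ce4 mm4 S4]] := F4 N.
  have [k kK Hk] := hits N mu1 mu2 mu3 mu4 nN fr1 fr2 fr3 fr4 ce3 ce4
    (le_trans l1 mm1) (le_trans l2 mm2) (le_trans l3 mm3) (le_trans l4 mm4).
  by exists k => // t /Hk; exact: hit_sol.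
have [k kK inf] := pigeonhole_infinite near_sol.
exists (tk k - r), (tk k + r); split; first by rewrite ltrD2l -subr_gt0 opprK addr_gt0.
move=> t; rewrite /= in_itv /= => /andP[t1 t2].
have tt : `|t - tk k| <= r by rewrite ler_distl !ltW.
have [|x1 [x2 [x3 [x4 [[[X1 Y1] [X2 Y2] [X3 Y3] [X4 Y4]] z]]]]] :=
  compact_cross_zero (t := t) (compact_cball (p := (p1, l / 2)) cE) (compact_cball (p := (p2, l / 2)) cE)
  (compact_cball (p := (p3, l / 2)) cE) (compact_cball (p := (p4, l / 2)) cE).
  move=> e e0; pose C := (1 + `|t|) * (4 * D * l) + 1.
  have C0 : 0 < C.
    apply: ltr_wpDl => //; rewrite mulr_ge0 ?addr_ge0// mulr_ge0 ?(ltW l0)// mulr_ge0// mulr_ge0//.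
    by rewrite !addr_ge0 // ltW.
  have h01 : 0 <= (2^-1 : R) < 1 by rewrite invr_ge0 invf_lt1 ?ltr1n ?ler0n.
  have [N1 HN1] := exp_small h01 (divr_gt0 e0 C0).
  have [N NN PN] := inf N1; have [x1 [x2 [x3 [x4 [hx hs]]]]] := PN t tt.
  exists x1, x2, x3, x4; split => //; apply: (le_trans hs); rewrite -/C mulrC -ler_pdivlMr//.
  exact: HN1.
have den := Hsep x1 x2 x3 x4 Y1 Y2 Y3 Y4.
exists x1, x2, x3, x4; split => //; split => //.
rewrite /cross_ratio; apply/eqP; rewrite -(inj_eq (mulIf den)) divfK//.
by move/eqP: z; rewrite /cross_form subr_eq0 eq_sym.
Qed.
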